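(* Let $d\ge1$ be an integer and let $d\mu=\mu\,dx$ with $\mu(x)=(2\pi)^{-d/2}e^{-|x|^2/2}$ be the normalized Gaussian measure on $\mathbb R^d$. Define $$\varphi(t):=\frac d4\left[\exp\left(\frac{2t}{d}\right)-1-\frac{2t}{d}\right]\qquad\forall\,t\in\mathbb R.$$ Then for every $u\in \mathrm H^1(\mathbb R^d,d\mu)$ such that $\int_{\mathbb R^d}|u|^2\,d\mu=1$ and $\int_{\mathbb R^d}|x|^2|u|^2\,d\mu=d$, one has $$\int_{\mathbb R^d}|\nabla u|^2\,d\mu-\frac12\int_{\mathbb R^d}|u|^2\log|u|^2\,d\mu\;\ge\;\varphi\left(\int_{\mathbb R^d}|u|^2\log|u|^2\,d\mu\right).$$
   Context: $\mathrm H^1(\mathbb R^d,d\mu)$ is the space of (real-valued) functions $u\in \mathrm L^2(\mathbb R^d,d\mu)$ whose weak gradient belongs to $\mathrm L^2(\mathbb R^d,d\mu)$. Convention: $0\log 0=0$. *)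

(* Defs.v *)
From HB Require Import structures.
From mathcomp Require Import all_boot all_order all_algebra.
From mathcomp Require Import all_classical all_reals all_analysis.
From mathcomp Require Import measurable_realfun.

Set Implicit Arguments.
Unset Strict Implicit.
Unset Printing Implicit Defensive.
Import Order.TTheory GRing.Theory Num.Theory.
Import numFieldNormedType.Exports.
Local Open Scope classical_set_scope.
Local Open Scope ring_scope.

Section measurable_rV.
Context (R : realType) (n : nat).

Let coord : 'I_n -> 'rV[R]_n -> R := fun i x => x 0 i.

Let rV_set0 : g_sigma_preimage coord set0.
Proof. exact: sigma_algebra0. Qed.

Let rV_setC A : g_sigma_preimage coord A -> g_sigma_preimage coord (~` A).
Proof. exact: sigma_algebraC. Qed.

Let rV_bigcup (F : (set 'rV[R]_n)^nat) :
  (forall i, g_sigma_preimage coord (F i)) ->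
  g_sigma_preimage coord (\bigcup_i F i).
Proof. exact: sigma_algebra_bigcup. Qed.

(* The sigma-algebra generated by the coordinate maps, i.e. the Borel
   sigma-algebra of R^n, set up as for [n.-tuple R]. Row vectors are used
   instead of tuples because they carry the topology needed for derivatives. *)
HB.instance Definition _ := @isMeasurable.Build
  (measure_tuple_display default_measure_display) 'rV[R]_n
  (g_sigma_preimage coord) rV_set0 rV_setC rV_bigcup.

End measurable_rV.

Lemma measurable_coord (R : realType) n (i : 'I_n) :
  measurable_fun [set: 'rV[R]_n] (fun x => x 0 i).
Proof.
move=> _ Y mY; rewrite setTI; apply: sub_sigma_algebra => /=.
rewrite -bigcup_seq/=; exists i => /=; first by rewrite mem_index_enum.
by exists Y => //; rewrite setTI.
Qed.

Lemma measurable_fun_rVP (R : realType) d (T : measurableType d) n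
    (f : T -> 'rV[R]_n) :
  measurable_fun [set: T] f <->
  forall i, measurable_fun [set: T] (fun x => f x 0 i).
Proof.
split=> [mf i|mf].
  by apply: (measurableT_comp (f := fun y : 'rV[R]_n => y 0 i)) => //;
     exact: measurable_coord.
apply: (@measurability _ _ _ _ _ _
  (\big[setU/set0]_(i < n) preimage_set_system setT
     (fun x : 'rV[R]_n => x 0 i) measurable)) => //.
move=> _ [B + <-]; rewrite -bigcup_seq => -[i _] [C mC <-].
by rewrite !setTI; have := mf i measurableT C mC; rewrite setTI.
Qed.

Section lebesgue_rV.
Context (R : realType).

Definition rV_cons n (p : measurableTypeR R * 'rV[R]_n) : 'rV[R]_n.+1 :=
  \row_i oapp (p.2 0) p.1 (unlift ord0 i).

Definition rV_uncons n (x : 'rV[R]_n.+1) : measurableTypeR R * 'rV[R]_n :=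
  (x 0 ord0, \row_i x 0 (lift ord0 i)).

Lemma rV_consK n : cancel (@rV_cons n) (@rV_uncons n).
Proof.
move=> [a x]; rewrite /rV_uncons /rV_cons mxE unlift_none/=; congr pair.
by apply/rowP => i; rewrite !mxE liftK.
Qed.

Lemma rV_unconsK n : cancel (@rV_uncons n) (@rV_cons n).
Proof.
move=> x; apply/rowP => i; rewrite !mxE.
by case: unliftP => [j ->|->]//=; rewrite mxE.
Qed.

Lemma measurable_rV_cons n : measurable_fun setT (@rV_cons n).
Proof.
apply/measurable_fun_rVP => i; rewrite /rV_cons.
under eq_fun do rewrite mxE.
case: unliftP => [j _|_] /=; last exact: measurable_fst.
by apply: (measurableT_comp (f := fun y : 'rV[R]_n => y 0 j)) => //;
   exact: measurable_coord.
Qed.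

Lemma measurable_rV_uncons n : measurable_fun setT (@rV_uncons n).
Proof.
apply/measurable_fun_pair; first exact: measurable_coord.
apply/measurable_fun_rVP => i; under eq_fun do rewrite mxE.
exact: measurable_coord.
Qed.

Section push_rV_cons.
Variables (n : nat)
  (m : {sigma_finite_measure set 'rV[R]_n -> \bar R}).

Definition push_rV_cons : set 'rV[R]_n.+1 -> \bar R :=
  pushforward (@lebesgue_measure R \x m)%E (@rV_cons n).

Let push0 : push_rV_cons set0 = 0%E.
Proof. by rewrite /push_rV_cons /pushforward preimage_set0 measure0. Qed.

Let push_ge0 A : (0 <= push_rV_cons A)%E.
Proof. by rewrite /push_rV_cons /pushforward; apply: measure_ge0. Qed.

Let push_sigma_additive : semi_sigma_additive push_rV_cons.
Proof.
move=> F mF tF mUF; rewrite /push_rV_cons /pushforward preimage_bigcup.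
apply: measure_semi_sigma_additive.
- by move=> k; rewrite -[X in measurable X]setTI; exact: measurable_rV_cons.
- apply/trivIsetP => /= i j _ _ ij; rewrite -preimage_setI.
  by move/trivIsetP : tF => /(_ _ _ _ _ ij) ->//; rewrite preimage_set0.
- rewrite -preimage_bigcup -[X in measurable X]setTI.
  exact: measurable_rV_cons.
Qed.

HB.instance Definition _ := isMeasure.Build _ _ _ push_rV_cons
  push0 push_ge0 push_sigma_additive.

Let push_sigma_finite : sigma_finite setT push_rV_cons.
Proof.
have /sigma_finiteP[F [TF ndF Foo]] := sigma_finiteT (@lebesgue_measure R).
have /sigma_finiteP[G [TG ndG Goo]] := sigma_finiteT m.
exists (fun k => @rV_uncons n @^-1` (F k `*` G k)).
  rewrite -preimage_bigcup [X in _ @^-1` X](_ : _ = setT) ?preimage_setT//.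
  apply/seteqP; split => // -[x y] _.
  have [k _ Fkx] : (\bigcup_k F k) x by rewrite -TF.
  have [l _ Gly] : (\bigcup_k G k) y by rewrite -TG.
  exists (maxn k l) => //; split => /=.
    by move: x Fkx; exact/subsetPset/ndF/leq_maxl.
  by move: y Gly; exact/subsetPset/ndG/leq_maxr.
move=> k; have [mF Fk] := Foo k; have [mG Gk] := Goo k; split.
  rewrite -[X in measurable X]setTI.
  exact: measurable_rV_uncons (measurableX mF mG).
rewrite /push_rV_cons /pushforward -comp_preimage.
rewrite (_ : _ \o _ = id) ?preimage_id; last first.
  by apply/funext => p /=; rewrite rV_consK.
by rewrite product_measure1E// lte_mul_pinfty// ge0_fin_numE.
Qed.

HB.instance Definition _ := Measure_isSigmaFinite.Build _ _ _ push_rV_cons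
  push_sigma_finite.

End push_rV_cons.

(* Lebesgue measure on R^n as the n-fold product of Lebesgue measure on R; its
   values on boxes are given by [lebesgue_rV_box] below. *)
Fixpoint lebesgue_rV n : {sigma_finite_measure set 'rV[R]_n -> \bar R} :=
  if n is n'.+1 then
    push_rV_cons (lebesgue_rV n')
  else \d_(0 : 'rV[R]_0).

End lebesgue_rV.

Lemma lebesgue_rV_box (R : realType) n (A : 'I_n -> set R) :
  (forall i, measurable (A i)) ->
  lebesgue_rV R n [set x | forall i, A i (x 0 i)] =
  (\prod_(i < n) lebesgue_measure (A i))%E.
Proof.
elim: n => [|n IHn] in A * => mA.
  by rewrite big_ord0 /= diracE mem_set//; case.
have mB : measurable [set x : 'rV[R]_n | forall i, A (lift ord0 i) (x 0 i)].
  rewrite (_ : [set _ | _] = \bigcap_(i in [set: 'I_n])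
      ((fun x : 'rV[R]_n => x 0 i) @^-1` A (lift ord0 i))); last first.
    by apply/seteqP; split => x /= Ax i; [move=> _; exact: Ax|exact: (Ax i I)].
  apply: fin_bigcap_measurable => [|i _]; first exact: finite_finset.
  by rewrite -[X in measurable X]setTI; exact: measurable_coord.
rewrite big_ord_recl -(IHn (fun i => A (lift ord0 i)))//.
rewrite -product_measure1E//; last exact: mA.
rewrite /= /push_rV_cons /pushforward.
congr (_ _); apply/seteqP; split => [[a x]/= H|[a x]/= [Aa H] i].
  split; first by have := H ord0; rewrite mxE unlift_none.
  by move=> i; have := H (lift ord0 i); rewrite mxE liftK.
by rewrite mxE; case: unliftP => [j ->|->].
Qed.

Section gaussian.
Context (R : realType) (n : nat).

(* The library norm on row vectors is the sup norm. *)
Definition enorm (x : 'rV[R]_n) : R := Num.sqrt (\sum_(i < n) x 0 i ^+ 2).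

Definition gauss_density (x : 'rV[R]_n) : R :=
  (2 * pi) `^ (- (n%:R / 2)) * expR (- (enorm x ^+ 2 / 2)).

Lemma gauss_density_ge0 x : 0 <= gauss_density x.
Proof. by rewrite mulr_ge0 ?powR_ge0 ?expR_ge0. Qed.

Lemma sqr_enorm x : enorm x ^+ 2 = \sum_(i < n) x 0 i ^+ 2.
Proof. by rewrite sqr_sqrtr// sumr_ge0// => i _; rewrite sqr_ge0. Qed.

Lemma measurable_gauss_density : measurable_fun setT gauss_density.
Proof.
rewrite /gauss_density; under eq_fun do rewrite sqr_enorm.
apply: measurable_funM => //; apply: measurableT_comp => //.
apply: measurableT_comp => //; apply: measurable_funM => //.
apply: measurable_sum => i; apply: measurable_funX; exact: measurable_coord.
Qed.

Definition gauss_measure (A : set 'rV[R]_n) : \bar R :=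
  (\int[lebesgue_rV R n]_(x in A) (gauss_density x)%:E)%E.

Let gauss0 : gauss_measure set0 = 0%E.
Proof. by rewrite /gauss_measure integral_set0. Qed.

Let gauss_ge0 A : (0 <= gauss_measure A)%E.
Proof. by apply: integral_ge0 => x _; rewrite lee_fin gauss_density_ge0. Qed.

Let gauss_sigma_additive : semi_sigma_additive gauss_measure.
Proof.
move=> F mF tF mUF; rewrite /gauss_measure ge0_integral_bigcup//.
- apply: is_cvg_ereal_nneg_natsum_cond => k _ _.
  by apply: integral_ge0 => x _; rewrite lee_fin gauss_density_ge0.
- apply/measurable_EFinP; apply: measurable_funTS.
  exact: measurable_gauss_density.
- by move=> x _; rewrite lee_fin gauss_density_ge0.
Qed.

HB.instance Definition _ := isMeasure.Build _ _ _ gauss_measure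
  gauss0 gauss_ge0 gauss_sigma_additive.

End gaussian.
Arguments gauss_measure : clear implicits.

Section sobolev.
Context (R : realType) (n : nat).
Implicit Types (u phi : 'rV[R]_n -> R) (g : 'rV[R]_n -> 'rV[R]_n).

Definition partial (i : 'I_n) phi : 'rV[R]_n -> R :=
  fun x => 'D_(delta_mx 0 i) phi x.

(* Every iterated partial derivative is (Frechet) differentiable everywhere,
   hence continuous. *)
Definition smooth phi : Prop :=
  forall (s : seq 'I_n) x, differentiable (foldr partial phi s) x.

Definition test_function phi : Prop :=
  smooth phi /\ compact (closure [set x | phi x != 0]).

Definition locally_integrable_rV u : Prop :=
  forall K, compact K -> (lebesgue_rV R n).-integrable K (EFin \o u).

Definition is_weak_gradient u g : Prop :=
  [/\ locally_integrable_rV u,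
      forall i, locally_integrable_rV (fun x => g x 0 i) &
      forall phi i, test_function phi ->
        \int[lebesgue_rV R n]_x (u x * partial i phi x) =
        - \int[lebesgue_rV R n]_x (g x 0 i * phi x)].

(* A weak gradient is unique up to a Lebesgue-null set; this picks a
   representative, and is meaningful only when a weak gradient exists. *)
Definition weak_gradient u : 'rV[R]_n -> 'rV[R]_n :=
  xget (fun=> 0) [set g | is_weak_gradient u g].

Definition H1_gauss : set ('rV[R]_n -> R) :=
  [set u | [/\ u \in Lfun (gauss_measure R n) 2%:E,
               exists g, is_weak_gradient u g &
               forall i, (fun x => weak_gradient u x 0 i)
                 \in Lfun (gauss_measure R n) 2%:E]].

End sobolev.

Definition varphi (R : realType) (d : nat) (t : R) : R :=
  d%:R / 4 * (expR (2 * t / d%:R) - 1 - 2 * t / d%:R).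

(* Main.v *)
Require Import Defs.
From HB Require Import structures.
From mathcomp Require Import all_boot all_order all_algebra.
From mathcomp Require Import all_classical all_reals all_analysis.
From mathcomp Require Import measurable_realfun ring lra.

(** Write E for the entropy of u^2 and I for the Dirichlet energy. The claim is
    equivalent to 4 I / d >= exp (2 E / d) - 1. By concavity of the logarithm it is
    the envelope of the family of bounds, for l > 0,
      E <= 2 l^2 I + d (l^2 - 1) / 2 - d ln l,
    which is least at l^2 = 1 / (1 + 4 I / d) ([optimal_scale]); the second moment
    of u^2 enters through the term in l^2. This family is the logarithmic Sobolev
    inequality after a dilation, and it is additive over the coordinates.

    The entropy is treated by duality: for positive bounded functions rho, the
    integral of u^2 ln rho minus the logarithm of the mean of rho has to be at most
    the right-hand side, after which rho is taken among the truncations of u^2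
    ([scaled_entropy_bound]). For a given rho, average the coordinates one after
    the other with respect to the one-dimensional Gaussian gam. The logarithms
    telescope down to that of the mean ([entropy_duality]), and at each step only
    the quotient of a function by its average along one coordinate matters. On each
    line this quotient is a probability density with respect to gam
    ([entropy_line_step]). The averages of rho only have to stay bounded
    and measurable; averaging u^2 instead would mean differentiating its averages.

    What remains is one-dimensional ([line_entropy]). On almost every line parallel
    to a coordinate axis, u is a primitive of the corresponding component of its
    weak gradient ([weak_gradient_lines]). If the density r is continuous, let T be
    the increasing map sending r gam to gam. Then
      ln r = (t^2 - T^2) / 2 + ln T',   ln (l T') <= l T' - 1,
    and with W = (t - T / l) / 2 the function l T' + (l^2 t^2 - T^2) / 2 - l^2 is
    2 l^2 (t W - W' - W^2). An integration by parts turns the first two terms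
    into 4 l^2 u u' W, and 2 u u' W - u^2 W^2 <= u'^2 ([entropy_pointwise]). General
    densities follow by approximation.

    The passage from weak gradients to lines is made with product test functions.
    Their factors are bumps built from exp (- 1 / x), and the functions of the
    other coordinates are eliminated because bounded boxes generate the measurable
    sets ([ae_eq0_box]); on a line it is Du Bois-Reymond's lemma
    ([weak_derivative_primitive]). *)

Set Implicit Arguments.
Unset Strict Implicit.
Unset Printing Implicit Defensive.
Import Order.TTheory GRing.Theory Num.Theory.
Import numFieldNormedType.Exports.
Local Open Scope classical_set_scope.
Local Open Scope ring_scope.

(** * Integrals of real-valued functions *)

Section real_integrable.
Context (d : measure_display) (T : measurableType d) (R : realType).
Context (m : {measure set T -> \bar R}) (D : set T) (mD : measurable D).
Implicit Types f g : T -> R.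

Lemma integrable_Zl (c : R) f : m.-integrable D (fun x => (f x)%:E) ->
  m.-integrable D (fun x => (c * f x)%:E).
Proof. move=> fi; exact (integrableZl mD c fi). Qed.

Lemma integrable_add f g : m.-integrable D (fun x => (f x)%:E) ->
  m.-integrable D (fun x => (g x)%:E) -> m.-integrable D (fun x => (f x + g x)%:E).
Proof. move=> fi gi; exact (integrableD mD fi gi). Qed.

Lemma integrable_sub f g : m.-integrable D (fun x => (f x)%:E) ->
  m.-integrable D (fun x => (g x)%:E) -> m.-integrable D (fun x => (f x - g x)%:E).
Proof. move=> fi gi; exact (integrableB mD fi gi). Qed.

Lemma integrable_meas f : m.-integrable D (fun x => (f x)%:E) -> measurable_fun D f.
Proof. by move=> fi; apply/measurable_EFinP; exact: measurable_int fi. Qed.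

Lemma integrable_le f g : measurable_fun D f -> (forall x, D x -> `|f x| <= g x) ->
  m.-integrable D (fun x => (g x)%:E) -> m.-integrable D (fun x => (f x)%:E).
Proof.
move=> mf fg gi; apply: (le_integrable mD _ _ gi); first exact/measurable_EFinP.
by move=> x Dx /=; rewrite lee_fin (le_trans (fg x Dx))// ler_norm.
Qed.

Lemma integrable_bounded_mul f (h : T -> R) (M : R) : measurable_fun D h ->
  (forall x, D x -> `|h x| <= M) -> m.-integrable D (fun x => (f x)%:E) ->
  m.-integrable D (fun x => (f x * h x)%:E).
Proof.
move=> mh hM fi.
have fi' : m.-integrable D (fun x => (M * `|f x|)%:E).
  by apply: integrable_Zl; exact (integrable_norm fi).
apply: integrable_le fi'.
  by apply: measurable_funM => //; exact: integrable_meas.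
by move=> x Dx; rewrite normrM mulrC ler_wpM2r// hM.
Qed.

Lemma Rintegral_cvg (f_ : nat -> T -> R) f g :
  (forall n, measurable_fun D (f_ n)) -> measurable_fun D f ->
  {ae m, forall x, D x -> f_ n x @[n --> \oo] --> f x} ->
  m.-integrable D (fun x => (g x)%:E) ->
  (forall n x, D x -> `|f_ n x| <= g x) ->
  m.-integrable D (fun x => (f x)%:E) /\
  \int[m]_(x in D) f_ n x @[n --> \oo] --> \int[m]_(x in D) f x.
Proof.
move=> mf mlim cf gi fg.
have mfE n : measurable_fun D (EFin \o f_ n) by apply/measurable_EFinP.
have mlimE : measurable_fun D (EFin \o f) by apply/measurable_EFinP.
have cfE : {ae m, forall x, D x -> (f_ n x)%:E @[n --> \oo] --> (f x)%:E}.
  apply: filterS cf => x cx Dx; apply: cvg_EFin; last exact: cx.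
  exact: nearW.
have fgE : {ae m, forall x n, D x -> (`|(f_ n x)%:E| <= (g x)%:E)%E}.
  by apply: aeW => x n Dx; rewrite lee_fin fg.
have [fi _ h] := @dominated_convergence _ _ _ m D mD (fun n x => (f_ n x)%:E) (EFin \o f)
  (EFin \o g) mfE mlimE cfE gi fgE.
split=> //; rewrite /Rintegral; apply: fine_cvg; rewrite fineK//.
exact: integrable_fin_num.
Qed.

Lemma Rintegral_cvg_everywhere (f_ : nat -> T -> R) f g :
  (forall n, measurable_fun D (f_ n)) ->
  (forall x, D x -> f_ n x @[n --> \oo] --> f x) ->
  m.-integrable D (fun x => (g x)%:E) ->
  (forall n x, D x -> `|f_ n x| <= g x) ->
  m.-integrable D (fun x => (f x)%:E) /\
  \int[m]_(x in D) f_ n x @[n --> \oo] --> \int[m]_(x in D) f x.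
Proof.
move=> mf cf gi fg; apply: (Rintegral_cvg mf) gi fg; last exact: aeW.
exact: measurable_fun_cvg cf.
Qed.

End real_integrable.

Lemma ae_eq_Rintegral (d : measure_display) (T : measurableType d) (R : realType)
    (m : {measure set T -> \bar R}) (D : set T) (f g : T -> R) : measurable D ->
  measurable_fun D f -> measurable_fun D g ->
  {ae m, forall x, D x -> f x = g x} ->
  \int[m]_(x in D) f x = \int[m]_(x in D) g x.
Proof.
move=> mD mf mg fg; rewrite /Rintegral; congr fine; apply: ae_eq_integral => //.
- exact/measurable_EFinP.
- exact/measurable_EFinP.
- have ? : Filter (nbhs (almost_everywhere m)) by exact: ae_filter_ringOfSetsType.
  by apply: filterS fg => x fgx Dx; rewrite fgx.
Qed.

Lemma le_Rintegral_ae (R : realType) (d : measure_display) (T : measurableType d)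
    (m : {measure set T -> \bar R}) (f g : T -> R) :
  m.-integrable setT (fun x => (f x)%:E) -> m.-integrable setT (fun x => (g x)%:E) ->
  {ae m, forall x, f x <= g x} -> \int[m]_x f x <= \int[m]_x g x.
Proof.
move=> fi gi fg; have mf := integrable_meas fi.
have mg := integrable_meas gi.
pose h x := Num.min (f x) (g x).
have mh : measurable_fun setT h by exact: measurable_minr.
have hi : m.-integrable setT (fun x => (h x)%:E).
  have nfi : m.-integrable setT (fun x => (`|f x| + `|g x|)%:E).
    by apply: integrable_add => //; [exact (integrable_norm fi)|exact (integrable_norm gi)].
  apply: (integrable_le measurableT mh _ nfi) => x _; rewrite /h.
  by case: (leP (f x) (g x)) => _; rewrite ?lerDl ?lerDr.
have -> : \int[m]_x f x = \int[m]_x h x.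
  apply: ae_eq_Rintegral => //.
  have ? : Filter (nbhs (almost_everywhere m)) by exact: ae_filter_ringOfSetsType.
  by apply: filterS fg => x fgx _; rewrite /h (min_idPl fgx).
by apply: (le_Rintegral measurableT hi gi) => x _; rewrite /h ge_min lexx orbT.
Qed.

Lemma eq_integrable_ae (R : realType) (d : measure_display) (T : measurableType d)
    (m : {measure set T -> \bar R}) (f g : T -> R) :
  measurable_fun setT f -> measurable_fun setT g -> {ae m, forall x, f x = g x} ->
  m.-integrable setT (fun x => (f x)%:E) -> m.-integrable setT (fun x => (g x)%:E).
Proof.
move=> mf mg fg /integrableP[_ foo]; apply/integrableP; split; first exact/measurable_EFinP.
apply: le_lt_trans foo; rewrite le_eqVlt; apply/orP; left; apply/eqP.
apply: ae_eq_integral => //.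
- by apply: measurableT_comp => //; exact/measurable_EFinP.
- by apply: measurableT_comp => //; exact/measurable_EFinP.
- have ? : Filter (nbhs (almost_everywhere m)) by exact: ae_filter_ringOfSetsType.
  by apply: filterS fg => x fgx _; rewrite fgx.
Qed.

Lemma Rintegral_sum (R : realType) (d : measure_display) (T : measurableType d) (m : {measure set T -> \bar R})
    (k : nat) (f : 'I_k -> T -> R) : (forall i, m.-integrable setT (fun x => (f i x)%:E)) ->
  m.-integrable setT (fun x => (\sum_i f i x)%:E) /\
  \int[m]_x (\sum_i f i x) = \sum_i \int[m]_x f i x.
Proof.
elim: k f => [|k IH] f fi.
  under eq_fun do rewrite big_ord0.
  under eq_Rintegral do rewrite big_ord0.
  by rewrite big_ord0 /Rintegral integral0; split=> //; exact: integrable0.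
have [i1 i2] := IH (fun i => f (lift ord0 i)) (fun i => fi _).
have E x : \sum_i f i x = f ord0 x + \sum_i f (lift ord0 i) x by rewrite big_ord_recl.
split; first by under eq_fun do rewrite E; exact: integrable_add.
rewrite big_ord_recl -i2 -(RintegralD measurableT (fi ord0) i1).
by apply: eq_Rintegral => x _; exact: E.
Qed.

(** Fatou's lemma; it serves where the integrals are bounded but no dominating function is known yet. *)
Lemma fatou_integrable (R : realType) (d : measure_display) (T : measurableType d) (m : {measure set T -> \bar R})
    (f : nat -> T -> R) (g : T -> R) (C : R) :
  (forall k, m.-integrable setT (fun x => (f k x)%:E)) -> (forall k x, 0 <= f k x) ->
  (forall x, f k x @[k --> \oo] --> g x) -> (forall k, \int[m]_x f k x <= C) ->
  m.-integrable setT (fun x => (g x)%:E).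
Proof.
move=> fi f0 fg fC.
have mf k : measurable_fun setT (f k) by exact: integrable_meas (fi k).
have mg : measurable_fun setT g by apply: (measurable_fun_cvg mf) => x _; exact: fg.
have g0 x : 0 <= g x by rewrite -(cvg_lim (@Rhausdorff R) (fg x)); apply: limr_ge; [apply/cvg_ex; eexists; exact: fg|exact: nearW].
apply/integrableP; split; first exact/measurable_EFinP.
have E : (\int[m]_x `|(g x)%:E| = \int[m]_x limn_einf (fun k => (f k x)%:E))%E.
  apply: eq_integral => x _; rewrite gee0_abs ?lee_fin//.
  have cE : (f k x)%:E @[k --> \oo] --> (g x)%:E by apply: cvg_EFin; [exact: nearW|exact: fg].
  rewrite is_cvg_limn_einfE; last by apply/cvg_ex; eexists; exact: cE.
  by rewrite (cvg_lim _ cE).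
rewrite E; apply: (@le_lt_trans _ _ C%:E); last by rewrite ltry.
apply: (le_trans (fatou _ _ _ _)) => //.
- by move=> k; exact/measurable_EFinP.
- by move=> k x _; rewrite lee_fin.
rewrite limn_einf_lim; apply: lime_le; first exact: is_cvg_einfs.
apply: nearW => k; apply: (@le_trans _ _ (\int[m]_x (f k x)%:E)%E).
  by apply: ereal_inf_lbound; exists k => /=.
by rewrite -(fineK (integrable_fin_num measurableT (fi k))) lee_fin; exact: fC.
Qed.

(** * Fubini's theorem for one coordinate of row vectors *)

Section insert_coordinate.
Context (R : realType).
Local Notation mu := (@lebesgue_measure R).

Definition ins n (i : 'I_n.+1) (t : R) (x : 'rV[R]_n) : 'rV[R]_n.+1 :=
  \row_j oapp (x 0) t (unlift i j).

Definition del n (i : 'I_n.+1) (x : 'rV[R]_n.+1) : 'rV[R]_n :=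
  \row_j x 0 (lift i j).

Lemma ins_eq n (i : 'I_n.+1) t x : ins i t x 0 i = t.
Proof. by rewrite mxE unlift_none. Qed.

Lemma ins_lift n (i : 'I_n.+1) t x j : ins i t x 0 (lift i j) = x 0 j.
Proof. by rewrite mxE liftK. Qed.

Lemma insK n (i : 'I_n.+1) t x : del i (ins i t x) = x.
Proof. by apply/rowP => j; rewrite mxE ins_lift. Qed.

Lemma measurable_ins n (i : 'I_n.+1) :
  measurable_fun [set: measurableTypeR R * 'rV[R]_n] (fun p => ins i p.1 p.2).
Proof.
apply/measurable_fun_rVP => j; under eq_fun do rewrite mxE.
case: unliftP => [k _|_] /=; last exact: measurable_fst.
by apply: (measurableT_comp (f := fun y : 'rV[R]_n => y 0 k)) => //;
   exact: measurable_coord.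
Qed.

Lemma measurable_insr n (i : 'I_n.+1) t :
  measurable_fun [set: 'rV[R]_n] (ins i t).
Proof. exact: (measurableT_comp (measurable_ins i) (measurable_pair1 t)). Qed.

Lemma measurable_insl n (i : 'I_n.+1) x :
  measurable_fun [set: measurableTypeR R] (fun t => ins i t x).
Proof. exact: (measurableT_comp (measurable_ins i) (measurable_pair2 x)). Qed.

Lemma measurable_del n (i : 'I_n.+1) : measurable_fun [set: 'rV[R]_n.+1] (del i).
Proof.
apply/measurable_fun_rVP => j; under eq_fun do rewrite mxE.
exact: measurable_coord.
Qed.

Lemma ins_lift_cons n (j : 'I_n.+1) (t s : R) (y : 'rV[R]_n) :
  ins (lift ord0 j) t (ins ord0 s y) = ins ord0 s (ins j t y).
Proof.
apply/rowP => k; have [l ->|->] := unliftP ord0 k; last first.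
  have e : ord0 = lift (lift ord0 j) ord0 by exact/val_inj.
  rewrite ins_eq; transitivity (ins (lift ord0 j) t (ins ord0 s y) 0 (lift (lift ord0 j) ord0)).
    by rewrite -e.
  by rewrite (ins_lift (lift ord0 j)) ins_eq.
rewrite ins_lift; have [m ->|->] := unliftP j l; last by rewrite !ins_eq.
have e : lift ord0 (lift j m) = lift (lift ord0 j) (lift ord0 m).
  by apply/val_inj; rewrite /= !/bump /= !add1n ltnS addnS.
by rewrite ins_lift e !ins_lift.
Qed.

Local Open Scope ereal_scope.

(** Lebesgue measure on R^(n+1) is built by adding coordinates at the front; Tonelli for another coordinate follows by moving it past the first one. *)
Lemma tonelli_ins n (i : 'I_n.+1) (f : 'rV[R]_n.+1 -> \bar R) :
  measurable_fun setT f -> (forall x, 0 <= f x) ->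
  \int[lebesgue_rV R n.+1]_x f x =
  \int[lebesgue_rV R n]_x \int[mu]_t f (ins i t x).
Proof.
have base m (g : 'rV[R]_m.+1 -> \bar R) :
  measurable_fun setT g -> (forall x, 0 <= g x) ->
  \int[lebesgue_rV R m.+1]_x g x =
  \int[mu]_t \int[lebesgue_rV R m]_x g (ins ord0 t x).
  move=> mg g0; rewrite /= /push_rV_cons ge0_integral_pushforward//=; last first.
    exact: measurable_rV_cons.
  rewrite preimage_setT (fubini_tonelli1 (g \o @rV_cons R m))//=.
  exact: measurableT_comp mg (@measurable_rV_cons R m).
have mgi m (j : 'I_m.+1) (g : 'rV[R]_m.+1 -> \bar R) : measurable_fun setT g ->
  measurable_fun setT (fun p : measurableTypeR R * 'rV[R]_m => g (ins j p.1 p.2)).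
  by move=> mg; exact: measurableT_comp mg (measurable_ins j).
elim: n => [|n IHn] in i f * => mf f0.
  rewrite (ord1 i) base//.
  exact: (fubini_tonelli (fun p : measurableTypeR R * 'rV[R]_0 => f (ins ord0 p.1 p.2)) (mgi _ _ _ mf)).
have [j ->|->] := unliftP ord0 i; last first.
  rewrite base//.
  exact: (fubini_tonelli (fun p : measurableTypeR R * 'rV[R]_n.+1 => f (ins ord0 p.1 p.2)) (mgi _ _ _ mf)).
rewrite base// [RHS]base; first last.
- by move=> x; exact: integral_ge0.
- exact: (measurable_fun_fubini_tonelli_G (fun p : measurableTypeR R * 'rV[R]_n.+1 => f (ins (lift ord0 j) p.1 p.2)) (mgi _ _ _ mf)).
apply: eq_integral => s _; rewrite (IHn j); first last.
- by move=> x.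
- exact: measurableT_comp mf (measurable_insr _ _).
apply: eq_integral => y _; apply: eq_integral => t _.
by rewrite ins_lift_cons.
Qed.

Lemma tonelli_ins_prod n (i : 'I_n.+1) (f : 'rV[R]_n.+1 -> \bar R) :
  measurable_fun setT f -> (forall x, 0 <= f x) ->
  \int[lebesgue_rV R n.+1]_x f x =
  \int[mu \x lebesgue_rV R n]_p f (ins i p.1 p.2).
Proof.
move=> mf f0; rewrite (tonelli_ins i)//.
rewrite (fubini_tonelli2 (fun p : measurableTypeR R * 'rV[R]_n => f (ins i p.1 p.2)))//.
exact: measurableT_comp mf (measurable_ins i).
Qed.

Lemma integrable_ins n (i : 'I_n.+1) (f : 'rV[R]_n.+1 -> \bar R) :
  (lebesgue_rV R n.+1).-integrable setT f ->
  (mu \x lebesgue_rV R n).-integrable setT (fun p => f (ins i p.1 p.2)).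
Proof.
move=> /integrableP[mf foo]; apply/integrableP; split.
  exact: measurableT_comp mf (measurable_ins i).
move: foo; rewrite (tonelli_ins_prod i)//.
exact: measurableT_comp.
Qed.

Lemma integral_ins_prod n (i : 'I_n.+1) (f : 'rV[R]_n.+1 -> \bar R) :
  measurable_fun setT f ->
  \int[lebesgue_rV R n.+1]_x f x =
  \int[mu \x lebesgue_rV R n]_p f (ins i p.1 p.2).
Proof.
move=> mf; rewrite integralE [RHS]integralE.
have mp : measurable_fun setT f^\+ by exact: measurable_funepos.
have mn : measurable_fun setT f^\- by exact: measurable_funeneg.
rewrite (tonelli_ins_prod i mp) ?(tonelli_ins_prod i mn)//=.
by rewrite !unlock.
Qed.

Lemma fubini_ins n (i : 'I_n.+1) (f : 'rV[R]_n.+1 -> \bar R) :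
  (lebesgue_rV R n.+1).-integrable setT f ->
  \int[lebesgue_rV R n.+1]_x f x =
  \int[lebesgue_rV R n]_x \int[mu]_t f (ins i t x).
Proof.
move=> fi; rewrite (integral_ins_prod i); last exact: measurable_int fi.
by rewrite -(integral21_prod_meas1 (integrable_ins i fi)).
Qed.

Lemma ae_integrable_ins n (i : 'I_n.+1) (f : 'rV[R]_n.+1 -> \bar R) :
  (lebesgue_rV R n.+1).-integrable setT f ->
  {ae lebesgue_rV R n, forall x, mu.-integrable setT (fun t => f (ins i t x))}.
Proof. by move=> fi; exact: (ae_integrable2 (integrable_ins i fi)). Qed.

Lemma integrable_marginal n (i : 'I_n.+1) (f : 'rV[R]_n.+1 -> \bar R) :
  (lebesgue_rV R n.+1).-integrable setT f ->
  (lebesgue_rV R n).-integrable setT (fun x => \int[mu]_t f (ins i t x)).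
Proof.
move=> fi; have mf := measurable_int _ fi; have gi := integrable_ins i fi.
have mgi := measurable_int _ gi.
apply/integrableP; split; first exact: (measurable_fubini_G gi).
apply: le_lt_trans ((integrable21ltyP _ _ mgi).1 gi).
apply: ge0_le_integral => //.
- apply: measurableT_comp => //; exact: (measurable_fubini_G gi).
- apply: (measurable_fun_fubini_tonelli_G (abse \o (fun p : measurableTypeR R * 'rV[R]_n => f (ins i p.1 p.2)))).
    exact: measurableT_comp.
  by move=> p; exact: abse_ge0.
- move=> x _; apply: le_abse_integral => //.
  exact: measurableT_comp mf (measurable_insl _ _).
Qed.

End insert_coordinate.

Section fubini_real.
Context (R : realType) (n : nat) (i : 'I_n.+1).
Local Notation mu := (@lebesgue_measure R).
Local Notation leb := (lebesgue_rV R).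

Lemma Rintegrable_ins (f : 'rV[R]_n.+1 -> R) :
  (leb n.+1).-integrable setT (fun x => (f x)%:E) ->
  (leb n).-integrable setT (fun x => (\int[mu]_t f (ins i t x))%:E).
Proof.
move=> fi; have Fi := integrable_marginal i fi.
apply: (le_integrable measurableT _ _ Fi).
  apply/measurable_EFinP; apply: (measurableT_comp (f := fine)); first exact: fine_measurable.
  exact: measurable_int Fi.
move=> x _ /=; rewrite /Rintegral.
by case: (\int[mu]_t _)%E => [r||] //=; rewrite ?normr0 ?lee_fin ?leey.
Qed.

Lemma Rfubini_ins (f : 'rV[R]_n.+1 -> R) :
  (leb n.+1).-integrable setT (fun x => (f x)%:E) ->
  \int[leb n.+1]_x f x = \int[leb n]_x \int[mu]_t f (ins i t x).
Proof.
move=> fi; rewrite {1}/Rintegral (fubini_ins i fi) /Rintegral; congr fine.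
have Fi := integrable_marginal i fi.
apply: ae_eq_integral => //.
- exact: measurable_int Fi.
- exact: measurable_int (Rintegrable_ins fi).
apply: filterS (ae_integrable_ins i fi) => x fx _ /=.
by rewrite fineK//; exact: integrable_fin_num.
Qed.

End fubini_real.

(** * The Gaussian density and measure *)

Section gaussian_density.
Context (R : realType).
Local Notation mu := (@lebesgue_measure R).
Local Notation gam := (normal_pdf (0 : R) 1).

Lemma gammaE (t : R) : gam t = (2 * pi) `^ (- (1 / 2)) * expR (- (t ^+ 2 / 2)).
Proof.
rewrite /normal_pdf oner_eq0 /normal_peak /normal_fun.
rewrite !expr1n mul1r subr0 powRN div1r powR12_sqrt; last first.
  by rewrite mulr_ge0// pi_ge0.
by rewrite mulr_natl mulNr.
Qed.

Lemma gamma_gt0 (t : R) : 0 < gam t.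
Proof. by rewrite gammaE mulr_gt0 ?expR_gt0// powR_gt0// mulr_gt0// pi_gt0. Qed.

Lemma gauss_density_gt0 n (x : 'rV[R]_n) : 0 < gauss_density x.
Proof. by rewrite mulr_gt0 ?expR_gt0// powR_gt0// mulr_gt0// pi_gt0. Qed.

Lemma enorm_ins n (i : 'I_n.+1) (t : R) (x : 'rV[R]_n) :
  enorm (ins i t x) ^+ 2 = t ^+ 2 + enorm x ^+ 2.
Proof.
rewrite !sqr_enorm (bigD1_ord i)//= ins_eq; congr (_ + _).
by apply: eq_bigr => j _; rewrite ins_lift.
Qed.

Lemma gauss_density_ins n (i : 'I_n.+1) (t : R) (x : 'rV[R]_n) :
  gauss_density (ins i t x) = gam t * gauss_density x.
Proof.
have /gt_eqF pi2 : (0 : R) < 2 * pi by rewrite mulr_gt0 ?pi_gt0.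
rewrite gammaE /gauss_density enorm_ins.
have -> : - (n.+1%:R / 2) = - (1 / 2) + - (n%:R / 2) :> R.
  by rewrite -opprD -mulrDl -natr1 addrC.
have -> : - ((t ^+ 2 + enorm x ^+ 2) / 2) = - (t ^+ 2 / 2) + - (enorm x ^+ 2 / 2).
  by rewrite -opprD -mulrDl.
by rewrite powRD ?pi2 ?implybT// expRD; exact: mulrACA.
Qed.

Lemma measurable_EFin_gauss_density n :
  measurable_fun setT (fun x : 'rV[R]_n => (gauss_density x)%:E).
Proof. by apply: measurableT_comp => //; exact: measurable_gauss_density. Qed.

Lemma gauss_measureT n : gauss_measure R n setT = 1%E.
Proof.
rewrite /gauss_measure; elim: n => [|n IHn].
  rewrite /= integral_dirac//; last first.
    exact: measurable_EFin_gauss_density.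
  rewrite diracE mem_set// -[(true%:R)%:E]/(1%:E) mul1e /gauss_density mul0r oppr0 powRr0 mul1r sqr_enorm.
  by rewrite big_ord0 mul0r oppr0 expR0.
rewrite (tonelli_ins ord0); first last.
- by move=> x; rewrite lee_fin gauss_density_ge0.
- exact: measurable_EFin_gauss_density.
rewrite -[RHS]IHn; apply: eq_integral => x _.
under eq_integral do rewrite gauss_density_ins EFinM.
rewrite ge0_integralZr//.
- by rewrite integral_normal_pdf ?oner_eq0// mul1e.
- by apply/measurable_EFinP; exact: measurable_normal_pdf.
- by move=> t _; rewrite lee_fin normal_pdf_ge0.
- by rewrite lee_fin gauss_density_ge0.
Qed.

HB.instance Definition _ n := @Measure_isProbability.Build _ _ R
  (gauss_measure R n) (gauss_measureT n).

Lemma gauss_dominates n : gauss_measure R n `<< lebesgue_rV R n.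
Proof.
apply/null_content_dominatesP => A mA A0; rewrite /gauss_measure.
apply: null_set_integral => //; apply: measurable_funTS.
exact: measurable_EFin_gauss_density.
Qed.

Local Open Scope ereal_scope.

Lemma integral_gauss n (f : 'rV[R]_n -> \bar R) :
  measurable_fun setT f -> (forall x, 0 <= f x) ->
  \int[gauss_measure R n]_x f x =
  \int[lebesgue_rV R n]_x (f x * (gauss_density x)%:E).
Proof.
move=> mf f0; have dom := @gauss_dominates n.
rewrite -(Radon_Nikodym_SigmaFinite.change_of_variables dom)//.
have mfRN := measurable_int _ (Radon_Nikodym_SigmaFinite.f_integrable dom).
have mdens : measurable_fun setT (fun x : 'rV[R]_n => (gauss_density x)%:E).
  exact: measurable_EFin_gauss_density.
apply: ae_eq_integral => //; [exact: emeasurable_funM..|].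
apply: ae_eqe_mul2l; apply: integral_ae_eq => //.
  exact: Radon_Nikodym_SigmaFinite.f_integrable.
by move=> E _ mE; rewrite -Radon_Nikodym_SigmaFinite.f_integral.
Qed.

Lemma integrable_gauss n (f : 'rV[R]_n -> R) :
  measurable_fun setT f ->
  (gauss_measure R n).-integrable setT (EFin \o f) <->
  (lebesgue_rV R n).-integrable setT (fun x => (f x * gauss_density x)%:E).
Proof.
move=> mf; have mnf : measurable_fun setT (fun x => `|(f x)%:E|).
  by apply: measurableT_comp => //; exact/measurable_EFinP.
have mdens : measurable_fun setT (fun x : 'rV[R]_n => (f x * gauss_density x)%:E).
  apply/measurable_EFinP; apply: measurable_funM => //.
  exact: measurable_gauss_density.
have E : \int[gauss_measure R n]_x `|(f x)%:E| =
    \int[lebesgue_rV R n]_x `|(f x * gauss_density x)%:E|.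
  rewrite integral_gauss//; apply: eq_integral => x _.
  by rewrite /= normrM (ger0_norm (gauss_density_ge0 x)).
split=> /integrableP[_ foo]; apply/integrableP; split=> //.
- by rewrite -E.
- exact/measurable_EFinP.
- by rewrite /= E.
Qed.

Lemma Rintegral_gauss n (f : 'rV[R]_n -> R) :
  (gauss_measure R n).-integrable setT (EFin \o f) ->
  (\int[gauss_measure R n]_x f x =
  \int[lebesgue_rV R n]_x (f x * gauss_density x))%R.
Proof.
move=> fi; have mf := measurable_int _ fi.
rewrite /Rintegral; congr fine; rewrite integralE [RHS]integralE.
have mp : measurable_fun setT (EFin \o f)^\+ by exact: measurable_funepos.
have mn : measurable_fun setT (EFin \o f)^\- by exact: measurable_funeneg.
rewrite !integral_gauss//; congr (_ - _); apply: eq_integral => x _; rewrite !unlock.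
- by rewrite maxe_pMl ?mul0e// ?lee_fin ?gauss_density_ge0.
- by rewrite maxe_pMl ?mul0e// ?lee_fin ?gauss_density_ge0// mulNe.
Qed.

End gaussian_density.

(** * Functions whose integrals vanish on intervals or boxes *)

Section vanishing_integrals.
Local Open Scope ereal_scope.

(** The sets over which f integrates to zero form a Dynkin system, so it is enough to test on a generating family stable under intersection. *)
Lemma ae_eq0_pi_system (d : measure_display) (T : measurableType d) (R : realType)
    (m : {measure set T -> \bar R}) (G : set (set T)) (D : set T) (f : T -> R) :
  @measurable _ T = <<s G >> -> setI_closed G -> measurable D ->
  m.-integrable D (EFin \o f) ->
  \int[m]_(x in D) (f x)%:E = 0 ->
  (forall A, G A -> \int[m]_(x in A `&` D) (f x)%:E = 0) ->
  {ae m, forall x, D x -> f x = 0%R}.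
Proof.
move=> mG GI mD fi fD0 fG0.
have mf A : measurable A -> measurable_fun (A `&` D) (EFin \o f).
  move=> mA; apply: (measurable_funS mD); first exact: subIsetr.
  exact: measurable_int fi.
have all0 A : measurable A -> \int[m]_(x in A `&` D) (f x)%:E = 0.
  rewrite mG; move: A.
  apply: (dynkin_induction (G := G) (P := fun A => \int[m]_(x in A `&` D) (f x)%:E = 0) mG GI).
  - by rewrite setTI.
  - by move=> A GA; exact: fG0.
  - move=> S mS S0; move: fD0; rewrite -{1}(setTI D) -(setUv S) setIUl integral_setU//.
    + by rewrite S0 add0e.
    + exact: measurableI.
    + by apply: measurableI => //; exact: measurableC.
    + by rewrite -setIUl setUv; exact: mf.
    + by apply/disj_set2P; rewrite setIACA setICr set0I.
  - move=> F mF tF F0; rewrite setI_bigcupl integral_bigcup//.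
    + by rewrite eseries0.
    + exact: trivIset_setIr.
    + by move=> k; exact: measurableI.
    + apply: integrableS fi => //; first by apply: bigcup_measurable => k _; exact: measurableI.
      by rewrite -setI_bigcupl; exact: subIsetr.
have := @integral_ae_eq _ _ _ m D mD (cst 0) (EFin \o f) fi (measurable_cst _).
have aux E : E `<=` D -> measurable E -> \int[m]_(x in E) (EFin \o f) x = \int[m]_(x in E) cst 0 x.
  by move=> ED mE; rewrite integral0 -(setIidl ED); exact: all0.
move=> /(_ aux); apply: filterS => x /= + Dx; move=> /(_ Dx) [->]//.
Qed.

Context (R : realType).
Local Notation mu := (@lebesgue_measure R).

Lemma ae_eq0_itv (a b : R) (f : R -> R) :
  mu.-integrable `[a, b] (EFin \o f) ->
  (forall p q : R, (a <= p)%R -> (p < q)%R -> (q <= b)%R ->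
    \int[mu]_(x in `]p, q[) (f x)%:E = 0) ->
  {ae mu, forall x : R, `[a, b]%classic x -> f x = 0%R}.
Proof.
move=> fi f0.
have f0' (p q : R) : (a <= p)%R -> (q <= b)%R -> \int[mu]_(x in `]p, q[) (f x)%:E = 0.
  have [pq|qp] := ltP p q; first by move=> ap; exact: f0.
  by rewrite set_itv_ge ?integral_set0// bnd_simp -leNgt.
have II (p q r s : R) : `]p, q[ `&` `]r, s[ = `](Num.max p r)%R, (Num.min q s)%R[%classic.
  by apply/seteqP; split => x /=; rewrite !in_itv/= gt_max lt_min;
    [move=> [/andP[-> ->] /andP[-> ->]]|move=> /andP[/andP[-> ->] /andP[-> ->]]].
have fio : mu.-integrable `]a, b[ (EFin \o f).
  by apply: integrableS fi => //; exact: subset_itvW.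
have aeo : {ae mu, forall x : R, `]a, b[%classic x -> f x = 0%R}.
  apply: (@ae_eq0_pi_system _ _ _ mu _ `]a, b[%classic f (RGenOpens.measurableE R)) => //.
  - move=> A B [p [q ->]] [r [s ->]]; rewrite II.
    by exists (Num.max p r), (Num.min q s).
  - exact: f0'.
  - by move=> A [p [q ->]]; rewrite II f0'// ?le_max ?ge_min lexx orbT.
have ae1 (c : R) : {ae mu, forall x : R, x != c}.
  exists [set c]; split=> //; first exact: lebesgue_measure_set1.
  by move=> x /= /negP; rewrite negbK => /eqP.
have ? : Filter (nbhs (almost_everywhere mu)) by exact: ae_filter_ringOfSetsType.
apply: filterS3 aeo (ae1 a) (ae1 b) => x xab xa xb; rewrite /= in_itv/= => /andP[ax bx].
by apply: xab; rewrite /= in_itv/= !lt_neqAle ax bx xb eq_sym xa.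
Qed.

Definition box n (p q : 'I_n -> R) : set 'rV[R]_n :=
  [set x | forall j, (x 0 j \in `](p j), (q j)[)%R].

Lemma boxI n (p q r s : 'I_n -> R) :
  box p q `&` box r s = box (fun j => Num.max (p j) (r j)) (fun j => Num.min (q j) (s j)).
Proof.
apply/seteqP; split => x /= => [[h1 h2] j|h].
  by move: (h1 j) (h2 j); rewrite !in_itv/= gt_max lt_min => /andP[-> ->] /andP[-> ->].
by split=> j; move: (h j); rewrite !in_itv/= gt_max lt_min =>
  /andP[/andP[pj rj] /andP[qj sj]]; apply/andP.
Qed.

Lemma measurable_box n (p q : 'I_n -> R) : measurable (box p q).
Proof.
rewrite (_ : box p q = \bigcap_(i in [set: 'I_n])
      ((fun x : 'rV[R]_n => (x 0 i)%R) @^-1` `](p i), (q i)[)); last first.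
  by apply/seteqP; split => x /= Ax i; [move=> _; exact: Ax|exact: (Ax i I)].
apply: fin_bigcap_measurable => [|i _]; first exact: finite_finset.
by rewrite -[X in measurable X]setTI; exact: measurable_coord.
Qed.

Definition cube n (N : nat) : set 'rV[R]_n := box (fun=> - N%:R)%R (fun=> N%:R).

Lemma cube_cover n (x : 'rV[R]_n) : exists N : nat, cube N x.
Proof.
exists (Num.truncn (\sum_j `|(x 0 j)%R|)%R).+1 => j.
rewrite in_itv/= -ltr_norml; apply: le_lt_trans (truncnS_gt _).
by rewrite (bigD1 j)//= lerDl sumr_ge0.
Qed.

Lemma measurable_boxE n : @measurable _ 'rV[R]_n =
  <<s [set A | exists p q : 'I_n -> R, A = box p q] >>.
Proof.
set G := [set A | _]; apply/seteqP; split; last first.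
  apply: smallest_sub; first exact: sigma_algebra_measurable.
  by move=> _ [p [q ->]]; exact: measurable_box.
apply: smallest_sub; first exact: smallest_sigma_algebra.
move=> A; rewrite -bigcup_seq => -[i _] [B mB <-].
suff : measurable_fun [set: g_sigma_algebraType G] (fun x : 'rV[R]_n => x 0%R i : measurableTypeR R).
  by move=> /(_ measurableT _ mB).
apply: (measurability _ (RGenOInfty.measurableE R)) => _ [_ [q ->] <-].
rewrite setTI.
rewrite (_ : _ @^-1` _ = \bigcup_N box (fun j => if j == i then q else - N%:R)%R (fun=> N%:R)).
  by apply: bigcupT_measurable => N; apply: sub_sigma_algebra; eexists; eexists; reflexivity.
apply/seteqP; split => x /=; rewrite in_itv/= andbT.
  move=> qx; have [N xN] := cube_cover x; exists N => // j; rewrite in_itv/=.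
  by have := xN j; rewrite in_itv/=; case: eqP => // -> /andP[_ ->]; rewrite qx.
by move=> [N _ /(_ i)]; rewrite eqxx in_itv/= => /andP[].
Qed.

Lemma ae_eq0_box n (f : 'rV[R]_n -> R) :
  (forall N, (lebesgue_rV R n).-integrable (cube N) (EFin \o f)) ->
  (forall p q : 'I_n -> R, \int[lebesgue_rV R n]_(x in box p q) (f x)%:E = 0) ->
  {ae lebesgue_rV R n, forall x, f x = 0%R}.
Proof.
move=> fi f0.
have aeN N : {ae lebesgue_rV R n, forall x, cube N x -> f x = 0%R}.
  apply: (@ae_eq0_pi_system _ _ _ (lebesgue_rV R n) _ (cube N) f (measurable_boxE n)) => //.
  - move=> A B [p [q ->]] [r [s ->]]; rewrite boxI.
    by eexists; eexists; reflexivity.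
  - exact: measurable_box.
  - exact: f0.
  - by move=> A [p [q ->]]; rewrite boxI f0.
have := ae_foralln aeN; apply: filterS => x /= h.
by have [N] := cube_cover x; exact: h.
Qed.

End vanishing_integrals.

(** * Smooth functions of one variable *)

Section smooth_functions.
Context (R : realType).
Implicit Types (f g : R -> R).

Fixpoint Cn (n : nat) f : Prop :=
  if n is m.+1 then (forall x, derivable f x 1) /\ Cn m (derive1 f) else True.

Definition smooth1 f := forall n, Cn n f.

Lemma CnW n f : Cn n.+1 f -> Cn n f.
Proof. by elim: n f => //= n IHn f [df /IHn Cf']. Qed.

Lemma smooth1_derivable f x : smooth1 f -> derivable f x 1.
Proof. by move=> /(_ 1%N)[]. Qed.

Lemma smooth1_continuous f : smooth1 f -> continuous f.
Proof.
move=> sf x; apply: differentiable_continuous; apply/derivable1_diffP.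
exact: smooth1_derivable.
Qed.

Lemma smooth1_derive f : smooth1 f -> smooth1 (derive1 f).
Proof. by move=> sf n; have [] := sf n.+1. Qed.

Lemma Cn_derive1 n f g : (forall x : R, is_derive x (1 : R) f (g x)) -> Cn n g -> Cn n.+1 f.
Proof.
move=> dfg Cg; split=> [x|]; first exact: ex_derive.
by rewrite (_ : (derive1 f) = g)//; apply/funext => x; rewrite derive1E; exact: derive_val.
Qed.

Lemma smooth1_antiderivative f g :
  (forall x : R, is_derive x (1 : R) f (g x)) -> smooth1 g -> smooth1 f.
Proof. by move=> dfg sg [//|n]; exact: Cn_derive1 dfg (sg n). Qed.

Lemma CnD n f g : Cn n f -> Cn n g -> Cn n (fun x => f x + g x).
Proof.
elim: n f g => //= n IHn f g [df Cf] [dg Cg]; apply: (Cn_derive1 (g := fun x => (derive1 f) x + (derive1 g) x)).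
  by move=> x; rewrite !derive1E; apply: is_deriveD; exact: derivableP.
exact: IHn.
Qed.

Lemma CnM n f g : Cn n f -> Cn n g -> Cn n (fun x => f x * g x).
Proof.
elim: n f g => // n IHn f g Cf Cg.
have [df Cf'] := Cf; have [dg Cg'] := Cg.
apply: (Cn_derive1 (g := fun x => f x * (derive1 g) x + g x * (derive1 f) x)).
  by move=> x; rewrite !derive1E; apply: is_deriveM; exact: derivableP.
by apply: CnD; apply: IHn => //; exact: CnW.
Qed.

Lemma Cn_cst n (c : R) : Cn n (fun=> c).
Proof.
elim: n c => // n IHn c; apply: (Cn_derive1 (g := fun=> 0)) => // x.
Qed.

Lemma Cn_affine n (c p : R) f : Cn n f -> Cn n (fun x => f (c * x + p)).
Proof.
elim: n f => // n IHn f [df Cf].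
apply: (Cn_derive1 (g := fun x => c * (derive1 f) (c * x + p))); last first.
  by apply: CnM; [exact: Cn_cst|exact: IHn].
move=> x; rewrite derive1E mulrC.
apply: (@is_derive1_comp _ f (fun x => c * x + p)).
  exact: derivableP.
by apply: trigger_derive; rewrite /GRing.scale/= mulr1 addr0.
Qed.

(** The family exp(-1/x)/x^n (for x > 0) is closed under differentiation up to linear combinations; its members are therefore smooth, at 0 as well. *)
Definition flat n (x : R) : R :=
  if 0 < x then x^-1 ^+ n * expR (- x^-1) else 0.

Lemma flat_le0 n x : x <= 0 -> flat n x = 0.
Proof. by rewrite /flat ltNge => ->. Qed.

Lemma flat_ge0 n x : 0 <= flat n x.
Proof.
rewrite /flat; case: ifPn => // x0.
by rewrite mulr_ge0 ?expR_ge0// exprn_ge0// invr_ge0 ltW.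
Qed.

Lemma flatS n x : 0 < x -> flat n x = x * flat n.+1 x.
Proof.
by move=> x0; rewrite /flat x0 exprS !mulrA divff ?mul1r// gt_eqF.
Qed.

Lemma flat_bound n x : flat n.+1 x <= n.+1%:R ^+ n.+1.
Proof.
rewrite /flat; case: ifPn => [x0|_]; last by rewrite exprn_ge0.
rewrite expRN ler_pdivrMr ?expR_gt0//.
set y := x^-1; have y0 : 0 < y by rewrite invr_gt0.
have n0 : (0 : R) < n.+1%:R by [].
rewrite -[leRHS](_ : (n.+1%:R * expR (y / n.+1%:R)) ^+ n.+1 = _); last first.
  rewrite exprMn -expRM_natl; congr (_ * expR _).
  by rewrite mulrC divfK// gt_eqF.
rewrite lerXn2r ?nnegrE ?(ltW y0) ?mulr_ge0 ?expR_ge0//.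
rewrite mulrC -ler_pdivrMr// (le_trans _ (expR_ge1Dx _))// lerDr//.
Qed.

Lemma is_derive_flat n x :
  is_derive x (1 : R) (flat n) (flat n.+2 x - n%:R * flat n.+1 x).
Proof.
have [x0|x0|->] := ltgtP x 0.
- rewrite !flat_le0 ?(ltW x0)// mulr0 subr0.
  apply: (@near_eq_is_derive _ _ _ (cst 0)).
  by near=> y; rewrite flat_le0//= ltW//; near: y; exact: lt_nbhsl.
- apply: (@near_eq_is_derive R R R (fun x : R => x^-1 ^+ n * expR (- x^-1) : R)).
  + by near=> y; rewrite /flat ifT//; near: y; exact: lt_nbhsr.
  + have xn0 : x != 0 by rewrite gt_eqF.
    have dV : is_derive x (1 : R) (fun x => x^-1) (- x ^- 2).
      apply: is_derive_eq; first by apply: (@is_deriveV _ id x).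
      by rewrite /GRing.scale/= mulr1.
    have dE : is_derive x (1 : R) (fun x => expR (- x^-1)) (expR (- x^-1) * x ^- 2).
      apply: (@is_derive1_comp _ expR (fun x => - x^-1)).
      by apply: trigger_derive; rewrite opprK.
    have dX : is_derive x (1 : R) (fun x : R => x^-1 ^+ n) ((n%:R * x^-1 ^+ n.-1) *: (- x ^- 2)).
      rewrite (_ : (fun x : R => _) = (fun x : R => x^-1 : R) ^+ n).
        exact: is_deriveX.
      by apply/funext => y; rewrite exprfctE.
    apply: (@is_derive_eq _ _ _ _ _ _ _ _ (is_deriveM dX dE)).
    rewrite /flat x0 /GRing.scale/= -exprVn -mulr_natl.
    case: n {dX} => [|n] /=; first by ring.
    by rewrite !exprS; ring.
- rewrite !flat_le0// mulr0 subr0.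
  suff h : h^-1 *: (flat n (h *: 1 + 0) - flat n 0) @[h --> (0 : R)^'] --> (0 : R).
    by apply: DeriveDef; [apply/cvg_ex; exists 0|exact/cvg_lim].
  have lim0 : `|h| * n.+2%:R ^+ n.+2 @[h --> (0 : R)^'] --> (0 : R).
    rewrite -[X in _ --> X](mul0r (n.+2%:R ^+ n.+2)) -{2}(normr0 R).
    apply: cvgM; last exact: cvg_cst.
    by apply: cvg_within_filter; exact: norm_continuous.
  apply: (@squeeze_cvgr _ _ _ _ (fun h : R => - (`|h| * n.+2%:R ^+ n.+2)) (fun h : R => `|h| * n.+2%:R ^+ n.+2)).
  + near=> h; rewrite -ler_norml addr0 (flat_le0 _ (lexx _)) subr0 /GRing.scale/= mulr1.
    have [h0|h0] := leP h 0.
      by rewrite flat_le0// mulr0 normr0 mulr_ge0// exprn_ge0.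
    rewrite (flatS _ h0) mulKf ?gt_eqF// (flatS _ h0).
    by rewrite !ger0_norm ?mulr_ge0 ?flat_ge0 ?(ltW h0)// ler_pM2l// flat_bound.
  + by rewrite -[X in _ --> X]oppr0; apply: cvgN; exact: lim0.
  + exact: lim0.
Unshelve. all: by end_near. Qed.

Lemma smooth1_flat n : smooth1 (flat n).
Proof.
move=> m; elim: m n => // m IHm n; apply: Cn_derive1; first exact: is_derive_flat.
have := CnD (IHm n.+2) (CnM (Cn_cst m (- n%:R)) (IHm n.+1)).
by under eq_fun do rewrite mulNr.
Qed.

End smooth_functions.

(** * Products of primitives *)

Section product_rule.
Context (R : realType).
Local Notation mu := (@lebesgue_measure R).

Lemma measurable_itvR (I : interval R) : measurable ([set` I] : set (measurableTypeR R)).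
Proof. exact: measurable_itv. Qed.

Lemma measurable_ler2 : measurable [set p : measurableTypeR R * measurableTypeR R | p.2 <= p.1].
Proof.
rewrite -[X in measurable X]setTI.
exact: (measurable_fun_le measurableT measurable_snd measurable_fst).
Qed.

Lemma fubini_triangle (f k : R -> R) :
  mu.-integrable setT (EFin \o f) -> mu.-integrable setT (EFin \o k) ->
  \int[mu]_x (f x * \int[mu]_(y in `]-oo, x]) k y) =
  \int[mu]_y (k y * \int[mu]_(x in `[y, +oo[) f x).
Proof.
move=> fi ki.
have mf : measurable_fun setT f by apply/measurable_EFinP; exact: measurable_int fi.
have mk : measurable_fun setT k by apply/measurable_EFinP; exact: measurable_int ki.
pose T := [set p : measurableTypeR R * measurableTypeR R | p.2 <= p.1].
pose P (p : measurableTypeR R * measurableTypeR R) := (f p.1 * k p.2 * \1_T p)%:E.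
have mP : measurable_fun setT P.
  apply/measurable_EFinP; apply: measurable_funM; first apply: measurable_funM.
  - exact: measurableT_comp mf measurable_fst.
  - exact: measurableT_comp mk measurable_snd.
  - by apply: measurable_indic; exact: measurable_ler2.
have iP : (mu \x mu)%E.-integrable setT P.
  apply/integrable12ltyP => //.
  apply: (@le_lt_trans _ _ (\int[mu]_x (`|(f x)%:E| * \int[mu]_y `|(k y)%:E|))%E).
    apply: ge0_le_integral => //.
    - by move=> x _; exact: integral_ge0.
    - apply: (measurable_fun_fubini_tonelli_F (abse \o P)).
        exact: measurableT_comp.
      by move=> p; rewrite /= lee_fin.
    - apply: emeasurable_funM => //.
      by apply: measurableT_comp => //; exact/measurable_EFinP.
    - move=> x _; rewrite -ge0_integralZl//; last first.
        by apply: measurableT_comp => //; exact/measurable_EFinP.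
      apply: ge0_le_integral => //.
      + apply: measurableT_comp => //.
        exact: measurableT_comp mP (measurable_pair1 x).
      + apply: emeasurable_funM => //.
        by apply: measurableT_comp => //; exact/measurable_EFinP.
      + move=> y _; rewrite /P -abseM -EFinM lee_fin/= normrM.
        by rewrite ler_piMr// indicE; case: (_ \in _); rewrite ?normr1 ?normr0.
  have /integrableP[_ fioo] := fi; have /integrableP[_ kioo] := ki.
  rewrite ge0_integralZr//.
  - by rewrite lte_mul_pinfty// ?integral_ge0// ge0_fin_numE// integral_ge0.
  - by apply: measurableT_comp => //; exact/measurable_EFinP.
  - exact: integral_ge0.
have := Fubini iP.
have -> : (\int[mu]_x \int[mu]_y P (x, y))%E =
  (\int[mu]_x (f x * \int[mu]_(y in `]-oo, x]) k y)%:E)%E.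
  apply: eq_integral => x _.
  have kx : mu.-integrable `]-oo, x] (EFin \o k) by exact: integrableS ki.
  rewrite EFinM fineK; last exact: integrable_fin_num.
  rewrite integral_mkcond -integralZl//; last first.
    have h := (integrable_mkcond (mu := mu) (D := `]-oo, x]%classic) (EFin \o k) (measurable_itv _)).1 kx.
    exact h.
  apply: eq_integral => y _; rewrite /P /patch indicE.
  have -> : ((x, y) \in T) = (y \in `]-oo, x]%classic).
    by apply/idP/idP; rewrite !inE /T /= ?in_itv.
  by case: ifPn => _; rewrite ?mulr1 ?mulr0 ?mule0.
have -> : (\int[mu]_y \int[mu]_x P (x, y))%E =
  (\int[mu]_y (k y * \int[mu]_(x in `[y, +oo[) f x)%:E)%E.
  apply: eq_integral => y _.
  have fy : mu.-integrable `[y, +oo[ (EFin \o f) by exact: integrableS fi.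
  rewrite EFinM fineK; last exact: integrable_fin_num.
  rewrite integral_mkcond -integralZl//; last first.
    have h := (integrable_mkcond (mu := mu) (D := `[y, +oo[%classic) (EFin \o f) (measurable_itv _)).1 fy.
    exact h.
  apply: eq_integral => x _; rewrite /P /patch indicE.
  have -> : ((x, y) \in T) = (x \in `[y, +oo[%classic).
    by apply/idP/idP; rewrite !inE /T /= ?in_itv/= ?andbT.
  by case: ifPn => _; rewrite ?mulr1 ?mulr0 ?mule0//= mulrC.
by rewrite /Rintegral => ->.
Qed.

Lemma integrable_mul_continuous (f h : R -> R) (a b : R) :
  mu.-integrable `[a, b] (EFin \o f) -> {within `[a, b], continuous h} ->
  mu.-integrable `[a, b] (fun x => (f x * h x)%:E).
Proof.
move=> fi ch.
have mh : measurable_fun (`[a, b] : set (measurableTypeR R)) h by exact: subspace_continuous_measurable_fun.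
have bh : [bounded h x | x in `[a, b]].
  have := continuous_compact ch (@segment_compact _ a b).
  move=> /compact_bounded [M [Mr hM]]; exists M; split => // r Mr' x abx.
  by apply: (hM r Mr' (h x)); exists x.
have mab : measurable (`[a, b] : set (measurableTypeR R)) by exact: measurable_itv.
exact (integrableMl mab fi mh bh).
Qed.

Lemma continuous_primitive (f : R -> R) (a b c : R) : a <= b ->
  mu.-integrable `[a, b] (EFin \o f) ->
  {within `[a, b], continuous (fun x => c + \int[mu]_(t in `[a, x]) f t)}.
Proof.
move=> ab fi x; apply: cvgD; first exact: cvg_cst.
exact: (parameterized_integral_continuous ab fi).
Qed.

(** Integration by parts for primitives of merely integrable functions: both sides are an integral over a triangle. *)
Lemma primitive_product (f k : R -> R) (a b F0 K0 : R) : a <= b ->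
  mu.-integrable `[a, b] (EFin \o f) -> mu.-integrable `[a, b] (EFin \o k) ->
  let F x := F0 + \int[mu]_(t in `[a, x]) f t in
  let K x := K0 + \int[mu]_(t in `[a, x]) k t in
  \int[mu]_(x in `[a, b]) (f x * K x) + \int[mu]_(x in `[a, b]) (k x * F x) =
  F b * K b - F0 * K0.
Proof.
move=> ab fi ki F K.
pose IF x := \int[mu]_(t in `[a, x]) f t; pose IK x := \int[mu]_(t in `[a, x]) k t.
have cIF : {within `[a, b], continuous IF} by exact: parameterized_integral_continuous.
have cIK : {within `[a, b], continuous IK} by exact: parameterized_integral_continuous.
have E1 : \int[mu]_(x in `[a, b]) (f x * K x) = K0 * IF b + \int[mu]_(x in `[a, b]) (f x * IK x).
  under eq_Rintegral do rewrite /K mulrDr (mulrC _ K0).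
  rewrite RintegralD//; first by rewrite RintegralZl.
  - exact: integrable_Zl.
  - exact: integrable_mul_continuous.
have E2 : \int[mu]_(x in `[a, b]) (k x * F x) = F0 * IK b + \int[mu]_(x in `[a, b]) (k x * IF x).
  under eq_Rintegral do rewrite /F mulrDr (mulrC _ F0).
  rewrite RintegralD//; first by rewrite RintegralZl.
  - exact: integrable_Zl.
  - exact: integrable_mul_continuous.
have rest (g : R -> R) : mu.-integrable `[a, b] (EFin \o g) ->
    mu.-integrable setT (EFin \o (g \_ `[a, b])).
  by move=> gi; rewrite -restrict_EFin; exact: (integrable_mkcond _ _).1 gi.
have key : \int[mu]_(x in `[a, b]) (f x * IK x) =
    \int[mu]_(x in `[a, b]) (k x * (IF b - IF x)).
  have := fubini_triangle (rest f fi) (rest k ki).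
  have -> : \int[mu]_x ((f \_ `[a, b]) x * \int[mu]_(y in `]-oo, x]) (k \_ `[a, b]) y) =
     \int[mu]_(x in `[a, b]) (f x * IK x).
    rewrite [RHS]Rintegral_mkcond; apply: eq_Rintegral => x _.
    rewrite /patch; case: ifPn => [|_]; last by rewrite mul0r.
    rewrite inE/= in_itv/= => /andP[ax xb]; congr (_ * _).
    rewrite -Rintegral_mkcondr; congr Rintegral; apply/seteqP.
    split=> y/=; rewrite !in_itv/=; first by move=> [yx /andP[-> _]].
    by move=> /andP[-> yx]; rewrite yx (le_trans yx xb).
  move=> ->; rewrite [RHS]Rintegral_mkcond; apply: eq_Rintegral => x _.
  rewrite /patch; case: ifPn => [|_]; last by rewrite mul0r.
  rewrite inE/= in_itv/= => /andP[ax xb]; congr (_ * _).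
  rewrite -Rintegral_mkcondr /IF (@Rintegral_itvB _ f (BLeft a) (BRight b) x) ?bnd_simp//.
  have fxb : mu.-integrable `]x, b] (EFin \o f).
    by apply: integrableS fi => //; apply: subset_itvr; rewrite bnd_simp.
  rewrite Rintegral_itv_obnd_cbnd; last by have /measurable_EFinP := measurable_int _ fxb.
  congr Rintegral; apply/seteqP.
  split=> y/=; rewrite !in_itv/= ?andbT; first by move=> [-> /andP[_ ->]].
  by move=> /andP[xy yb]; rewrite xy yb (le_trans ax xy).
rewrite E1 E2 key.
under [X in _ + X + _ = _]eq_Rintegral do rewrite mulrBr (mulrC _ (IF b)).
rewrite RintegralB//; last 2 first.
- exact: integrable_Zl.
- exact: integrable_mul_continuous.
rewrite RintegralZl//.
have e1 : F b = F0 + IF b by [].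
have e2 : K b = K0 + IK b by [].
rewrite e1 e2 -/(IK b); ring.
Qed.

End product_rule.

(** * Bumps and product test functions *)

Section bumps.
Context (R : realType).
Local Notation mu := (@lebesgue_measure R).

Definition bump (p q : R) (k : nat) (x : R) : R :=
  flat 0 (k.+1%:R * (x - p)) * flat 0 (k.+1%:R * (q - x)).

Lemma smooth1_bump p q k : smooth1 (bump p q k).
Proof.
move=> n; apply: CnM.
- have := Cn_affine k.+1%:R (- (k.+1%:R * p)) (@smooth1_flat R 0 n).
  by under eq_fun do rewrite -mulrBr.
- have := Cn_affine (- k.+1%:R) (k.+1%:R * q) (@smooth1_flat R 0 n).
  by under eq_fun do rewrite addrC mulNr -mulrBr.
Qed.

Lemma flat_le1 (x : R) : flat 0 x <= 1.
Proof.
rewrite /flat; case: ifPn => // x0; rewrite expr0 mul1r -expR0 ler_expR.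
by rewrite oppr_le0 invr_ge0 ltW.
Qed.

Lemma bump_ge0 p q k x : 0 <= bump p q k x.
Proof. by rewrite mulr_ge0 ?flat_ge0. Qed.

Lemma bump_le1 p q k x : bump p q k x <= 1.
Proof. by rewrite -(mulr1 1) ler_pM ?flat_ge0 ?flat_le1. Qed.

Lemma bump_neq0 p q k x : bump p q k x != 0 -> p < x < q.
Proof.
apply: contraR; rewrite negb_and -!leNgt => /orP[xp|qx]; rewrite /bump.
- by rewrite (flat_le0 0 (x := _ * (x - p))) ?mul0r// mulr_ge0_le0 ?subr_le0.
- by rewrite (flat_le0 0 (x := _ * (q - x))) ?mulr0// mulr_ge0_le0 ?subr_le0.
Qed.

Lemma flat0_cvg1 (y : nat -> R) : y n @[n --> \oo] --> +oo ->
  flat 0 (y n) @[n --> \oo] --> (1 : R).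
Proof.
move=> yoo; apply: cvg_trans (_ : expR (- (y n)^-1) @[n --> \oo] --> _).
  apply: near_eq_cvg; near=> n.
  rewrite /flat ifT ?expr0 ?mul1r//.
  by near: n; move/cvgryPgt : yoo; exact.
rewrite -(expR0 R) -oppr0; apply: continuous_cvg; first exact: continuous_expR.
by apply: cvgN; apply/(gtr0_cvgV0 (f := y)) => //; move/cvgryPgt : yoo; exact.
Unshelve. all: by end_near. Qed.

(** The end points are rational because only countably many test functions can be used simultaneously on almost every line. *)
Lemma bump_approx (p q : R) : exists r s : nat -> rat,
  [/\ (forall n, p < (ratr (r n) : R)), (forall n, (ratr (s n) : R) < q) &
   forall x : R, bump (ratr (r n)) (ratr (s n)) n x @[n --> \oo] -->
     ((p < x < q)%R%:R : R)].
Proof.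
have /choice[r rp] (n : nat) : exists r : rat, p < ratr r < p + n.+1%:R^-1.
  have [|r rI] := @rat_in_itvoo R p (p + n.+1%:R^-1); first by rewrite ltrDl invr_gt0.
  by exists r; move: rI; rewrite in_itv.
have /choice[s sq] (n : nat) : exists s : rat, q - n.+1%:R^-1 < ratr s < q.
  have [|s sI] := @rat_in_itvoo R (q - n.+1%:R^-1) q; first by rewrite ltrBlDr ltrDl invr_gt0.
  by exists s; move: sI; rewrite in_itv.
exists r, s; split=> [n|n|x]; [by have /andP[] := rp n|by have /andP[] := sq n|].
have [/andP[px xq]|] := boolP (p < x < q); last first.
  move=> nx; apply: cvg_near_cst; near=> n.
  apply/eqP; apply: contraNT nx => /bump_neq0 /andP[rx xs].
  have /andP[pr _] := rp n; have /andP[_ sq'] := sq n.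
  by rewrite (lt_trans pr rx) (lt_trans xs sq').
have lin (e : R) : 0 < e -> n.+1%:R * e - 1 @[n --> \oo] --> +oo.
  move=> e0; apply/cvgryPge => A; near=> n.
  rewrite lerBrDr -ler_pdivrMr//.
  have : `|(A + 1) / e| <= n%:R by near: n; exact: nbhs_infty_ger.
  by rewrite -natr1 => /(le_trans (ler_norm _)) /le_trans; apply; rewrite lerDl.
rewrite -[X in _ --> X](mulr1 1); apply: cvgM; apply: flat0_cvg1.
- apply: (@ger_cvgy _ _ _ _ (fun n : nat => n.+1%:R * (x - p) - 1)); last first.
    by apply: lin; rewrite subr_gt0.
  near=> n; have /andP[_ rn] := rp n.
  have : n.+1%:R * (ratr (r n) - p) < 1 by rewrite -ltr_pdivlMl// mulr1 ltrBlDl.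
  by lra.
- apply: (@ger_cvgy _ _ _ _ (fun n : nat => n.+1%:R * (q - x) - 1)); last first.
    by apply: lin; rewrite subr_gt0.
  near=> n; have /andP[sn _] := sq n.
  have : n.+1%:R * (q - ratr (s n)) < 1.
    by rewrite -ltr_pdivlMl// mulr1 ltrBlDl -ltrBlDr.
  by lra.
Unshelve. all: by end_near. Qed.

Lemma restrict_support (f : R -> R) (a b : R) :
  (forall x, f x != 0 -> a <= x <= b) -> f \_ `[a, b] = f.
Proof.
move=> fab; apply/funext => x; rewrite /patch; case: ifPn => // xab.
apply/esym/eqP; apply: contraNT xab => /fab; by rewrite inE/= in_itv.
Qed.

Lemma integrable_support (f : R -> R) (a b : R) :
  (forall x, f x != 0 -> a <= x <= b) ->
  mu.-integrable `[a, b] (EFin \o f) -> mu.-integrable setT (EFin \o f).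
Proof.
move=> fab fi; rewrite -(restrict_support fab) -restrict_EFin.
exact: (integrable_mkcond _ _).1 fi.
Qed.

Lemma Rintegral_support (f : R -> R) (a b : R) :
  (forall x, f x != 0 -> a <= x <= b) ->
  \int[mu]_x f x = \int[mu]_(x in `[a, b]) f x.
Proof. by move=> fab; rewrite [RHS]Rintegral_mkcond restrict_support. Qed.

Lemma continuous_itv_integrable (f : R -> R) (a b : R) : continuous f ->
  mu.-integrable `[a, b] (EFin \o f).
Proof.
move=> cf; apply: continuous_compact_integrable; first exact: segment_compact.
exact: continuous_subspaceT.
Qed.

Lemma Rintegral_mul_itv (a b p q : R) (w : R -> R) : a <= p -> q <= b ->
  \int[mu]_(x in `[a, b]) (w x * (p < x < q)%R%:R) = \int[mu]_(x in `]p, q[) w x.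
Proof.
move=> ap qb; rewrite Rintegral_mkcond [RHS]Rintegral_mkcond.
apply: eq_Rintegral => x _; rewrite /patch !mem_setE !in_itv/=.
case: (boolP (p < x < q)) => [/andP[px xq]|_]; last by rewrite mulr0; case: ifP.
by rewrite (le_trans ap (ltW px)) (le_trans (ltW xq) qb) mulr1.
Qed.

Lemma bump_integrable p q k : mu.-integrable setT (fun x => (bump p q k x)%:E).
Proof.
apply: (@integrable_support _ p q).
  by move=> x /bump_neq0 /andP[/ltW-> /ltW->].
by apply: continuous_itv_integrable => x; apply: smooth1_continuous; exact: smooth1_bump.
Qed.

End bumps.

Section product_functions.
Context (R : realType) (n : nat).

Definition tens (f : 'I_n -> R -> R) (x : 'rV[R]_n) : R := \prod_j f j (x 0 j).

Lemma differentiable_tens (f : 'I_n -> R -> R) x : (forall j (t : R), derivable (f j) t 1) ->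
  differentiable (tens f) x.
Proof.
move=> df; rewrite /tens; elim: (index_enum _) => [|j s IHs].
  under eq_fun do rewrite big_nil; exact: differentiable_cst.
under eq_fun do rewrite big_cons.
apply: differentiableM => //.
apply: (@differentiable_comp _ _ _ _ (fun x : 'rV[R]_n => x 0 j) (f j)).
  exact: differentiable_coord.
exact/derivable1_diffP.
Qed.

Lemma partial_tens (f : 'I_n -> R -> R) i : (forall j (t : R), derivable (f j) t 1) ->
  partial i (tens f) = tens (fun j => if j == i then derive1 (f i) else f j).
Proof.
move=> df; apply/funext => x; rewrite /partial /tens.
rewrite [RHS](bigD1 i)//= eqxx.
under [in RHS]eq_bigr => j /negbTE -> do [].
set C := (X in _ = _ * X).
rewrite derive1E /derive; apply/cvg_lim => //.
have -> : (fun h : R => h^-1 *: ((\prod_j f j ((h *: delta_mx 0 i + x) 0 j)) - \prod_j f j (x 0 j))) =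
    (fun h : R => h^-1 *: ((f i \o shift (x 0 i)) (h *: 1) - f i (x 0 i)) * C).
  apply/funext => h; rewrite (bigD1 i)//= [X in _ - X](bigD1 i)//=.
  rewrite [in X in X - _](eq_bigr (fun j => f j (x 0 j))); last first.
    by move=> j ji; rewrite !mxE (negbTE ji) andbF mulr0 add0r.
  by rewrite -mulrBl !mxE !eqxx -scalerAl.
apply: cvgM; last exact: cvg_cst.
exact: (df i (x 0 i)).
Qed.

Lemma smooth_tens (f : 'I_n -> R -> R) : (forall j, smooth1 (f j)) -> smooth (tens f).
Proof.
move=> sf s.
suff [g [sg ->]] : exists g, (forall j, smooth1 (g j)) /\ foldr (@partial R n) (tens f) s = tens g.
  by move=> x; apply: differentiable_tens => j t; exact: smooth1_derivable.
elim: s => [|i s [g [sg IH]]]; first by exists f.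
exists (fun j => if j == i then derive1 (g i) else g j); split=> [j|/=].
  by case: ifP => _ //; exact: smooth1_derive.
by rewrite IH partial_tens// => j t; exact: smooth1_derivable.
Qed.

Lemma test_function_tens (f : 'I_n -> R -> R) (N : R) : (forall j, smooth1 (f j)) ->
  (forall j t, f j t != 0 -> `|t| <= N) -> test_function (tens f).
Proof.
move=> sf fN; split; first exact: smooth_tens.
pose K := [set x : 'rV[R]_n | forall j, `[- N, N]%classic (x ord0 j)].
have cK : compact K by apply: (@rV_compact R n (fun=> `[- N, N]%classic)) => j; exact: segment_compact.
have clK : closed K by apply: compact_closed.
apply: (@subclosed_compact _ _ K) => //; first exact: closed_closure.
rewrite [X in _ `<=` X]((closure_id K).1 clK); apply: closure_subset => x /= fx0 j.
rewrite /= in_itv/= -ler_norml; apply: (fN j).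
by apply: contraNN fx0 => /eqP fj0; rewrite /tens (bigD1 j)//= fj0 mul0r.
Qed.

End product_functions.

(** * Weak derivatives on the line *)

Section weak_derivative_line.
Context (R : realType).
Local Notation mu := (@lebesgue_measure R).

Lemma exists_mollifier : exists theta : R -> R,
  [/\ smooth1 theta, (forall x, theta x != 0 -> 0 < x < 1) & \int[mu]_x theta x = 1].
Proof.
have [r [s [r0 s1 cvb]]] := @bump_approx R 0 1.
pose f n := bump (ratr (r n)) (ratr (s n)) n : R -> R.
have supp n x : f n x != 0 -> 0 < x < 1.
  by move=> /bump_neq0 /andP[rx xs]; rewrite (lt_trans (r0 n) rx) (lt_trans xs (s1 n)).
have int01 n : \int[mu]_x f n x = \int[mu]_(x in `[0, 1]) f n x.
  by apply: Rintegral_support => x /supp /andP[/ltW-> /ltW->].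
have mb n : measurable_fun (`[0, 1] : set (measurableTypeR R)) (f n).
  apply: measurable_funTS; apply: continuous_measurable_fun => x.
  by apply: smooth1_continuous; exact: smooth1_bump.
have i1 : mu.-integrable `[0, 1] (fun=> (1 : R)%:E).
  by apply: (@continuous_itv_integrable _ (fun=> 1)) => x; exact: cvg_cst.
have bd n x : `[0, 1]%classic x -> `|f n x| <= 1.
  by move=> _; rewrite ger0_norm ?bump_ge0 ?bump_le1.
have [_] := Rintegral_cvg_everywhere (measurable_itvR `[0, 1]) mb (fun x _ => cvb x) i1 bd.
rewrite (_ : (fun x : R => (0 < x < 1)%R%:R : R) = (fun x => 1 * (0 < x < 1)%R%:R)); last first.
  by apply/funext => x; rewrite mul1r.
rewrite (@Rintegral_mul_itv R 0 1 0 1 (fun=> 1))// Rintegral_cst//.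
rewrite [X in fine X](_ : _ = 1%E); last first.
  apply: (etrans (lebesgue_measure_itv `]0, 1[)).
  by rewrite /= lte_fin ltr01 -EFinB subr0.
rewrite mul1r => cv.
have [n fn] : exists n, 0 < \int[mu]_(x in `[0, 1]) f n x.
  have /cvgrPdist_lt /(_ 1 ltr01) [n _ /(_ n (leqnn _))] := cv.
  rewrite ltr_distlC subrr => /andP[h _]; by exists n.
exists (fun x => (\int[mu]_(x in `[0, 1]) f n x)^-1 * f n x); split.
- by move=> m; apply: CnM; [exact: Cn_cst|exact: smooth1_bump].
- by move=> x; rewrite mulf_eq0 negb_or => /andP[_ /supp].
- rewrite RintegralZl//; last exact: bump_integrable.
  by rewrite int01 mulVf// gt_eqF.
Qed.

(** The primitive of a bump corrected by a multiple of theta has compact support; differentiating against it tests whether v minus the primitive of g is constant. *)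
Definition centered (theta : R -> R) (p q : R) (k : nat) (x : R) : R :=
  bump p q k x - (\int[mu]_t bump p q k t) * theta x.

Definition test1 theta p q k (x : R) : R :=
  \int[mu]_(t in `]-oo, x]) centered theta p q k t.

Section theta.
Variables (theta : R -> R) (stheta : smooth1 theta).
Hypotheses (supp_theta : forall x, theta x != 0 -> 0 < x < 1)
  (int_theta : \int[mu]_x theta x = 1).

Lemma theta_integrable : mu.-integrable setT (fun x => (theta x)%:E).
Proof.
apply: (@integrable_support _ _ 0 1).
  by move=> x /supp_theta /andP[/ltW-> /ltW->].
by apply: continuous_itv_integrable => x; exact: smooth1_continuous.
Qed.

Lemma smooth1_centered p q k : smooth1 (centered theta p q k).
Proof.
move=> n; have := CnD (@smooth1_bump R p q k n) (CnM (Cn_cst n (- \int[mu]_t bump p q k t)) (stheta n)).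
by under eq_fun do rewrite mulNr.
Qed.

Lemma centered_integrable p q k : mu.-integrable setT (fun x => (centered theta p q k x)%:E).
Proof.
apply: integrable_sub => //; first exact: bump_integrable.
by apply: integrable_Zl => //; exact: theta_integrable.
Qed.

Lemma centered_int0 p q k : \int[mu]_x centered theta p q k x = 0.
Proof.
rewrite /centered RintegralB//; last 2 first.
- exact: bump_integrable.
- by apply: integrable_Zl => //; exact: theta_integrable.
by rewrite RintegralZl ?int_theta ?mulr1 ?subrr//; exact: theta_integrable.
Qed.

Lemma centered_supp (N : R) p q k x : 1 <= N -> - N <= p -> q <= N ->
  centered theta p q k x != 0 -> - N <= x <= N.
Proof.
move=> N1 Np qN; apply: contraNT => xN; rewrite /centered.
have -> : bump p q k x = 0.
  apply/eqP; apply: contraNT xN => /bump_neq0 /andP[/ltW px /ltW xq].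
  by rewrite (le_trans Np px) (le_trans xq qN).
have -> : theta x = 0.
  apply/eqP; apply: contraNT xN => /supp_theta /andP[/ltW px /ltW xq].
  by rewrite (le_trans xq N1) andbT (le_trans _ px)// oppr_le0 (le_trans _ N1).
by rewrite mulr0 subr0.
Qed.

Lemma is_derive_test1 p q k (x : R) :
  is_derive x (1 : R) (test1 theta p q k) (centered theta p q k x).
Proof.
have ci : mu.-integrable `]-oo, (x + 1)] (EFin \o centered theta p q k).
  by apply: integrableS (centered_integrable p q k).
have xx1 : x < x + 1 by rewrite ltrDl.
have [dF F'] := @continuous_FTC1 R (centered theta p q k) -oo%O x (x + 1) xx1 ci
  (ltNyr _) (smooth1_continuous (smooth1_centered p q k) (x:=x)).
by rewrite -F' derive1E; apply: DeriveDef.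
Qed.

Lemma smooth1_test1 p q k : smooth1 (test1 theta p q k).
Proof. exact: smooth1_antiderivative (is_derive_test1 p q k) (smooth1_centered p q k). Qed.

Lemma test1_itv (N : R) p q k x : 1 <= N -> - N <= p -> q <= N ->
  test1 theta p q k x = \int[mu]_(t in `[- N, x]) centered theta p q k t.
Proof.
move=> N1 Np qN; rewrite /test1 Rintegral_mkcond [RHS]Rintegral_mkcond.
apply: eq_Rintegral => t _; rewrite /patch !mem_setE !in_itv/=.
case: (leP (- N) t) => //= tN.
have -> : centered theta p q k t = 0.
  apply/eqP; apply: contraTT tN => /(centered_supp N1 Np qN) /andP[Nt _].
  by rewrite -leNgt.
by case: ifP.
Qed.

Lemma test1_supp (N : R) p q k x : 1 <= N -> - N <= p -> q <= N ->
  test1 theta p q k x != 0 -> - N <= x <= N.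
Proof.
move=> N1 Np qN; apply: contraNT; rewrite negb_and -!ltNge => /orP[xN|Nx].
  by rewrite (test1_itv k x N1 Np qN) set_itv_ge ?Rintegral_set0// bnd_simp -ltNge.
rewrite -(centered_int0 p q k) /test1 Rintegral_mkcond; apply/eqP.
apply: eq_Rintegral => t _; rewrite /patch mem_setE in_itv/=.
case: (leP t x) => // xt; apply/esym/eqP; apply: contraTT xt.
by move=> /(centered_supp N1 Np qN) /andP[_ tN]; rewrite -leNgt (le_trans tN)// ltW.
Qed.

(** Du Bois-Reymond's argument. After an integration by parts, v minus the primitive of g is orthogonal to every bump corrected to mean zero; the correction being along the fixed function theta, the difference has the same mean, its pairing with theta, on every interval. *)
Lemma weak_derivative_primitive (N : R) (v g : R -> R) : 1 <= N ->
  mu.-integrable `[- N, N] (fun x => (v x)%:E) ->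
  mu.-integrable `[- N, N] (fun x => (g x)%:E) ->
  (forall (r s : rat) k, - N <= ratr r -> ratr s <= N ->
    \int[mu]_(t in `[- N, N]) (v t * centered theta (ratr r) (ratr s) k t
      + g t * test1 theta (ratr r) (ratr s) k t) = 0) ->
  exists c, {ae mu, forall t, `[- N, N]%classic t ->
     v t = c + \int[mu]_(s in `[- N, t]) g s}.
Proof.
move=> N1 vi gi vg0.
have NN : - N <= N by rewrite ge0_cp// (le_trans _ N1).
pose G t := \int[mu]_(s in `[- N, t]) g s.
have cG : {within `[- N, N], continuous G} by exact: parameterized_integral_continuous.
have mab : measurable (`[- N, N] : set (measurableTypeR R)) by exact: measurable_itv.
have Gi : mu.-integrable `[- N, N] (fun x => (G x)%:E).
  apply: continuous_compact_integrable; first exact: segment_compact.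
  exact: cG.
pose w t := v t - G t.
have wi : mu.-integrable `[- N, N] (fun x => (w x)%:E) by exact: integrable_sub.
have wmul (h : R -> R) : smooth1 h -> mu.-integrable `[- N, N] (fun x => (w x * h x)%:E).
  move=> sh; apply: integrable_mul_continuous => //.
  by apply: continuous_subspaceT; exact: smooth1_continuous.
pose c := \int[mu]_(t in `[- N, N]) (w t * theta t).
have key (r s : rat) k : - N <= ratr r -> ratr s <= N ->
    \int[mu]_(t in `[- N, N]) (w t * bump (ratr r) (ratr s) k t) =
    c * \int[mu]_(t in `[- N, N]) bump (ratr r) (ratr s) k t.
  move=> Nr sN; set b := bump _ _ _; set be := centered theta (ratr r) (ratr s) k.
  have bei : mu.-integrable `[- N, N] (fun x => (be x)%:E).
    by apply: integrableS (centered_integrable _ _ _).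
  have := primitive_product 0 0 NN gi bei.
  rewrite /= !add0r mulr0 subr0 -(test1_itv k N N1 Nr sN).
  have -> : test1 theta (ratr r) (ratr s) k N = 0.
    rewrite -(centered_int0 (ratr r) (ratr s) k) /test1 Rintegral_mkcond.
    apply: eq_Rintegral => t _; rewrite /patch mem_setE in_itv/=.
    case: (leP t N) => // Nt; apply/esym/eqP; apply: contraTT Nt.
    by move=> /(centered_supp N1 Nr sN) /andP[_ tN]; rewrite -leNgt.
  rewrite mulr0.
  under eq_Rintegral do rewrite add0r -(test1_itv k _ N1 Nr sN).
  under [X in _ + X = _]eq_Rintegral do rewrite add0r -/(G _).
  move=> E; have := vg0 r s k Nr sN; rewrite RintegralD//; first last.
  - apply: integrable_mul_continuous => //.
    by apply: continuous_subspaceT; exact: smooth1_continuous (smooth1_test1 _ _ _).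
  - apply: integrable_mul_continuous => //.
    by apply: continuous_subspaceT; exact: smooth1_continuous (smooth1_centered _ _ _).
  move=> E'.
  have wbe : \int[mu]_(t in `[- N, N]) (w t * be t) = 0.
    rewrite (_ : (fun t => w t * be t) = (fun t => v t * be t - be t * G t)); last first.
      by apply/funext => t; rewrite /w mulrBl (mulrC (G t)).
    rewrite RintegralB//; first by apply/eqP; rewrite subr_eq0; apply/eqP; lra.
    - apply: integrable_mul_continuous => //.
      by apply: continuous_subspaceT; exact: smooth1_continuous (smooth1_centered _ _ _).
    - exact: integrable_mul_continuous.
  move: wbe; rewrite /be /centered.
  under eq_Rintegral do rewrite mulrBr (mulrCA _ _ (theta _)).
  rewrite RintegralB//; last 2 first.
  - by apply: wmul; exact: smooth1_bump.
  - by apply: integrable_Zl => //; exact: wmul.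
  rewrite RintegralZl//; last exact: wmul.
  rewrite -/c => /eqP; rewrite subr_eq0 => /eqP ->; rewrite mulrC; congr (_ * _).
  apply: Rintegral_support => x /bump_neq0 /andP[rx xs].
  by rewrite (le_trans Nr (ltW rx)) (le_trans (ltW xs) sN).
have bN (p q : R) k : measurable_fun (`[- N, N] : set (measurableTypeR R)) (bump p q k).
  apply: measurable_funTS; apply: continuous_measurable_fun => x.
  by apply: smooth1_continuous; exact: smooth1_bump.
have zero (p q : R) : - N <= p -> p < q -> q <= N ->
    \int[mu]_(x in `]p, q[) (w x - c) = 0.
  move=> Np pq qN; have [r [s [pr sq cvb]]] := bump_approx p q.
  have wni : mu.-integrable `[- N, N] (fun x => (`|w x|)%:E) by exact: integrable_norm.
  have bd1 n x : `[- N, N]%classic x ->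
      `|w x * bump (ratr (r n)) (ratr (s n)) n x| <= `|w x|.
    by move=> _; rewrite normrM ler_piMr// ger0_norm ?bump_ge0 ?bump_le1.
  have bd2 n x : `[- N, N]%classic x -> `|1 * bump (ratr (r n)) (ratr (s n)) n x| <= 1 :> R.
    by move=> _; rewrite mul1r ger0_norm ?bump_ge0 ?bump_le1.
  have onei : mu.-integrable `[- N, N] (fun x => (1 : R)%:E).
    by apply: (@continuous_itv_integrable _ (fun=> 1)) => x; exact: cvg_cst.
  have lim (h : R -> R) x : `[- N, N]%classic x ->
      h x * bump (ratr (r n)) (ratr (s n)) n x @[n --> \oo] --> h x * (p < x < q)%R%:R.
    by move=> _; apply: cvgM (cvb x); exact: cvg_cst.
  have mw n : measurable_fun (`[- N, N] : set (measurableTypeR R))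
      (fun x => w x * bump (ratr (r n)) (ratr (s n)) n x).
    by apply: measurable_funM; [exact: integrable_meas wi|exact: bN].
  have m1 n : measurable_fun (`[- N, N] : set (measurableTypeR R))
      (fun x => 1 * bump (ratr (r n)) (ratr (s n)) n x).
    by apply: measurable_funM => //; exact: bN.
  have [_ cv1] := Rintegral_cvg_everywhere mab mw (lim w) wni bd1.
  have [_ cv2] := Rintegral_cvg_everywhere mab m1 (lim (fun=> 1)) onei bd2.
  have e : \int[mu]_(x in `]p, q[) w x = c * \int[mu]_(x in `]p, q[) 1.
    rewrite -(Rintegral_mul_itv w Np qN) -(Rintegral_mul_itv (fun=> 1) Np qN).
    rewrite -(cvg_lim (@Rhausdorff R) cv1); apply/cvg_lim; first exact: Rhausdorff.
    have cv3 := cvgM (@cvg_cst _ c _ \oo _) cv2.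
    rewrite (_ : (fun n => _) = (fun n => c * \int[mu]_(x in `[- N, N])
       (1 * bump (ratr (r n)) (ratr (s n)) n x))); first exact: cv3.
    apply/funext => n.
    rewrite key ?(ltW (le_lt_trans Np (pr n))) ?(ltW (lt_le_trans (sq n) qN))//.
    by congr (_ * _); apply: eq_Rintegral => x _; rewrite mul1r.
  have sub : `]p, q[%classic `<=` `[- N, N]%classic.
    by move=> x /=; rewrite !in_itv/= => /andP[px xq]; rewrite (le_trans Np (ltW px)) (le_trans (ltW xq) qN).
  rewrite RintegralB//; last 2 first.
  - exact: integrableS wi.
  - apply: integrableS (@continuous_itv_integrable _ (fun=> c) (- N) N _) => // x.
    exact: cvg_cst.
  rewrite e -[X in _ - X](_ : \int[mu]_(x in `]p, q[) (c * 1) = _); last first.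
    by apply: eq_Rintegral => x _; rewrite mulr1.
  by rewrite RintegralZl ?subrr//; exact: integrableS onei.
exists c.
have wci : mu.-integrable `[- N, N] (fun x => (w x - c)%:E).
  apply: integrable_sub => //.
  by apply: (@continuous_itv_integrable _ (fun=> c)) => x; exact: cvg_cst.
have zeroE (p q : R) : - N <= p -> p < q -> q <= N ->
    (\int[mu]_(x in `]p, q[) (w x - c)%:E = 0)%E.
  move=> Np pq qN; rewrite -[LHS]fineK; first by congr EFin; exact: zero.
  apply: integrable_fin_num => //; apply: integrableS wci => //.
  by move=> x /=; rewrite !in_itv/= => /andP[px xq]; rewrite (le_trans Np (ltW px)) (le_trans (ltW xq) qN).
have ? : Filter (nbhs (almost_everywhere mu)) by exact: ae_filter_ringOfSetsType.
have := @ae_eq0_itv R (- N) N (fun x => w x - c) wci zeroE.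
apply: filterS => t h tN.
by have := h tN; rewrite /w /G => /eqP; rewrite subr_eq0 subr_eq => /eqP.
Qed.

End theta.
End weak_derivative_line.

(** * Line integrals of weak gradients *)

Section slices.
Context (R : realType) (n : nat) (i : 'I_n.+1).
Local Notation mu := (@lebesgue_measure R).
Local Notation leb := (lebesgue_rV R).

(** Closed, hence compact, so that locally integrable functions are integrable there; the open cubes and boxes serve as the generating family instead. *)
Definition ccube m (N : R) : set 'rV[R]_m := [set x | forall j, `[- N, N]%classic (x ord0 j)].

Lemma compact_ccube m N : compact (@ccube m N).
Proof. by apply: (@rV_compact R m (fun=> `[- N, N]%classic)) => j; exact: segment_compact. Qed.

Lemma measurable_ccube m N : measurable (@ccube m N).
Proof.
rewrite (_ : ccube N = \bigcap_(j in [set: 'I_m])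
      ((fun x : 'rV[R]_m => x 0 j) @^-1` `[- N, N])); last first.
  by apply/seteqP; split => x /= Ax j; [move=> _; exact: Ax|exact: (Ax j I)].
apply: fin_bigcap_measurable => [|j _]; first exact: finite_finset.
by rewrite -[X in measurable X]setTI; exact: measurable_coord.
Qed.

Definition extend (a : R -> R) (b : 'I_n -> R -> R) (j : 'I_n.+1) : R -> R :=
  oapp b a (unlift i j).

Lemma tens_extend a b (x : 'rV[R]_n.+1) :
  tens (extend a b) x = a (x 0 i) * tens b (del i x).
Proof.
rewrite /tens (bigD1_ord i)//= /extend unlift_none/=; congr (_ * _).
by apply: eq_bigr => j _; rewrite liftK/= mxE.
Qed.

Lemma partial_tens_extend a b (x : 'rV[R]_n.+1) :
  smooth1 a -> (forall j, smooth1 (b j)) ->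
  partial i (tens (extend a b)) x = derive1 a (x 0 i) * tens b (del i x).
Proof.
move=> sa sb; rewrite partial_tens; last first.
  move=> j t; rewrite /extend; case: (unlift i j) => [k|] /=; exact: smooth1_derivable.
rewrite /tens (bigD1_ord i)//= eqxx /extend unlift_none/=; congr (_ * _).
by apply: eq_bigr => j _; rewrite eq_sym (negbTE (neq_lift i j)) liftK/= mxE.
Qed.

Lemma loc_integrable_cube (u : 'rV[R]_n.+1 -> R) (N : R) :
  locally_integrable_rV u ->
  (leb n.+1).-integrable setT (fun x => ((u \_ (ccube N)) x)%:E).
Proof.
move=> lu; have := lu _ (@compact_ccube _ N); rewrite integrable_mkcond; last exact: measurable_ccube.
by rewrite restrict_EFin.
Qed.

Section test.
Variables (u g : 'rV[R]_n.+1 -> R).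
Hypotheses (lu : locally_integrable_rV u) (lg : locally_integrable_rV g)
  (ug : forall phi, test_function phi ->
    \int[leb n.+1]_x (u x * partial i phi x) = - \int[leb n.+1]_x (g x * phi x)).
Variables (N : nat) (a : R -> R).
Hypotheses (sa : smooth1 a) (suppa : forall t, a t != 0 -> - N%:R <= t <= N%:R)
  (suppa' : forall t, derive1 a t != 0 -> - N%:R <= t <= N%:R).

Let L (x : 'rV[R]_n) : R := \int[mu]_t (u (ins i t x) * derive1 a t + g (ins i t x) * a t).

Let cutoff (x : 'rV[R]_n) : R := \1_(@cube R n N) x.

Let Lfull (x : 'rV[R]_n.+1) : R :=
  (u x * derive1 a (x 0 i) + g x * a (x 0 i)) * cutoff (del i x).

Let bounded_supp (h : R -> R) : continuous h -> (forall t, h t != 0 -> - N%:R <= t <= N%:R) ->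
  exists M, forall t, `|h t| <= M.
Proof.
move=> ch hN.
have [c cN Hc] : exists2 c, c \in `[- N%:R, N%:R] & forall t, t \in `[- N%:R, N%:R] -> `|h t| <= `|h c|.
  apply: (@EVT_max R (fun t => `|h t|)); first by rewrite ge0_cp.
  by apply: continuous_subspaceT => t; apply: cvg_norm; exact: ch.
exists `|h c| => t; have [->|/hN ht] := eqVneq (h t) 0; first by rewrite normr0.
by apply: Hc; rewrite in_itv.
Qed.

Let piece (w : 'rV[R]_n.+1 -> R) (h : R -> R) : locally_integrable_rV w ->
  continuous h -> (forall t, h t != 0 -> - N%:R <= t <= N%:R) ->
  (leb n.+1).-integrable setT (fun x => (w x * h (x 0 i) * cutoff (del i x))%:E).
Proof.
move=> lw ch hN; have [M hM] := bounded_supp ch hN.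
have := loc_integrable_cube N%:R lw.
rewrite (_ : (fun x => (w x * h (x 0 i) * cutoff (del i x))%:E) =
   (fun x => ((w \_ (ccube N%:R)) x * (h (x 0 i) * cutoff (del i x)))%:E)); last first.
  apply/funext => x; congr EFin; rewrite mulrA /patch; case: ifPn => // xN.
  rewrite !mul0r; have [->|/hN hx] := eqVneq (h (x 0 i)) 0; first by rewrite mulr0 mul0r.
  rewrite /cutoff indicE; case: (boolP (_ \in _)) => [|_]; last by rewrite mulr0.
  rewrite inE => xc; exfalso; move/negP: xN; apply; rewrite inE => j /=.
  have [k ->|->] := unliftP i j; last by rewrite in_itv.
  by have := xc k; rewrite mxE !in_itv/= => /andP[/ltW -> /ltW ->].
apply: (@integrable_bounded_mul _ _ _ _ _ _ _ _ M) => //.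
- apply: measurable_funM.
    apply: (measurableT_comp (f := h)); last exact: measurable_coord.
    exact: continuous_measurable_fun.
  apply: (measurableT_comp (f := cutoff)); last exact: measurable_del.
  by apply: measurable_indic; exact: measurable_box.
- move=> x _; rewrite normrM -(mulr1 M) ler_pM//.
  by rewrite /cutoff indicE; case: (_ \in _); rewrite ?normr1 ?normr0.
Qed.

Let integrable_Lfull : (leb n.+1).-integrable setT (fun x => (Lfull x)%:E).
Proof.
rewrite (_ : (fun x => _) = (fun x => (u x * derive1 a (x 0 i) * cutoff (del i x) +
    g x * a (x 0 i) * cutoff (del i x))%:E)); last first.
  by apply/funext => x; rewrite /Lfull mulrDl.
apply: integrable_add => //; apply: piece => //.
- by apply: smooth1_continuous; exact: smooth1_derive.
- exact: smooth1_continuous.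
Qed.

Let LfullE x : \int[mu]_t Lfull (ins i t x) = L x * cutoff x.
Proof.
rewrite /Lfull /L /cutoff indicE; case: (boolP (x \in _)) => xc.
  by rewrite mulr1; apply: eq_Rintegral => t _; rewrite insK ins_eq indicE xc mulr1.
rewrite mulr0; transitivity (\int[mu]_t (0 : R)); last by rewrite Rintegral_cst// mul0r.
by apply: eq_Rintegral => t _; rewrite insK indicE (negbTE xc) mulr0.
Qed.

Lemma integrable_line_integral : (leb n).-integrable (cube N) (fun x => (L x)%:E).
Proof.
have := Rintegrable_ins i integrable_Lfull.
under eq_fun do rewrite LfullE.
have <- : (EFin \o L) \_ (cube N) = (fun x => (L x * cutoff x)%:E).
  by apply/funext => x; rewrite /patch /cutoff indicE; case: ifPn => _; rewrite ?mulr1 ?mulr0.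
exact: (integrable_mkcond (mu := leb n) (EFin \o L) (@measurable_box R n _ _)).2.
Qed.

(** Fubini's theorem for the weak gradient identity, tested on the product of a function of the i-th coordinate and functions of the others. *)
Lemma line_integral_test (b : 'I_n -> R -> R) : (forall j, smooth1 (b j)) ->
  (forall j t, `|b j t| <= 1) -> (forall j t, b j t != 0 -> - N%:R < t < N%:R) ->
  \int[leb n]_(x in cube N) (L x * tens b x) = 0.
Proof.
move=> sb b1 bN.
have tb x : tens b x != 0 -> cube N x.
  move=> bx j; rewrite in_itv/=; apply: (bN j); apply: contraNN bx => /eqP bj0.
  by rewrite /tens (bigD1 j)//= bj0 mul0r.
have tb1 x : `|tens b x| <= 1.
  rewrite /tens normr_prod; suff /andP[] : 0 <= \prod_j `|b j (x 0 j)| <= 1 by [].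
  elim/big_ind : _ => [|y z /andP[y0 y1] /andP[z0 z1]|j _].
  - by rewrite ler01 lexx.
  - by rewrite mulr_ge0// mulr_ile1.
  - by rewrite normr_ge0 b1.
have mtb : measurable_fun setT (tens b).
  apply: measurable_prod => j _; apply: (measurableT_comp (f := b j)); last exact: measurable_coord.
  by apply: continuous_measurable_fun; exact: smooth1_continuous.
have tbc x : tens b x = tens b x * cutoff x.
  rewrite /cutoff indicE; have [->|/tb xc] := eqVneq (tens b x) 0; first by rewrite mul0r.
  by rewrite mem_set// mulr1.
pose phi := tens (extend a b).
have tphi : test_function phi.
  apply: (@test_function_tens _ _ _ N%:R) => [j|j t].
    by rewrite /extend; case: unlift => [k|] /=; [exact: sb|exact: sa].
  rewrite /extend ler_norml; case: unlift => [k /bN /andP[/ltW-> /ltW->]//|/=].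
  exact: suppa.
have wi (w : 'rV[R]_n.+1 -> R) (h : R -> R) : locally_integrable_rV w ->
    continuous h -> (forall t, h t != 0 -> - N%:R <= t <= N%:R) ->
    (leb n.+1).-integrable setT (fun x => (w x * (h (x 0 i) * tens b (del i x)))%:E).
  move=> lw ch hN.
  have := @integrable_bounded_mul _ _ _ (leb n.+1) setT measurableT _ (fun x => tens b (del i x)) 1 _ _ (piece lw ch hN).
  rewrite (_ : (fun x => (w x * h (x 0 i) * cutoff (del i x) * tens b (del i x))%:E) =
     (fun x => (w x * (h (x 0 i) * tens b (del i x)))%:E)); last first.
    by apply/funext => x; rewrite [in RHS]tbc; congr EFin; ring.
  apply => //; exact: (measurableT_comp mtb (@measurable_del _ _ _)).
have ca : continuous a by exact: smooth1_continuous.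
have ca' : continuous (derive1 a) by apply: smooth1_continuous; exact: smooth1_derive.
have zero : \int[leb n.+1]_x (Lfull x * tens b (del i x)) = 0.
  have := ug tphi; rewrite /phi.
  under eq_Rintegral do rewrite partial_tens_extend//.
  under [X in _ = - X -> _]eq_Rintegral do rewrite tens_extend.
  move/eqP; rewrite -subr_eq0 opprK -RintegralD//; try exact: wi.
  move/eqP => <-; apply: eq_Rintegral => x _; rewrite [in RHS]tbc /Lfull; ring.
have Fi : (leb n.+1).-integrable setT (fun x => (Lfull x * tens b (del i x))%:E).
  apply: (@integrable_bounded_mul _ _ _ _ _ _ _ _ 1) => //.
  exact: (measurableT_comp mtb (@measurable_del _ _ _)).
rewrite -zero (Rfubini_ins i Fi) Rintegral_mkcond.
rewrite /Rintegral; congr fine; apply: ae_eq_integral => //.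
- apply/measurable_EFinP; apply/(measurable_restrictT _ _).1; first exact: measurable_box.
  apply: measurable_funM; last exact: measurable_funTS.
  exact: integrable_meas integrable_line_integral.
- exact: measurable_int (Rintegrable_ins i Fi).
apply: filterS (ae_integrable_ins i integrable_Lfull) => x xi _ /=.
congr EFin; transitivity (tens b x * \int[mu]_t Lfull (ins i t x)).
  rewrite LfullE /patch /cutoff indicE; case: ifPn => _; rewrite ?mulr1 ?mulr0//.
  by rewrite mulrC.
rewrite -RintegralZl//; apply: eq_Rintegral => t _.
by rewrite insK mulrC.
Qed.

End test.
End slices.

Section lines.
Context (R : realType) (n : nat) (i : 'I_n.+1).
Local Notation mu := (@lebesgue_measure R).
Local Notation leb := (lebesgue_rV R).

(** The line integral is orthogonal to products of bumps, which approximate the indicators of boxes. *)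
Lemma ae_line_integral_eq0 (u g : 'rV[R]_n.+1 -> R) (N : nat) (a : R -> R) :
  locally_integrable_rV u -> locally_integrable_rV g ->
  (forall phi, test_function phi ->
    \int[leb n.+1]_x (u x * partial i phi x) = - \int[leb n.+1]_x (g x * phi x)) ->
  smooth1 a -> (forall t, a t != 0 -> - N%:R <= t <= N%:R) ->
  (forall t, derive1 a t != 0 -> - N%:R <= t <= N%:R) ->
  {ae leb n, forall x, \int[mu]_t (u (ins i t x) * derive1 a t + g (ins i t x) * a t) = 0}.
Proof.
move=> lu lg ug sa aN a'N.
have wide (f : R -> R) (M : nat) : (N <= M)%N -> (forall t, f t != 0 -> - N%:R <= t <= N%:R) ->
    (forall t, f t != 0 -> - M%:R <= t <= M%:R).
  move=> NM fN t /fN /andP[Nt tN]; have NMR : N%:R <= M%:R :> R by rewrite ler_nat.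
  by rewrite (le_trans tN NMR) (le_trans _ Nt)// lerN2.
pose L x := \int[mu]_t (u (ins i t x) * derive1 a t + g (ins i t x) * a t).
have Li M : (N <= M)%N -> (leb n).-integrable (cube M) (EFin \o L).
  move=> NM; exact (integrable_line_integral i lu lg sa (wide _ _ NM aN) (wide _ _ NM a'N)).
have LiT M : (leb n).-integrable (cube M) (EFin \o L).
  apply: integrableS (Li _ (leq_maxl N M)); [exact: measurable_box|exact: measurable_box|].
  move=> x xM j; have := xM j; rewrite !in_itv/= => /andP[Mx xM'].
  have MR : M%:R <= (maxn N M)%:R :> R by rewrite ler_nat leq_maxr.
  by rewrite (lt_le_trans xM' MR) (le_lt_trans _ Mx)// lerN2.
apply: ae_eq0_box => // p q.
pose S := \sum_j (`|p j| + `|q j|).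
pose M := (N + (Num.truncn S).+1)%N.
have SM : S <= M%:R.
  by rewrite natrD (le_trans (ltW (truncnS_gt S)))// lerDr.
have pqM j : - M%:R <= p j /\ q j <= M%:R.
  have pS : `|p j| + `|q j| <= M%:R.
    by apply: le_trans SM; rewrite /S (bigD1 j)//= lerDl sumr_ge0// => k _; rewrite addr_ge0.
  have p1 : `|p j| <= M%:R by apply: le_trans pS; rewrite lerDl.
  have q1 : `|q j| <= M%:R by apply: le_trans pS; rewrite lerDr.
  by split; [rewrite lerNl (le_trans _ p1)// -normrN ler_norm|rewrite (le_trans (ler_norm _) q1)].
have sub : box p q `<=` cube M.
  move=> x xpq j; have := xpq j; rewrite !in_itv/= => /andP[px xq].
  by have [Mp qM] := pqM j; rewrite (le_lt_trans Mp px) (lt_le_trans xq qM).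
have /choice[r /choice[s rs]] := fun j => bump_approx (p j) (q j).
pose b k j := bump (ratr (r j k)) (ratr (s j k)) k : R -> R.
have LM := Li M (leq_addr _ _).
have mcube : measurable (@cube R n M) by exact: measurable_box.
have tens_b k x : 0 <= tens (b k) x <= 1.
  rewrite /tens; elim/big_ind : _ => [|y z /andP[y0 y1] /andP[z0 z1]|j _].
  - by rewrite ler01 lexx.
  - by rewrite mulr_ge0// mulr_ile1.
  - by rewrite bump_ge0 bump_le1.
have mtb k : measurable_fun setT (tens (b k)).
  apply: measurable_prod => j _; apply: (measurableT_comp (f := b k j)); last exact: measurable_coord.
  by apply: continuous_measurable_fun; apply: smooth1_continuous; exact: smooth1_bump.
have mLb k : measurable_fun (cube M) (fun x => L x * tens (b k) x).
  apply: measurable_funM; last exact: measurable_funTS.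
  exact: integrable_meas LM.
have cvb x : cube M x -> L x * tens (b k) x @[k --> \oo] --> L x * \prod_j (p j < x 0 j < q j)%R%:R.
  move=> _; apply: cvgM; first exact: cvg_cst.
  rewrite /tens; elim: (index_enum _) => [|j l IHl].
    by rewrite big_nil; under eq_fun do rewrite big_nil; exact: cvg_cst.
  rewrite big_cons; under eq_fun do rewrite big_cons.
  by apply: cvgM => //; have [_ _] := rs j; exact.
have Ln : (leb n).-integrable (cube M) (fun x => `|L x|%:E) by exact (integrable_norm LM).
have bd k x : cube M x -> `|L x * tens (b k) x| <= `|L x|.
  by move=> _; have /andP[t0 t1] := tens_b k x; rewrite normrM ler_piMr// ger0_norm.
have [_ cv] := Rintegral_cvg_everywhere mcube mLb cvb Ln bd.
have E : \int[leb n]_(x in cube M) (L x * \prod_j (p j < x 0 j < q j)%R%:R) = 0.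
  rewrite -(cvg_lim (@Rhausdorff R) cv); apply/cvg_lim; first exact: Rhausdorff.
  rewrite (_ : (fun k => _) = fun=> 0); first exact: cvg_cst.
  apply/funext => k; apply: (line_integral_test lu lg ug sa).
  - exact: wide (leq_addr _ _) aN.
  - exact: wide (leq_addr _ _) a'N.
  - by move=> j; exact: smooth1_bump.
  - by move=> j t; rewrite ger0_norm ?bump_ge0 ?bump_le1.
  - move=> j t /bump_neq0 /andP[rt ts]; have [pr sq _] := rs j; have [Mp qM] := pqM j.
    by rewrite (le_lt_trans Mp (lt_trans (pr k) rt)) (lt_le_trans (lt_trans ts (sq k)) qM).
rewrite -[LHS]fineK; last first.
  by apply: integrable_fin_num; [exact: measurable_box|apply: integrableS LM => //; exact: measurable_box].
congr EFin; rewrite -[RHS]E -/(Rintegral _ _ L) Rintegral_mkcond [RHS]Rintegral_mkcond.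
apply: eq_Rintegral => x _; rewrite /patch; case: ifPn => xb; case: ifPn => // xc.
- rewrite big1 ?mulr1// => j _; move: xb; rewrite inE => /(_ j).
  by rewrite in_itv/= => ->.
- by exfalso; move/negP : xc; apply; move: xb; rewrite !inE; exact: sub.
- have [j /negbTE jN] : exists j, ~~ (p j < x 0 j < q j).
    apply/not_existsP => H; move/negP : xb; apply; rewrite inE => j.
    by rewrite in_itv/=; move: (H j) => /negP; rewrite negbK.
  by rewrite (bigD1 j)//= jN mul0r mulr0.
Qed.

(** A test function of one variable leads to an identity on almost every line. Countably many such functions, with rational end points, give it on the same lines, and they determine the function up to a constant on each of the intervals [-N-1, N+1]. *)
Lemma weak_gradient_lines (u : 'rV[R]_n.+1 -> R) (G : 'rV[R]_n.+1 -> 'rV[R]_n.+1) :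
  is_weak_gradient u G ->
  {ae leb n, forall x, forall N : nat,
    [/\ mu.-integrable `[- N.+1%:R, N.+1%:R] (fun t => (u (ins i t x))%:E),
        mu.-integrable `[- N.+1%:R, N.+1%:R] (fun t => (G (ins i t x) 0 i)%:E) &
        exists c, {ae mu, forall t, `[- N.+1%:R, N.+1%:R]%classic t ->
          u (ins i t x) = c + \int[mu]_(s in `[- N.+1%:R, t]) G (ins i s x) 0 i}]}.
Proof.
move=> [lu /(_ i) lg ug].
have [theta [sth supp_th int_th]] := exists_mollifier R.
have ? : Filter (nbhs (almost_everywhere (leb n))) by exact: ae_filter_ringOfSetsType.
have lines (w : 'rV[R]_n.+1 -> R) : locally_integrable_rV w ->
    {ae leb n, forall x, forall N : nat, mu.-integrable `[- N.+1%:R, N.+1%:R] (fun t => (w (ins i t x))%:E)}.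
  move=> lw; have := ae_foralln (fun N : nat => ae_integrable_ins i (loc_integrable_cube N%:R lw)).
  apply: filterS => x H N.
  have [M xM] := cube_cover x; pose K := maxn N.+1 M.
  have := H K; move=> /(integrableS measurableT (measurable_itvR `[- N.+1%:R, N.+1%:R]) (@subsetT _ _)).
  apply: eq_integrable; first exact: measurable_itv.
  move=> t; rewrite inE/= in_itv/= => /andP[Nt tN]; congr EFin.
  rewrite /patch mem_set// => j /=.
  have NK : N.+1%:R <= K%:R :> R by rewrite ler_nat leq_maxl.
  have MK : M%:R <= K%:R :> R by rewrite ler_nat leq_maxr.
  have [k ->|->] := unliftP i j.
    rewrite ins_lift in_itv/=; have := xM k; rewrite in_itv/= => /andP[/ltW Mx /ltW xM'].
    by rewrite (le_trans xM' MK) (le_trans _ Mx)// lerN2.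
  by rewrite ins_eq in_itv/= (le_trans tN NK) (le_trans _ Nt)// lerN2.
(* a single null set must serve for all the parameters, which are therefore enumerated *)
pose P (m : nat) (x : 'rV[R]_n) :=
  if (unpickle m : option (nat * rat * rat * nat)) is Some (N, r, s, k) then
    - N.+1%:R <= ratr r :> R -> ratr s <= N.+1%:R :> R ->
    \int[mu]_(t in `[- N.+1%:R, N.+1%:R])
      (u (ins i t x) * centered theta (ratr r) (ratr s) k t +
       G (ins i t x) 0 i * test1 theta (ratr r) (ratr s) k t) = 0
  else True.
have aeP m : {ae leb n, forall x, P m x}.
  rewrite /P; case: (unpickle m) => [[[[N r] s] k]|]; last exact: aeW.
  have [Nr|Nr] := boolP (- N.+1%:R <= ratr r :> R); last by apply: aeW => x.
  have [sN|sN] := boolP (ratr s <= N.+1%:R :> R); last by apply: aeW => x.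
  have N1 : 1 <= N.+1%:R :> R by rewrite ler1n.
  set A := test1 theta (ratr r) (ratr s) k; set B := centered theta (ratr r) (ratr s) k.
  have da t : derive1 A t = B t.
    by rewrite derive1E; apply: derive_val; exact: is_derive_test1.
  have sA t : A t != 0 -> - N.+1%:R <= t <= N.+1%:R.
    exact: (test1_supp sth supp_th int_th N1 Nr sN).
  have sB t : B t != 0 -> - N.+1%:R <= t <= N.+1%:R.
    exact: (centered_supp supp_th N1 Nr sN).
  have sA' t : derive1 A t != 0 -> - N.+1%:R <= t <= N.+1%:R by rewrite da; exact: sB.
  have := @ae_line_integral_eq0 u (fun x => G x 0 i) N.+1 A lu lg
    (fun phi => @ug phi i) (smooth1_test1 sth supp_th _ _ _) sA sA'.
  apply: filterS => x H _ _; rewrite -[RHS]H.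
  rewrite [RHS](@Rintegral_support _ _ (- N.+1%:R) N.+1%:R); last first.
    move=> t; apply: contraNT => tN; rewrite da.
    have -> : B t = 0 by apply/eqP; apply: contraNT tN; exact: sB.
    have -> : A t = 0 by apply/eqP; apply: contraNT tN; exact: sA.
    by rewrite !mulr0 addr0.
  by apply: eq_Rintegral => t _; rewrite da.
have := ae_foralln aeP.
move: (lines _ lu) (lines _ lg); apply: filterS3 => x ux gx Px N.
split=> //; have N1 : 1 <= N.+1%:R :> R by rewrite ler1n.
apply: (weak_derivative_primitive sth supp_th int_th N1 (ux N) (gx N)) => r s k Nr sN.
by have := Px (pickle (N, r, s, k)); rewrite /P pickleK; exact.
Qed.

End lines.

(** * Transport to the Gaussian on the line *)

Section distribution_functions.
Context (R : realType).
Local Notation mu := (@lebesgue_measure R).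

Definition cdf1 (f : R -> R) (x : R) : R := \int[mu]_(t in `]-oo, x]) f t.

Section density.
Variable f : R -> R.
Hypotheses (cf : continuous f) (fi : mu.-integrable setT (fun x => (f x)%:E)).

Lemma is_derive_cdf1 (x : R) : is_derive x (1 : R) (cdf1 f) (f x).
Proof.
have ci : mu.-integrable `]-oo, (x + 1)] (EFin \o f) by exact: integrableS fi.
have xx1 : x < x + 1 by rewrite ltrDl.
have [dF F'] := @continuous_FTC1 R f -oo%O x (x + 1) xx1 ci (ltNyr _) (cf (x:=x)).
by rewrite -F' derive1E; apply: DeriveDef.
Qed.

Lemma continuous_cdf1 : continuous (cdf1 f).
Proof.
move=> x; apply: differentiable_continuous; apply/derivable1_diffP.
by have := is_derive_cdf1 x => -[].
Qed.

Lemma derive1_cdf1 x : derive1 (cdf1 f) x = f x.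
Proof. by rewrite derive1E; apply: derive_val; exact: is_derive_cdf1. Qed.

Hypothesis f_gt0 : forall x, 0 < f x.
Hypothesis intf : \int[mu]_x f x = 1.

Lemma cdf1_incr x y : x < y -> cdf1 f x < cdf1 f y.
Proof.
move=> xy; apply: (@gtr0_derive1_incr R (cdf1 f) x y) => //.
- by move=> z _; have [] := is_derive_cdf1 z.
- by move=> z _; rewrite derive1_cdf1.
- by apply: continuous_subspaceT; exact: continuous_cdf1.
Qed.

Lemma cdf1_inj x y : cdf1 f x = cdf1 f y -> x = y.
Proof.
move=> e; have [xy|yx|//] := ltgtP x y.
- by have := cdf1_incr xy; rewrite e ltxx.
- by have := cdf1_incr yx; rewrite e ltxx.
Qed.

Lemma cdf1_ndecr x y : x <= y -> cdf1 f x <= cdf1 f y.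
Proof. by rewrite le_eqVlt => /predU1P[->//|/cdf1_incr/ltW]. Qed.

Lemma cdf1_reflect x y : cdf1 f x <= cdf1 f y -> x <= y.
Proof. by move=> h; rewrite leNgt; apply/negP => /cdf1_incr; rewrite ltNge h. Qed.

Let cdf_patch x : cdf1 f x = \int[mu]_t (f \_ `]-oo, x]) t.
Proof. by rewrite /cdf1 Rintegral_mkcond. Qed.

Let meas_patch x : measurable_fun (setT : set (measurableTypeR R)) (f \_ `]-oo, x]).
Proof.
apply/(measurable_restrictT _ _).1; first exact: measurable_itvR.
by apply: measurable_funTS; exact: integrable_meas fi.
Qed.

Let norm_patch x t : `|(f \_ `]-oo, x]) t| <= f t.
Proof. by rewrite /patch; case: ifPn => _; rewrite ?normr0 ?ger0_norm// ltW. Qed.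

Lemma cvg_cdf1_pinfty (C : nat) : cdf1 f (n + C)%:R @[n --> \oo] --> (1 : R).
Proof.
rewrite -[X in _ --> X]intf.
have cv (x : R) : setT x -> (f \_ `]-oo, (n + C)%:R]) x @[n --> \oo] --> f x.
  move=> _; apply: cvg_near_cst; near=> n; rewrite /patch mem_set//= in_itv/=.
  have : x <= n%:R by apply: le_trans (ler_norm _) _; near: n; exact: nbhs_infty_ger.
  by move=> /le_trans; apply; rewrite ler_nat leq_addr.
have [_] := Rintegral_cvg_everywhere measurableT (fun n => meas_patch (n + C)%:R) cv fi
  (fun n x _ => norm_patch _ _).
rewrite (_ : (fun n => cdf1 f (n + C)%:R) = (fun n => \int[mu]_t (f \_ `]-oo, (n + C)%:R]) t))//.
by apply/funext => n; rewrite cdf_patch.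
Unshelve. all: by end_near. Qed.

Lemma cvg_cdf1_ninfty (C : nat) : cdf1 f (- (n + C)%:R) @[n --> \oo] --> (0 : R).
Proof.
have cv (x : R) : setT x -> (f \_ `]-oo, (- (n + C)%:R)]) x @[n --> \oo] --> (0 : R).
  move=> _; apply: cvg_near_cst; near=> n; rewrite /patch memNset//= in_itv/=.
  apply/negP; rewrite -ltNge ltrNl.
  have : `|x| < n%:R by near: n; exact: nbhs_infty_gtr.
  rewrite -normrN => /(le_lt_trans (ler_norm _)) /lt_le_trans; apply.
  by rewrite ler_nat leq_addr.
have [_] := Rintegral_cvg_everywhere measurableT (fun n => meas_patch (- (n + C)%:R)) cv fi
  (fun n x _ => norm_patch _ _).
rewrite (_ : (fun n => cdf1 f (- (n + C)%:R)) = (fun n => \int[mu]_t (f \_ `]-oo, (- (n + C)%:R)]) t)).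
  by rewrite [X in _ --> X -> _]Rintegral_cst// mul0r.
by apply/funext => n; rewrite cdf_patch.
Unshelve. all: by end_near. Qed.

Lemma cdf1_lt1 x : cdf1 f x < 1.
Proof.
apply: (lt_le_trans (cdf1_incr (_ : x < x + 1))); first by rewrite ltrDl.
rewrite -[X in _ <= X]intf cdf_patch; apply: le_Rintegral => //.
- apply: (integrable_le measurableT (meas_patch _) _ fi) => t _; exact: norm_patch.
- by move=> t _; exact: le_trans (ler_norm _) (norm_patch _ _).
Qed.

Lemma cdf1_gt0 x : 0 < cdf1 f x.
Proof.
apply: (le_lt_trans _ (cdf1_incr (_ : x - 1 < x))); last by rewrite ltrBlDr ltrDl.
by rewrite /cdf1; apply: Rintegral_ge0 => t _; exact: ltW.
Qed.

Lemma cdf1_surj s : 0 < s < 1 -> exists y, cdf1 f y = s.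
Proof.
move=> /andP[s0 s1].
have [n ns] : exists n : nat, s < cdf1 f (n + 0)%:R.
  have /cvgrPdist_lt /(_ (1 - s)) := cvg_cdf1_pinfty 0.
  rewrite subr_gt0 => /(_ s1) [n _ /(_ n (leqnn _))] /= h; exists n.
  by move: h; rewrite gtr0_norm ?subr_gt0 ?cdf1_lt1// ltrD2l ltrN2.
have [m ms] : exists m : nat, cdf1 f (- (m + 0)%:R) < s.
  have /cvgrPdist_lt /(_ s s0) [m _ /(_ m (leqnn _))] := cvg_cdf1_ninfty 0.
  by rewrite /= sub0r normrN gtr0_norm ?cdf1_gt0// => h; exists m.
have ab : - (m + 0)%:R <= (n + 0)%:R :> R.
  by apply: cdf1_reflect; rewrite ltW// (lt_trans ms).
have [||y _ ys] := @IVT R (cdf1 f) _ _ s ab; last by exists y.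
- by apply: continuous_subspaceT; exact: continuous_cdf1.
- by rewrite ge_min (ltW ms)/= le_max (ltW ns) orbT.
Qed.

End density.

Local Notation gam := (normal_pdf (0 : R) 1).

Lemma is_derive_gamma (t : R) : is_derive t (1 : R) gam (- t * gam t).
Proof.
rewrite (_ : gam = (fun t => (2 * pi) `^ (- (1 / 2)) * expR (- (t * t / 2)))); last first.
  by apply/funext => s; rewrite gammaE expr2.
have dq : is_derive t (1 : R) (fun s : R => - (s * s / 2)) (- t).
  apply: trigger_derive; rewrite /GRing.scale/= !mulr0 !mulr1 add0r; lra.
have dE : is_derive t (1 : R) (fun s => expR (- (s * s / 2))) (expR (- (t * t / 2)) * - t).
  exact: (@is_derive1_comp _ expR (fun s => - (s * s / 2))).
set c := _ `^ _; apply: (@is_derive_eq _ _ _ _ _ _ _ _ (is_deriveZ c dE)).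
by rewrite /GRing.scale/=; ring.
Qed.

Lemma continuous_gamma : continuous gam.
Proof. by apply: continuous_normal_pdf; exact: oner_neq0. Qed.

Lemma integrable_gamma : mu.-integrable setT (fun x => (gam x)%:E).
Proof. by apply: integrable_normal_pdf; exact: oner_neq0. Qed.

Lemma Rintegral_gamma : \int[mu]_x gam x = 1.
Proof. by rewrite /Rintegral integral_normal_pdf ?oner_neq0. Qed.

Lemma gamma_average_bounds (f : R -> R) (e M : R) : 0 <= e ->
  measurable_fun (setT : set (measurableTypeR R)) f -> (forall t, e <= f t <= M) ->
  mu.-integrable setT (fun t => (f t * gam t)%:E) /\ e <= \int[mu]_t (f t * gam t) <= M.
Proof.
move=> e0 mf feM; have g0 t : 0 <= gam t by exact/ltW/gamma_gt0.
have gi := integrable_gamma.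
have mgam : measurable_fun (setT : set (measurableTypeR R)) gam by exact: measurable_normal_pdf.
have cgi (c : R) : mu.-integrable setT (fun t => (c * gam t)%:E) by exact: integrable_Zl.
have fi : mu.-integrable setT (fun t => (f t * gam t)%:E).
  apply: (integrable_le measurableT _ _ (cgi M)); first exact: measurable_funM.
  move=> t _; have /andP[h1 h2] := feM t.
  by rewrite ger0_norm ?ler_wpM2r// mulr_ge0// (le_trans e0).
have eI (c : R) : \int[mu]_t (c * gam t) = c.
  by rewrite (RintegralZl _ measurableT gi) Rintegral_gamma mulr1.
split=> //; apply/andP; split; [rewrite -[leLHS]eI|rewrite -[leRHS]eI].
  by apply: (le_Rintegral measurableT (cgi e) fi) => t _; apply: ler_wpM2r => //; have /andP[] := feM t.
by apply: (le_Rintegral measurableT fi (cgi M)) => t _; apply: ler_wpM2r => //; have /andP[] := feM t.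
Qed.

Lemma gamma_shift (t : R) (C : nat) : 0 <= t ->
  gam (t + C%:R) <= gam t * expR (- (C%:R / 2)).
Proof.
move=> t0; rewrite !gammaE -[leRHS]mulrA; apply: ler_wpM2l; first exact: powR_ge0.
rewrite -expRD ler_expR.
have C2 : C%:R <= C%:R ^+ 2 :> R.
  by rewrite expr2 -natrM ler_nat; case: C => // C; rewrite leq_pmulr.
have C0 : 0 <= C%:R :> R by [].
have tC : 0 <= t * C%:R by rewrite mulr_ge0.
rewrite sqrrD -mulr_natl; lra.
Qed.

Lemma gammaN (t : R) : gam (- t) = gam t.
Proof. by rewrite !gammaE sqrrN. Qed.

Local Notation Phi := (cdf1 gam).

(** The monotone map pushing f to the Gaussian. Comparing the tails of f with those of a shifted Gaussian shows that it grows at most linearly. *)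
Lemma gaussian_transport (f : R -> R) (e : R) : continuous f ->
  mu.-integrable setT (fun x => (f x)%:E) -> \int[mu]_x f x = 1 ->
  0 < e -> (forall t, e * gam t <= f t) ->
  exists T : R -> R, exists C : R,
    (forall t : R, is_derive t (1 : R) T (f t / gam (T t))) /\
    (forall t, `|T t| <= `|t| + C).
Proof.
move=> cf fi intf e0 ef.
have f0 x : 0 < f x by apply: lt_le_trans (ef x); rewrite mulr_gt0// gamma_gt0.
have g0 : forall x, 0 < gam x := @gamma_gt0 R.
have cg := continuous_gamma; have gi := integrable_gamma; have ig := Rintegral_gamma.
have dP := is_derive_cdf1 cg gi.
have Pinj := cdf1_inj cg gi g0.
pose Psi s := xget 0 [set y | Phi y = s].
have PhiK : cancel Phi Psi.
  move=> y; rewrite /Psi; case: xgetP => [z _ /= /Pinj//|/(_ y) h].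
  by exfalso; exact: h.
have dPsi y : is_derive (Phi y) (1 : R) Psi (gam y)^-1.
  apply: (@is_derive_inverse R Phi Psi (gam y) y _ _ (dP y)).
  - by near=> z; exact: PhiK.
  - by near=> z; apply: continuous_cdf1.
  - by rewrite gt_eqF.
pose T t := Psi (cdf1 f t).
have PT t : Phi (T t) = cdf1 f t.
  have [|y yE] := cdf1_surj cg gi g0 ig (s := cdf1 f t).
    by rewrite (cdf1_gt0 cf fi f0) (cdf1_lt1 cf fi f0 intf).
  by rewrite /T -yE PhiK.
(* the shift C makes the Gaussian tails smaller than those of f *)
have [C Ce] : exists C : nat, expR (- (C%:R / 2)) <= e.
  exists (Num.truncn (2 * `|ln e|)).+1; rewrite -[leRHS](@lnK R e)// ler_expR lerNl.
  apply: (le_trans (ler_norm _)); rewrite normrN ler_pdivlMr// mulrC.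
  exact/ltW/truncnS_gt.
have dPs (c s : R) : is_derive s (1 : R) (fun s => Phi (s + c)) (gam (s + c)).
  have ds : is_derive s (1 : R) (fun s : R => s + c) 1.
    by apply: trigger_derive; rewrite addr0.
  by have := @is_derive1_comp _ Phi (fun s : R => s + c) s _ _ (dP (s + c)) ds; rewrite mulr1.
have upper t : 0 <= t -> T t <= t + C%:R.
  move=> t0; apply: (cdf1_reflect cg gi g0); rewrite PT -subr_ge0.
  pose Q t := Phi (t + C%:R) - cdf1 f t.
  have dQ (s : R) : is_derive s (1 : R) Q (gam (s + C%:R) - f s).
    exact: is_deriveB (dPs C%:R s) (is_derive_cdf1 cf fi s).
  have Qn s : t <= s -> Q s <= Q t.
    move=> ts; apply: (@ler0_derive1_nincry R Q 0) => //.
    - move=> x; rewrite in_itv/= andbT => x0; rewrite derive1E (derive_val (is_derive := dQ x)).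
      rewrite subr_le0 (le_trans (gamma_shift _ (ltW x0)))// (le_trans _ (ef x))//.
      by rewrite mulrC ler_wpM2r// ltW.
    - apply: continuous_subspaceT => x; apply: differentiable_continuous.
      by apply/derivable1_diffP; have [h _] := dQ x; exact: h.
  have cQ : Q n%:R @[n --> \oo] --> (1 - 1 : R).
    apply: cvgB; first by under eq_fun do rewrite -natrD; exact: cvg_cdf1_pinfty.
    by have := cvg_cdf1_pinfty fi f0 intf 0; under eq_fun do rewrite addn0.
  rewrite -/(Q t) -(subrr 1) -(cvg_lim (@Rhausdorff R) cQ); apply: limr_le.
    by apply/cvg_ex; eexists; exact: cQ.
  near=> n; apply: Qn; apply: le_trans (ler_norm _) _.
  by near: n; exact: nbhs_infty_ger.
have lower t : t <= 0 -> t - C%:R <= T t.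
  move=> t0; apply: (cdf1_reflect cg gi g0); rewrite PT -subr_ge0.
  pose Q t := cdf1 f t - Phi (t - C%:R).
  have dQ (s : R) : is_derive s (1 : R) Q (f s - gam (s - C%:R)).
    exact: is_deriveB (is_derive_cdf1 cf fi s) (dPs (- C%:R) s).
  have Qn s : s <= t -> Q s <= Q t.
    move=> ts; apply: (@ger0_derive1_ndecrNy R Q 0) => //.
    - move=> x; rewrite in_itv/= => x0; rewrite derive1E (derive_val (is_derive := dQ x)).
      rewrite subr_ge0 -(gammaN (x - _)) opprB addrC.
      rewrite (le_trans (gamma_shift _ _)) ?oppr_ge0 ?(ltW x0)// gammaN (le_trans _ (ef x))//.
      by rewrite mulrC ler_wpM2r// ltW.
    - apply: continuous_subspaceT => x; apply: differentiable_continuous.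
      by apply/derivable1_diffP; have [h _] := dQ x; exact: h.
  have cQ : Q (- n%:R) @[n --> \oo] --> (0 - 0 : R).
    apply: cvgB; last first.
      by under eq_fun do rewrite -opprD -natrD; exact: cvg_cdf1_ninfty.
    by have := cvg_cdf1_ninfty fi f0 0; under eq_fun do rewrite addn0.
  rewrite -/(Q t) -(subrr 0) -(cvg_lim (@Rhausdorff R) cQ); apply: limr_le.
    by apply/cvg_ex; eexists; exact: cQ.
  near=> n; apply: Qn; rewrite lerNl; apply: le_trans (ler_norm _) _.
  by near: n; exact: nbhs_infty_ger.
have Tmono s t : s <= t -> T s <= T t.
  move=> st; apply: (cdf1_reflect cg gi g0); rewrite !PT.
  exact: cdf1_ndecr.
exists T, C%:R; split=> [t|t].
  have dT := dPsi (T t); rewrite PT in dT.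
  have := @is_derive1_comp _ Psi (cdf1 f) t _ _ dT (is_derive_cdf1 cf fi t).
  by rewrite mulrC.
rewrite ler_norml; have [t0|/ltW t0] := leP 0 t.
- rewrite ger0_norm// upper// andbT (le_trans _ (Tmono _ _ t0))//.
  by rewrite (le_trans _ (lower 0 _))// sub0r lerN2 lerDr.
- rewrite ler0_norm// opprD opprK lower//= (le_trans (Tmono _ _ t0))//.
  by rewrite (le_trans (upper 0 _))// lerD2r oppr_ge0.
Unshelve. all: by end_near. Qed.

End distribution_functions.

(** * The one-dimensional inequality for continuous densities *)

Section primitive_sqr.
Context (R : realType).
Local Notation mu := (@lebesgue_measure R).

Lemma Rintegral_derive (F f : R -> R) (a x : R) : a <= x ->
  (forall t : R, is_derive t (1 : R) F (f t)) -> continuous f ->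
  F x = F a + \int[mu]_(t in `[a, x]) f t.
Proof.
rewrite le_eqVlt => /predU1P[<- _ _|ax dF cf].
  by rewrite set_itv1 Rintegral_set1 addr0.
have cF : continuous F.
  move=> t; apply: differentiable_continuous; apply/derivable1_diffP.
  by have [h _] := dF t; exact: h.
rewrite /Rintegral (@continuous_FTC2 R f F a x ax)//.
- by rewrite -EFinB /= subrKC.
- exact: continuous_subspaceT.
- split; [by move=> t _; have [h _] := dF t; exact: h| |].
  + by apply: cvg_at_right_filter; exact: cF.
  + by apply: cvg_at_left_filter; exact: cF.
- by move=> t _; rewrite derive1E; apply: derive_val; exact: dF.
Qed.

(** The weak form of (V^2)' = 2 g V, for V only absolutely continuous: both V and Psi are primitives, to which the product formula applies twice. *)
Lemma primitive_sqr_test (g Psi psi : R -> R) (a b c : R) : a <= b ->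
  mu.-integrable `[a, b] (fun t => (g t)%:E) ->
  (forall t : R, is_derive t (1 : R) Psi (psi t)) -> continuous psi ->
  Psi a = 0 -> Psi b = 0 ->
  let V x := c + \int[mu]_(t in `[a, x]) g t in
  \int[mu]_(t in `[a, b]) (2 * (g t * V t) * Psi t + psi t * V t ^+ 2) = 0.
Proof.
move=> ab gi dPsi cpsi Pa Pb V.
have cV : {within `[a, b], continuous V} by exact: continuous_primitive.
have gV : mu.-integrable `[a, b] (fun t => (g t * V t)%:E) by exact: integrable_mul_continuous.
have mab : measurable (`[a, b] : set (measurableTypeR R)) by exact: measurable_itvR.
have hi : mu.-integrable `[a, b] (fun t => (2 * (g t * V t))%:E) by exact: integrable_Zl.
have sqrV x : x \in `[a, b] -> V x ^+ 2 = c ^+ 2 + \int[mu]_(t in `[a, x]) (2 * (g t * V t)).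
  rewrite in_itv/= => /andP[ax xb].
  have sub : `[a, x]%classic `<=` `[a, b]%classic.
    by move=> t /=; rewrite !in_itv/= => /andP[-> /le_trans]; apply.
  have gix : mu.-integrable `[a, x] (fun t => (g t)%:E) by exact: integrableS gi.
  have gVx : mu.-integrable `[a, x] (fun t => (g t * V t)%:E) by exact: integrableS gV.
  have E : \int[mu]_(t in `[a, x]) (g t * V t) + \int[mu]_(t in `[a, x]) (g t * V t) =
      V x * V x - c * c := primitive_product c c ax gix gix.
  by rewrite RintegralZl// !expr2; lra.
have psii : mu.-integrable `[a, b] (fun t => (psi t)%:E) by exact: continuous_itv_integrable.
have PsiE x : x \in `[a, b] -> Psi x = 0 + \int[mu]_(t in `[a, x]) psi t.
  by rewrite in_itv/= => /andP[ax xb]; rewrite (Rintegral_derive ax dPsi cpsi) Pa.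
have cPsi : continuous Psi.
  move=> t; apply: differentiable_continuous; apply/derivable1_diffP.
  by have [h _] := dPsi t; exact: h.
have cV2 : {within `[a, b], continuous (fun t => V t ^+ 2)}.
  by move=> t; apply: cvgM; exact: cV.
have E := primitive_product (c ^+ 2) 0 ab hi psii.
rewrite RintegralD//; first last.
- exact: integrable_mul_continuous.
- by apply: integrable_mul_continuous => //; exact: continuous_subspaceT.
transitivity ((c ^+ 2 + \int[mu]_(t in `[a, b]) (2 * (g t * V t))) *
    (0 + \int[mu]_(t in `[a, b]) psi t) - c ^+ 2 * 0); last first.
  by rewrite -PsiE ?Pb ?mulr0 ?subr0// in_itv/= ab lexx.
rewrite -E; congr (_ + _); apply: eq_Rintegral => t; rewrite inE/= => tab.
- by rewrite -(PsiE t tab).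
- by rewrite -(sqrV t tab).
Qed.

End primitive_sqr.

Lemma is_derive_cutoff (R : realType) (k t : R) :
  is_derive t (1 : R) (fun t => 1 - k * (t * t)) (- (k * (t + t))).
Proof. by apply: trigger_derive; rewrite /GRing.scale/= !mulr1; ring. Qed.

Section gaussian_line.
Context (R : realType).
Local Notation mu := (@lebesgue_measure R).
Local Notation gam := (normal_pdf (0 : R) 1).

(** The part of the entropy bound that involves no derivative. Integrated against u^2 and summed over the coordinates, it only depends on the mass and the second moment of u^2. *)
Definition bterm (l t : R) : R := (1 - l ^+ 2) * t ^+ 2 / 2 + l ^+ 2 - 1 - ln l.

Lemma ln_transport (r t T T' : R) : 0 < T' -> r * gam t = gam T * T' ->
  ln r = (t ^+ 2 - T ^+ 2) / 2 + ln T'.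
Proof.
move=> T0 E.
have -> : r = expR ((t ^+ 2 - T ^+ 2) / 2) * T'.
  have gt := gamma_gt0 t; apply: (mulIf (lt0r_neq0 gt)); rewrite E !gammaE.
  have -> : expR (- (T ^+ 2 / 2)) = expR ((t ^+ 2 - T ^+ 2) / 2) * expR (- (t ^+ 2 / 2)).
    by rewrite -expRD; congr expR; lra.
  ring.
by rewrite lnM ?posrE ?expR_gt0// expRK.
Qed.

(** Here G is the Gaussian density at t, a and b are the values of a function and of its derivative, X and X' those of the cutoff. The difference of the two sides is a square in b - a W plus a multiple of l T' - 1 - ln (l T'), which is nonnegative. *)
Lemma entropy_pointwise (a b G X X' t T T' l r W W' : R) : 0 <= G -> 0 <= X -> 0 < l -> 0 < T' ->
  ln r = (t ^+ 2 - T ^+ 2) / 2 + ln T' ->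
  W = (t - l^-1 * T) / 2 -> W' = (1 - l^-1 * T') / 2 ->
  a ^+ 2 * G * (X * (ln r - bterm l t)) <=
  - (2 * l ^+ 2) * (2 * (b * a) * (W * G * X) + (W' * G * X - W * (t * G) * X + W * G * X') * a ^+ 2)
  + 2 * l ^+ 2 * (b ^+ 2 * G * X + a ^+ 2 * G * (W * X')).
Proof.
move=> G0 X0 l0 T0 -> WE W'E; rewrite -subr_ge0.
have lT : ln T' + ln l <= l * T' - 1.
  rewrite -lnM ?posrE// mulrC -[X in ln X](subrKC 1); apply: le_ln1Dx.
  by rewrite ltrBrDl subrr mulr_gt0.
have ll : l * l^-1 = 1 by rewrite divff// gt_eqF.
pose Y := l * T' - 1 - (ln T' + ln l).
have -> : - (2 * l ^+ 2) * (2 * (b * a) * (W * G * X) + (W' * G * X - W * (t * G) * X + W * G * X') * a ^+ 2)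
  + 2 * l ^+ 2 * (b ^+ 2 * G * X + a ^+ 2 * G * (W * X')) -
  a ^+ 2 * G * (X * ((t ^+ 2 - T ^+ 2) / 2 + ln T' - bterm l t)) =
  2 * l ^+ 2 * ((b - a * W) ^+ 2 * (G * X)) + a ^+ 2 * (G * X) * Y.
  rewrite /Y W'E WE /bterm; field.
  by rewrite gt_eqF.
have Y0 : 0 <= Y by rewrite /Y; lra.
have GX : 0 <= G * X by exact: mulr_ge0.
by apply: addr_ge0; apply: mulr_ge0 => //; apply: mulr_ge0; rewrite ?sqr_ge0.
Qed.

Lemma ln_bterm_bound (l M e : R) : 0 < e -> exists A, forall r t, e <= r <= M ->
  `|ln r - bterm l t| <= A * (1 + t ^+ 2).
Proof.
move=> e0; exists (`|ln e| + `|ln M| + `|l ^+ 2 - 1 - ln l| + `|1 - l ^+ 2|) => r t /andP[er rM].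
have r0 : 0 < r by exact: lt_le_trans er.
have M0 : 0 < M by exact: lt_le_trans rM.
have l1 : ln e <= ln r by rewrite ler_ln.
have l2 : ln r <= ln M by rewrite ler_ln.
have t20 := sqr_ge0 t; rewrite /bterm ler_norml; move: l1 l2.
set x := 1 - l ^+ 2; set y := ln e; set z := ln M; rewrite -!addrA.
have := ler_norm x; have := ler_norm (- x); have := ler_norm (- y); have := ler_norm z.
have := ler_norm (l ^+ 2 - 1 - ln l); have := ler_norm (- (l ^+ 2 - 1 - ln l)).
rewrite !normrN; have := normr_ge0 x; have := normr_ge0 y; have := normr_ge0 z.
set w := l ^+ 2 - 1 - ln l; have := normr_ge0 w.
have -> : l ^+ 2 + (-1 + - ln l) = w by rewrite /w; ring.
move=> w0 z0 y0 x0 w1 w2 z1 y1 x1 x2 l1 l2.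
have xt1 : x * t ^+ 2 <= `|x| * t ^+ 2 by rewrite ler_wpM2r.
have xt2 : - x * t ^+ 2 <= `|x| * t ^+ 2 by rewrite ler_wpM2r.
have p1 : 0 <= `|y| * t ^+ 2 by rewrite mulr_ge0.
have p2 : 0 <= `|z| * t ^+ 2 by rewrite mulr_ge0.
have p3 : 0 <= `|w| * t ^+ 2 by rewrite mulr_ge0.
by apply/andP; split; lra.
Qed.

(** Let T be the map that pushes r gam forward to gam. Then ln r is an explicit function of T and T', and with W = (t - T/l)/2 the pointwise bound on the entropy is a divergence, which integrates to zero, plus the Dirichlet form. The cutoff 1 - (t/N)^2 removes the boundary terms; the error it makes is O(1/N) because W grows at most linearly. *)
Lemma line_entropy_continuous (v g r : R -> R) (e M l : R) :
  measurable_fun (setT : set (measurableTypeR R)) v ->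
  measurable_fun (setT : set (measurableTypeR R)) g ->
  mu.-integrable setT (fun t => (v t ^+ 2 * gam t)%:E) ->
  mu.-integrable setT (fun t => (t ^+ 2 * (v t ^+ 2 * gam t))%:E) ->
  mu.-integrable setT (fun t => (g t ^+ 2 * gam t)%:E) ->
  (forall N : nat, mu.-integrable `[- N.+1%:R, N.+1%:R] (fun t => (g t)%:E) /\
     exists c, {ae mu, forall t, `[- N.+1%:R, N.+1%:R]%classic t ->
          v t = c + \int[mu]_(s in `[- N.+1%:R, t]) g s}) ->
  continuous r -> 0 < e -> (forall t, e <= r t <= M) ->
  \int[mu]_t (r t * gam t) = 1 -> 0 < l ->
  \int[mu]_t (v t ^+ 2 * gam t * (ln (r t) - bterm l t)) <=
  2 * l ^+ 2 * \int[mu]_t (g t ^+ 2 * gam t).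
Proof.
move=> mv mg vi ti gi prim cr e0 erM intr l0.
have r0 t : 0 < r t by apply: lt_le_trans e0 _; have /andP[] := erM t.
have cg := @continuous_gamma R.
have crg : continuous (fun t => r t * gam t) by move=> t; apply: cvgM; [exact: cr|exact: cg].
have [rgi _] := gamma_average_bounds (ltW e0) (continuous_measurable_fun cr) erM.
have [T [C [dT TC]]] := gaussian_transport crg rgi intr e0
  (fun t => ler_wpM2r (ltW (gamma_gt0 t)) (proj1 (andP (erM t)))).
pose T' t := r t * gam t / gam (T t).
have cT : continuous T.
  move=> t; apply: differentiable_continuous; apply/derivable1_diffP.
  by have [h _] := dT t; exact: h.
have cT' : continuous T'.
  move=> t; apply: cvgM; first exact: crg.
  apply: cvgV; first by rewrite gt_eqF// gamma_gt0.
  apply: continuous_comp; [exact: cT|exact: cg].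
have T'0 t : 0 < T' t by rewrite divr_gt0// ?mulr_gt0// ?gamma_gt0.
have lnr t : ln (r t) = (t ^+ 2 - T t ^+ 2) / 2 + ln (T' t).
  by apply: ln_transport => //; rewrite [RHS]mulrC divfK// gt_eqF// gamma_gt0.
pose W t := 2^-1 * (t - l^-1 * T t); pose W' t := 2^-1 * (1 - l^-1 * T' t).
have dW (t : R) : is_derive t (1 : R) W (W' t).
  have d1 : is_derive t (1 : R) (fun t => l^-1 * T t) (l^-1 * T' t) := is_deriveZ l^-1 (dT t).
  have d2 : is_derive t (1 : R) (fun t => t - l^-1 * T t) (1 - l^-1 * T' t).
    exact (is_deriveB (is_derive_id t 1) d1).
  exact (is_deriveZ 2^-1 d2).
have cW : continuous W.
  move=> t; apply: differentiable_continuous; apply/derivable1_diffP.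
  by have [h _] := dW t; exact: h.
have cW' : continuous W'.
  move=> t; apply: cvgM; first exact: cvg_cst.
  by apply: cvgB; [exact: cvg_cst|apply: cvgM; [exact: cvg_cst|exact: cT']].
have [K [K0 WK]] : exists K, 0 <= K /\ forall t, `|W t| <= K * (1 + `|t|).
  have k0 : 0 <= l^-1 by rewrite invr_ge0 ltW.
  exists (2^-1 * (1 + l^-1 * (1 + `|C|))); split.
    by rewrite mulr_ge0// addr_ge0// mulr_ge0// addr_ge0.
  move=> t; rewrite /W normrM ger0_norm// -mulrA ler_wpM2l//.
  apply: (le_trans (ler_normB _ _)); rewrite normrM (ger0_norm k0) mulrDl mul1r.
  have h : l^-1 * `|T t| <= l^-1 * ((1 + `|C|) * (1 + `|t|)).
    rewrite ler_wpM2l// (le_trans (TC t))//.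
    have := ler_norm C; have := mulr_ge0 (normr_ge0 C) (normr_ge0 t); lra.
  by rewrite -mulrA lerD// lerDr.
have [A EA] := ln_bterm_bound l M e0.
have E_bound t : `|ln (r t) - bterm l t| <= A * (1 + t ^+ 2) by exact: EA.
pose J := \int[mu]_t (v t ^+ 2 * gam t + t ^+ 2 * (v t ^+ 2 * gam t)).
have Ji : mu.-integrable setT (fun t => (v t ^+ 2 * gam t + t ^+ 2 * (v t ^+ 2 * gam t))%:E).
  exact: integrable_add.
have vg0 t : 0 <= v t ^+ 2 * gam t by rewrite mulr_ge0 ?sqr_ge0// ltW// gamma_gt0.
have gg0 t : 0 <= g t ^+ 2 * gam t by rewrite mulr_ge0 ?sqr_ge0// ltW// gamma_gt0.
pose E t := ln (r t) - bterm l t.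
have cE : continuous E.
  move=> t; apply: cvgB.
    apply: continuous_comp; [exact: cr|exact: continuous_ln].
  rewrite /bterm; apply: cvgB; last exact: cvg_cst.
  apply: cvgB; last exact: cvg_cst.
  apply: cvgD; last exact: cvg_cst.
  apply: cvgM; last exact: cvg_cst.
  apply: cvgM; first exact: cvg_cst.
  exact: exprn_continuous.
have mgam : measurable_fun (setT : set (measurableTypeR R)) gam by exact: measurable_normal_pdf.
have vgi : mu.-integrable setT (fun t => (g t * v t * gam t)%:E).
  apply: (integrable_le measurableT _ _ (integrable_add measurableT gi vi)).
    by apply: measurable_funM => //; exact: measurable_funM.
  move=> t _; rewrite normrM (ger0_norm (ltW (gamma_gt0 t))) -mulrDl ler_wpM2r ?(ltW (gamma_gt0 t))//.
  have := sqr_ge0 (g t - v t); have := sqr_ge0 (g t + v t).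
  by rewrite ler_norml => h1 h2; apply/andP; split; nra.
have mulcont (F h : R -> R) (n : R) : mu.-integrable setT (fun t => (F t)%:E) -> continuous h ->
    mu.-integrable `[- n, n] (fun t => (F t * h t)%:E).
  move=> Fi ch; apply: integrable_mul_continuous; first exact: integrableS Fi.
  exact: continuous_subspaceT.
have le_itv (F : R -> R) (n : R) : mu.-integrable setT (fun t => (F t)%:E) -> (forall t, 0 <= F t) ->
    \int[mu]_(t in `[- n, n]) F t <= \int[mu]_t F t.
  move=> Fi F0; rewrite Rintegral_mkcond; apply: le_Rintegral => //.
    rewrite -restrict_EFin; apply: (integrable_mkcond _ _).1 => //; exact: integrableS Fi.
  by move=> t _; rewrite /patch; case: ifP.
pose chi (k t : R) := 1 - k * (t * t).
pose k (N : nat) : R := N.+1%:R^-1 * N.+1%:R^-1.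
have cchi q : continuous (chi q).
  move=> t; apply: cvgB; first exact: cvg_cst.
  apply: cvgM; first exact: cvg_cst.
  by apply: cvgM; exact: cvg_id.
have chi01 N t : `[- N.+1%:R, N.+1%:R]%classic t -> 0 <= chi (k N) t <= 1.
  rewrite /= in_itv/= -ler_norml => tN.
  have tt : t * t = `|t| * `|t| by rewrite -normrM ger0_norm// -expr2 sqr_ge0.
  have n1 : `|t| * N.+1%:R^-1 <= 1 by rewrite ler_pdivrMr// mul1r.
  have n0 : 0 <= `|t| * N.+1%:R^-1 by rewrite mulr_ge0// invr_ge0.
  have -> : chi (k N) t = 1 - (`|t| * N.+1%:R^-1) * (`|t| * N.+1%:R^-1).
    by rewrite /chi /k tt; ring.
  by rewrite subr_ge0 mulr_ile1//= gerBl mulr_ge0.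
(* the derivative of the cutoff is at most 2 / N.+1 on [- N.+1, N.+1], and |W| <= K (1 + |t|) *)
have step (N : nat) : \int[mu]_(t in `[- N.+1%:R, N.+1%:R])
    (v t ^+ 2 * gam t * (chi (k N) t * E t)) <=
    2 * l ^+ 2 * (\int[mu]_t (g t ^+ 2 * gam t) + 4 * K / N.+1%:R * J).
  set n : R := N.+1%:R.
  have n0 : 0 < n by [].
  have nn : - n <= n by lra.
  have kn : k N * (n * n) = 1 by rewrite /k -/n; field; rewrite gt_eqF.
  have [gN [c vV]] := prim N; rewrite -/n in gN vV.
  have mab : measurable (`[- n, n] : set (measurableTypeR R)) by exact: measurable_itvR.
  pose X' t : R := - (k N * (t + t)).
  pose Psi t := W t * gam t * chi (k N) t.
  pose psi t := W' t * gam t * chi (k N) t - W t * (t * gam t) * chi (k N) t + W t * gam t * X' t.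
  have cX' : continuous X'.
    move=> t; apply: cvgN; apply: cvgM; first exact: cvg_cst.
    by apply: cvgD; exact: cvg_id.
  have dX (t : R) : is_derive t (1 : R) (chi (k N)) (X' t).
    exact: is_derive_cutoff.
  have dPsi (t : R) : is_derive t (1 : R) Psi (psi t).
    have d1 : is_derive t (1 : R) (fun t => W t * gam t) (W t * (- t * gam t) + gam t * W' t).
      exact (is_deriveM (dW t) (is_derive_gamma t)).
    apply: (@is_derive_eq _ _ _ _ _ _ _ _ (is_deriveM d1 (dX t))).
    by rewrite /GRing.scale/= /psi; ring.
  have ctg : continuous (fun t : R => t * gam t) by move=> t; apply: cvgM; [exact: cvg_id|exact: cg].
  have cpsi : continuous psi.
    move=> t; apply: cvgD; last by apply: cvgM; [apply: cvgM; [exact: cW|exact: cg]|exact: cX'].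
    apply: cvgB; apply: cvgM; try exact: cchi; apply: cvgM;
      [exact: cW'|exact: cg|exact: cW|exact: ctg].
  have Psi1 : Psi n = 0 by rewrite /Psi /chi kn subrr mulr0.
  have Psi2 : Psi (- n) = 0 by rewrite /Psi /chi mulrNN kn subrr mulr0.
  pose V (x : R) := c + \int[mu]_(s in `[- n, x]) g s.
  have Z : \int[mu]_(t in `[- n, n]) (2 * (g t * V t) * Psi t + psi t * V t ^+ 2) = 0.
    exact: (primitive_sqr_test c nn gN dPsi cpsi Psi2 Psi1).
  have cV : {within `[- n, n], continuous V} by exact: continuous_primitive.
  have mV : measurable_fun (`[- n, n] : set (measurableTypeR R)) V.
    exact: subspace_continuous_measurable_fun.
  pose Q t := g t * v t * gam t * (2 * W t * chi (k N) t) +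
    v t ^+ 2 * gam t * (W' t * chi (k N) t - t * W t * chi (k N) t + W t * X' t).
  pose P1 t := g t ^+ 2 * gam t * chi (k N) t.
  pose P2 t := v t ^+ 2 * gam t * (W t * X' t).
  have Qi : mu.-integrable `[- n, n] (fun t => (Q t)%:E).
    apply: (integrable_add mab).
      apply: mulcont => // t; apply: cvgM; last exact: cchi.
      by apply: cvgM; [exact: cvg_cst|exact: cW].
    apply: mulcont => // t; apply: cvgD; last by apply: cvgM; [exact: cW|exact: cX'].
    apply: cvgB; apply: cvgM; try exact: cchi; first exact: cW'.
    by apply: cvgM; [exact: cvg_id|exact: cW].
  have P1i : mu.-integrable `[- n, n] (fun t => (P1 t)%:E) by exact: mulcont.
  have P2i : mu.-integrable `[- n, n] (fun t => (P2 t)%:E).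
    by apply: mulcont => // t; apply: cvgM; [exact: cW|exact: cX'].
  have cPsi : continuous Psi.
    move=> t; apply: differentiable_continuous; apply/derivable1_diffP.
    by have [h _] := dPsi t; exact: h.
  have Q0 : \int[mu]_(t in `[- n, n]) Q t = 0.
    rewrite -[RHS]Z; apply: ae_eq_Rintegral => //.
    - exact: integrable_meas Qi.
    - have mg' : measurable_fun (`[- n, n] : set (measurableTypeR R)) g by exact: measurable_funTS.
      apply: measurable_funD; apply: measurable_funM => //.
      + by apply: measurable_funM => //; exact: measurable_funM.
      + by apply: measurable_funTS; exact: continuous_measurable_fun.
      + by apply: measurable_funTS; exact: continuous_measurable_fun.
      + exact: measurable_funX.
    - have ? : Filter (nbhs (almost_everywhere mu)) by exact: ae_filter_ringOfSetsType.
      by apply: filterS vV => t h /h vt; rewrite /Q vt /V /Psi /psi; ring.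
  have P1le : \int[mu]_(t in `[- n, n]) P1 t <= \int[mu]_t (g t ^+ 2 * gam t).
    apply: le_trans (le_itv _ n gi gg0); apply: le_Rintegral => //.
      exact: integrableS gi.
    by move=> t /chi01 /andP[_ c1]; rewrite /P1 ler_piMr.
  have P2le : \int[mu]_(t in `[- n, n]) P2 t <= 4 * K / n * J.
    have A0 : 0 <= 4 * K / n by rewrite divr_ge0 ?mulr_ge0// ltW.
    have h0 t : 0 <= v t ^+ 2 * gam t + t ^+ 2 * (v t ^+ 2 * gam t).
      by rewrite addr_ge0// mulr_ge0// sqr_ge0.
    have Jin : mu.-integrable `[- n, n] (fun t => (v t ^+ 2 * gam t + t ^+ 2 * (v t ^+ 2 * gam t))%:E).
      exact: integrableS Ji.
    apply: (le_trans _ (ler_wpM2l A0 (le_itv _ n Ji h0))).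
    rewrite -RintegralZl//; apply: le_Rintegral => //; first exact: integrable_Zl.
    move=> t; rewrite /= in_itv/= -ler_norml => tn.
    rewrite /P2 [leRHS](_ : _ = v t ^+ 2 * gam t * (4 * K / n * (1 + t ^+ 2))); last by ring.
    rewrite ler_wpM2l// (le_trans (ler_norm _))// normrM.
    apply: (le_trans (ler_pM _ _ (WK t) (lexx _))) => //.
    have kN0 : 0 <= k N by rewrite /k mulr_ge0// invr_ge0.
    rewrite /X' normrN normrM -mulr2n normrMn (ger0_norm kN0) /k -/n.
    rewrite [leLHS](_ : _ = 2 * K / n * ((1 + `|t|) * (`|t| / n))); last first.
      by rewrite ?mulr2n; ring.
    have -> : 4 * K / n * (1 + t ^+ 2) = 2 * K / n * (2 * (1 + t ^+ 2)) by ring.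
    apply: ler_wpM2l; first by rewrite divr_ge0 ?mulr_ge0// ltW.
    have tn1 : `|t| / n <= 1 by rewrite ler_pdivrMr// mul1r.
    have tn0 : 0 <= `|t| / n by rewrite divr_ge0// ltW.
    apply: (@le_trans _ _ (1 + `|t|)); first by rewrite ler_piMr// addr_ge0.
    rewrite -(real_normK (num_real t)); have := sqr_ge0 (`|t| - 1); have := sqr_ge0 `|t|.
    by rewrite !expr2; lra.
  apply: (le_trans (le_Rintegral (mu := mu) mab (f2 := fun t => - (2 * l ^+ 2) * Q t + 2 * l ^+ 2 * (P1 t + P2 t)) _ _ _)).
  - by apply: mulcont => // t; apply: cvgM; [exact: cchi|exact: cE].
  - by apply: integrable_add => //; apply: integrable_Zl => //; exact: integrable_add.
  - move=> t tn; have /andP[c0 _] := chi01 N t tn.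
    apply: (le_trans (entropy_pointwise (v t) (g t) (X' t) (ltW (gamma_gt0 t)) c0 l0 (T'0 t) (lnr t) (W := W t) (W' := W' t) _ _)); rewrite /W /W' ?(mulrC 2^-1)//.
    by rewrite le_eqVlt; apply/orP; left; apply/eqP; rewrite /Q /P1 /P2 /W /W'; ring.
  have P12i := integrable_add mab P1i P2i.
  have eq : \int[mu]_(t in `[- n, n]) (- (2 * l ^+ 2) * Q t + 2 * l ^+ 2 * (P1 t + P2 t)) =
      - (2 * l ^+ 2) * \int[mu]_(t in `[- n, n]) Q t +
      2 * l ^+ 2 * (\int[mu]_(t in `[- n, n]) P1 t + \int[mu]_(t in `[- n, n]) P2 t).
    have h1 := integrable_Zl mab (- (2 * l ^+ 2)) Qi.
    have h2 := integrable_Zl mab (2 * l ^+ 2) P12i.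
    by rewrite (RintegralD mab h1 h2) (RintegralZl _ mab Qi) (RintegralZl _ mab P12i) (RintegralD mab P1i P2i).
  rewrite eq Q0 mulr0 add0r ler_pM2l ?mulr_gt0 ?exprn_gt0//.
  exact: lerD.
have lim : \int[mu]_(t in `[- N.+1%:R, N.+1%:R]) (v t ^+ 2 * gam t * (chi (k N) t * E t))
    @[N --> \oo] --> \int[mu]_t (v t ^+ 2 * gam t * E t).
  pose F (N : nat) (t : R) := v t ^+ 2 * gam t * (chi (k N) t * E t).
  have mF N : measurable_fun (setT : set (measurableTypeR R)) (F N).
    apply: measurable_funM; first exact: integrable_meas vi.
    by apply: continuous_measurable_fun => t; apply: cvgM; [exact: cchi|exact: cE].
  pose FI N := F N \_ `[- N.+1%:R, N.+1%:R].
  have mFI N : measurable_fun (setT : set (measurableTypeR R)) (FI N).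
    apply/(measurable_restrictT _ _).1; first exact: measurable_itvR.
    exact: measurable_funTS.
  have cv (t : R) : setT t -> FI N t @[N --> \oo] --> v t ^+ 2 * gam t * E t.
    move=> _; have cF : F N t @[N --> \oo] --> v t ^+ 2 * gam t * E t.
      have -> : v t ^+ 2 * gam t * E t = v t ^+ 2 * gam t * ((1 - 0 * 0 * (t * t)) * E t) by ring.
      apply: cvgM; first exact: cvg_cst.
      apply: cvgM; last exact: cvg_cst.
      apply: cvgB; first exact: cvg_cst.
      apply: cvgM; last exact: cvg_cst.
      by apply: cvgM; exact: cvg_harmonic.
    apply: cvg_trans cF; apply: near_eq_cvg; near=> N.
    rewrite /FI patchE mem_set//= in_itv/= -ler_norml (@le_trans _ _ N%:R) ?ler_nat//.
    by near: N; exact: nbhs_infty_ger.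
  have bd N t : setT t -> `|FI N t| <= A * (v t ^+ 2 * gam t + t ^+ 2 * (v t ^+ 2 * gam t)).
    move=> _; have A0 : 0 <= A * (1 + t ^+ 2) by apply: le_trans (E_bound t).
    rewrite [leRHS](_ : _ = v t ^+ 2 * gam t * (A * (1 + t ^+ 2))); last by ring.
    rewrite /FI patchE; case: ifPn => [/set_mem tN|_]; last by rewrite normr0 mulr_ge0.
    rewrite normrM (ger0_norm (vg0 t)) ler_wpM2l// normrM.
    have /andP[c0 c1] := chi01 N t tN.
    rewrite (ger0_norm c0); apply: le_trans (E_bound t).
    by rewrite ler_piMl.
  have [_] := Rintegral_cvg_everywhere measurableT mFI cv (integrable_Zl measurableT A Ji) bd.
  move=> cvI; apply: cvg_trans cvI; apply: near_eq_cvg; near=> N.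
  by rewrite [RHS]Rintegral_mkcond.
have lim2 : 2 * l ^+ 2 * (\int[mu]_t (g t ^+ 2 * gam t) + 4 * K / N.+1%:R * J)
    @[N --> \oo] --> 2 * l ^+ 2 * \int[mu]_t (g t ^+ 2 * gam t).
  apply: cvgM; first exact: cvg_cst.
  rewrite -[X in _ --> X]addr0; apply: cvgD; first exact: cvg_cst.
  rewrite -[X in _ --> X](mul0r J); apply: cvgM; last exact: cvg_cst.
  rewrite -[X in _ --> X](mulr0 (4 * K)); apply: cvgM; first exact: cvg_cst.
  exact: cvg_harmonic.
apply: (ler_cvg_to lim lim2); exact: nearW.
Unshelve. all: by end_near. Qed.

End gaussian_line.

(** * The one-dimensional inequality for measurable densities *)

Section gaussian_line_measurable.
Context (R : realType).
Local Notation mu := (@lebesgue_measure R).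
Local Notation gam := (normal_pdf (0 : R) 1).

Lemma continuous_cdf1_integrable (f : R -> R) :
  mu.-integrable setT (fun x => (f x)%:E) -> continuous (cdf1 f).
Proof.
move=> fi x.
have iS (D : set (measurableTypeR R)) : measurable D -> mu.-integrable D (EFin \o f).
  by move=> mD; exact: integrableS fi.
have ab : x - 1 < x + 1 by lra.
have FE y : x - 1 <= y -> cdf1 f y = cdf1 f (x - 1) + \int[mu]_(t in `[(x - 1), y]) f t.
  move=> ay; rewrite -Rintegral_itv_obnd_cbnd; last exact: (iS _ (measurable_itvR _)).
  rewrite -(@Rintegral_itvB R f -oo%O (BRight y) (x - 1) (iS _ (measurable_itvR _)))//.
  by rewrite subrKC.
apply: (within_continuous_continuous ab); last by rewrite in_itv/=; apply/andP; split; lra.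
apply: (@subspace_eq_continuous _ _ _ (fun y => cdf1 f (x - 1) + \int[mu]_(t in `[(x - 1), y]) f t) (cdf1 f)).
  by move=> y; rewrite inE/= in_itv/= => /andP[ay _]; rewrite (FE y ay).
apply: continuous_primitive; first exact: ltW.
exact: (iS _ (measurable_itvR _)).
Qed.

Lemma cdf1_quotient_cvg (f : R -> R) : mu.-integrable setT (fun x => (f x)%:E) ->
  {ae mu, forall x, n.+1%:R * (cdf1 f (x + n.+1%:R^-1) - cdf1 f x) @[n --> \oo] --> f x}.
Proof.
move=> fi.
have locf : locally_integrable setT f by apply: open_integrable_locally => //; exact: openT.
have iS y : mu.-integrable `]-oo, y] (EFin \o f).
  by apply: integrableS fi => //; exact: measurable_itvR.
have ? : Filter (nbhs (almost_everywhere mu)) by exact: ae_filter_ringOfSetsType.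
apply: filterS (FTC1Ny iS locf) => x [dF F'].
have cv : h^-1 *: (cdf1 f (h *: 1 + x) - cdf1 f x) @[h --> 0%R^'] --> f x.
  have := dF; rewrite /derivable /=; set q := (X in cvg (X @ _)) => cq.
  have -> : f x = lim (q @ 0%R^') by rewrite -F' derive1E.
  exact cq.
have hn : (n.+1%:R^-1 : R) @[n --> \oo] --> (0 : R)^'.
  move=> A [e /= e0 eA]; have /cvgrPdist_lt /(_ e e0) := @cvg_harmonic R.
  apply: filterS => n /= h; apply: eA => /=; first by [].
  by rewrite gt_eqF.
have := cvg_comp _ _ hn cv; apply: cvg_trans; apply: near_eq_cvg; near=> n.
by rewrite /= /GRing.scale/= mulr1 invrK (addrC _ x).
Unshelve. all: by end_near. Qed.


(** The right-hand side does not see the density, so continuity can be dropped by approximation: by Lebesgue differentiation, the difference quotients of the distribution function, truncated to [e, M] and normalized, are continuous densities that converge to r almost everywhere. *)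
Lemma line_entropy (v g r : R -> R) (e M l : R) :
  measurable_fun (setT : set (measurableTypeR R)) v ->
  measurable_fun (setT : set (measurableTypeR R)) g ->
  mu.-integrable setT (fun t => (v t ^+ 2 * gam t)%:E) ->
  mu.-integrable setT (fun t => (t ^+ 2 * (v t ^+ 2 * gam t))%:E) ->
  mu.-integrable setT (fun t => (g t ^+ 2 * gam t)%:E) ->
  (forall N : nat, mu.-integrable `[- N.+1%:R, N.+1%:R] (fun t => (g t)%:E) /\
     exists c, {ae mu, forall t, `[- N.+1%:R, N.+1%:R]%classic t ->
          v t = c + \int[mu]_(s in `[- N.+1%:R, t]) g s}) ->
  measurable_fun (setT : set (measurableTypeR R)) r -> 0 < e -> (forall t, e <= r t <= M) ->
  \int[mu]_t (r t * gam t) = 1 -> 0 < l ->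
  \int[mu]_t (v t ^+ 2 * gam t * (ln (r t) - bterm l t)) <=
  2 * l ^+ 2 * \int[mu]_t (g t ^+ 2 * gam t).
Proof.
move=> mv mg vi ti gi prim mr e0 erM intr l0.
have cg := @continuous_gamma R.
have r0 t : 0 < r t by apply: lt_le_trans e0 _; have /andP[] := erM t.
have M0 : 0 < M by apply: lt_le_trans (r0 0) _; have /andP[] := erM 0.
have eM : e <= M by have /andP[] := erM 0; exact: le_trans.
have mgam : measurable_fun (setT : set (measurableTypeR R)) gam by exact: measurable_normal_pdf.
have Mgi := integrable_Zl measurableT M (@integrable_gamma R).
have [rgi _] := gamma_average_bounds (ltW e0) mr erM.
pose F := cdf1 (fun t => r t * gam t).
have cF : continuous F by exact: continuous_cdf1_integrable.
pose q (n : nat) t := n.+1%:R * (F (t + n.+1%:R^-1) - F t).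
have cq n : continuous (q n).
  move=> t; apply: cvgM; first exact: cvg_cst.
  apply: cvgB; last exact: cF.
  have cs : {for t, continuous (fun t : R => t + n.+1%:R^-1)}.
    by apply: cvgD; [exact: cvg_id|exact: cvg_cst].
  exact (continuous_comp cs (cF _)).
pose clip x := Num.min M (Num.max e x).
have cclip : continuous clip.
  move=> x; apply: continuous_min; first exact: cvg_cst.
  by apply: continuous_max; [exact: cvg_cst|exact: cvg_id].
have clipb x : e <= clip x <= M by rewrite /clip ge_min lexx le_min eM le_max lexx.
pose rk n t := clip (q n t / gam t).
have crk n : continuous (rk n).
  move=> t; have cqg : {for t, continuous (fun t => q n t / gam t)}.
    apply: cvgM; first exact: cq.
    by apply: cvgV; [rewrite gt_eqF// gamma_gt0|exact: cg].
  exact (continuous_comp cqg (cclip _)).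
have rkb n t : e <= rk n t <= M by exact: clipb.
have rkcv : {ae mu, forall t, rk n t @[n --> \oo] --> r t}.
  have ? : Filter (nbhs (almost_everywhere mu)) by exact: ae_filter_ringOfSetsType.
  apply: filterS (cdf1_quotient_cvg rgi) => t qt.
  have -> : r t = clip (r t * gam t / gam t).
    rewrite mulfK ?gt_eqF ?gamma_gt0// /clip.
    by have /andP[er rM] := erM t; rewrite (max_idPr er) (min_idPr rM).
  apply: continuous_cvg; first exact: cclip.
  by apply: cvgM; [exact: qt|exact: cvg_cst].
pose m n := \int[mu]_t (rk n t * gam t).
have mrk n : measurable_fun (setT : set (measurableTypeR R)) (rk n).
  exact: continuous_measurable_fun.
have rkgi n := (gamma_average_bounds (ltW e0) (mrk n) (rkb n)).1.
have mb n : e <= m n <= M := (gamma_average_bounds (ltW e0) (mrk n) (rkb n)).2.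
have rkgb n t : `|rk n t * gam t| <= M * gam t.
  have /andP[h1 h2] := rkb n t; have g0 := ltW (gamma_gt0 t).
  by rewrite ger0_norm ?ler_wpM2r// mulr_ge0// (le_trans (ltW e0)).
have mcv : m n @[n --> \oo] --> (1 : R).
  have cvg_rkg : {ae mu, forall t, setT t -> rk n t * gam t @[n --> \oo] --> r t * gam t}.
    have ? : Filter (nbhs (almost_everywhere mu)) by exact: ae_filter_ringOfSetsType.
    by apply: filterS rkcv => t h _; apply: cvgM; [exact: h|exact: cvg_cst].
  have mrkg n : measurable_fun (setT : set (measurableTypeR R)) (fun t => rk n t * gam t).
    exact: measurable_funM.
  have mrg : measurable_fun (setT : set (measurableTypeR R)) (fun t => r t * gam t).
    exact: measurable_funM.
  have [_] := Rintegral_cvg measurableT mrkg mrg cvg_rkg Mgi (fun n t _ => rkgb n t).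
  by rewrite intr.
have m0 n : 0 < m n by apply: lt_le_trans e0 _; have /andP[] := mb n.
have rkmb n t : e / M <= rk n t / m n <= M / e.
  have /andP[h1 h2] := rkb n t; have /andP[h3 h4] := mb n.
  have i1 : M^-1 <= (m n)^-1 by rewrite lef_pV2 ?posrE.
  have i2 : (m n)^-1 <= e^-1 by rewrite lef_pV2 ?posrE.
  have r1 : 0 <= rk n t by rewrite (le_trans (ltW e0)).
  by rewrite !ler_pM// ?invr_ge0 ltW.
have eM0 : 0 < e / M by exact: divr_gt0.
have [A EA] := ln_bterm_bound l (M / e) eM0.
have Ji : mu.-integrable setT (fun t => (v t ^+ 2 * gam t + t ^+ 2 * (v t ^+ 2 * gam t))%:E).
  exact: integrable_add.
have step k : \int[mu]_t (v t ^+ 2 * gam t * (ln (rk k t / m k) - bterm l t)) <=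
    2 * l ^+ 2 * \int[mu]_t (g t ^+ 2 * gam t).
  apply: (line_entropy_continuous mv mg vi ti gi prim _ eM0 (rkmb k) _ l0).
    by move=> t; apply: cvgM; [exact: crk|exact: cvg_cst].
  transitivity (\int[mu]_t ((m k)^-1 * (rk k t * gam t))).
    by apply: eq_Rintegral => t _; ring.
  by rewrite (RintegralZl _ measurableT (rkgi k)) mulVf// gt_eqF.
have mln (h : R -> R) : measurable_fun (setT : set (measurableTypeR R)) h ->
    measurable_fun (setT : set (measurableTypeR R)) (fun t => v t ^+ 2 * gam t * (ln (h t) - bterm l t)).
  move=> mh; apply: measurable_funM; first exact: integrable_meas vi.
  apply: measurable_funB; first exact: measurableT_comp.
  apply: continuous_measurable_fun => t.
  rewrite /bterm; do 2 (apply: cvgB; last exact: cvg_cst).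
  apply: cvgD; last exact: cvg_cst.
  apply: cvgM; last exact: cvg_cst.
  by apply: cvgM; [exact: cvg_cst|exact: exprn_continuous].
have lim : \int[mu]_t (v t ^+ 2 * gam t * (ln (rk n t / m n) - bterm l t)) @[n --> \oo] -->
    \int[mu]_t (v t ^+ 2 * gam t * (ln (r t) - bterm l t)).
  have cv : {ae mu, forall t, setT t -> v t ^+ 2 * gam t * (ln (rk n t / m n) - bterm l t) @[n --> \oo] -->
      v t ^+ 2 * gam t * (ln (r t) - bterm l t)}.
    have ? : Filter (nbhs (almost_everywhere mu)) by exact: ae_filter_ringOfSetsType.
    apply: filterS rkcv => t h _; apply: cvgM; first exact: cvg_cst.
    apply: cvgB; last exact: cvg_cst.
    have cr : rk n t / m n @[n --> \oo] --> r t / 1.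
      by apply: cvgM; [exact: h|apply: cvgV => //; exact: oner_neq0].
    rewrite divr1 in cr; exact: (continuous_cvg _ (continuous_ln (r0 t)) cr).
  have bd n t : setT t -> `|v t ^+ 2 * gam t * (ln (rk n t / m n) - bterm l t)| <=
      A * (v t ^+ 2 * gam t + t ^+ 2 * (v t ^+ 2 * gam t)).
    move=> _; rewrite [leRHS](_ : _ = v t ^+ 2 * gam t * (A * (1 + t ^+ 2))); last by ring.
    have vg0 : 0 <= v t ^+ 2 * gam t by rewrite mulr_ge0 ?sqr_ge0// ltW// gamma_gt0.
    by rewrite normrM (ger0_norm vg0) ler_wpM2l// EA.
  have mrkm n : measurable_fun (setT : set (measurableTypeR R)) (fun t => rk n t / m n).
    exact: measurable_funM.
  by have [] := Rintegral_cvg measurableT (fun n => mln _ (mrkm n)) (mln _ mr) cv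
    (integrable_Zl measurableT A Ji) bd.
apply: (ler_cvg_to lim (cvg_cst _)); exact: nearW.
Qed.

End gaussian_line_measurable.

(** * Averaging one Gaussian coordinate *)

Section gaussian_average.
Context (R : realType).
Local Notation mu := (@lebesgue_measure R).
Local Notation gam := (normal_pdf (0 : R) 1).

Section fubini.
Context (n : nat) (i : 'I_n.+1).
Local Notation leb := (lebesgue_rV R).
Local Notation gau := (gauss_measure R).

Lemma measurable_marginal (f : measurableTypeR R * 'rV[R]_n -> R) : measurable_fun setT f ->
  measurable_fun setT (fun x => \int[mu]_t f (t, x)).
Proof.
move=> mf; have mF : measurable_fun setT (EFin \o f) by exact/measurable_EFinP.
rewrite /Rintegral; apply: (measurableT_comp (f := fine)); first exact: fine_measurable.
under eq_fun do rewrite integralE.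
have mp := measurable_fun_fubini_tonelli_G (m1 := mu) _ (measurable_funepos mF) (fun p => funepos_ge0 _ p).
have mn := measurable_fun_fubini_tonelli_G (m1 := mu) _ (measurable_funeneg mF) (fun p => funeneg_ge0 _ p).
have := emeasurable_funB mp mn; congr (measurable_fun _ _); apply/funext => x; congr (_ - _)%E.
- by apply: eq_integral => t _; rewrite !unlock.
- by apply: eq_integral => t _; rewrite !unlock.
Qed.

Lemma gauss_ae_integrable_ins (f : 'rV[R]_n.+1 -> R) : measurable_fun setT f ->
  (gau n.+1).-integrable setT (fun x => (f x)%:E) ->
  {ae leb n, forall x, mu.-integrable setT (fun t => (f (ins i t x) * gam t)%:E)}.
Proof.
move=> mf /(integrable_gauss mf) /(ae_integrable_ins i).
have ? : Filter (nbhs (almost_everywhere (leb n))) by exact: ae_filter_ringOfSetsType.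
apply: filterS => x /= H.
have E : (fun t => (f (ins i t x) * gam t)%:E) =
    (fun t => ((gauss_density x)^-1 * (f (ins i t x) * gauss_density (ins i t x)))%:E).
  apply/funext => t; congr EFin; rewrite gauss_density_ins; field.
  by rewrite gt_eqF// gauss_density_gt0.
by rewrite E; exact: integrable_Zl.
Qed.

Lemma gauss_fubini_ins (f : 'rV[R]_n.+1 -> R) : measurable_fun setT f ->
  (gau n.+1).-integrable setT (fun x => (f x)%:E) ->
  (leb n).-integrable setT
    (fun x => ((\int[mu]_t (f (ins i t x) * gam t)) * gauss_density x)%:E) /\
  \int[gau n.+1]_x f x =
  \int[leb n]_x ((\int[mu]_t (f (ins i t x) * gam t)) * gauss_density x).
Proof.
move=> mf fi; have fi' := (integrable_gauss mf).1 fi.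
have E x : mu.-integrable setT (fun t => (f (ins i t x) * gam t)%:E) ->
    \int[mu]_t (f (ins i t x) * gauss_density (ins i t x)) =
    (\int[mu]_t (f (ins i t x) * gam t)) * gauss_density x.
  move=> fx; rewrite mulrC -(RintegralZl _ measurableT fx).
  by apply: eq_Rintegral => t _; rewrite gauss_density_ins; ring.
have H := gauss_ae_integrable_ins mf fi.
have Ei := Rintegrable_ins i fi'.
have mE : measurable_fun setT (fun x : 'rV[R]_n => (\int[mu]_t (f (ins i t x) * gam t)) * gauss_density x).
  apply: measurable_funM; last exact: measurable_gauss_density.
  apply: (measurable_marginal (f := fun p => f (ins i p.1 p.2) * gam p.1)).
  apply: measurable_funM; first exact: (measurableT_comp mf (measurable_ins i)).
  apply: (measurableT_comp (f := gam)); last exact: measurable_fst.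
  exact: measurable_normal_pdf.
have ? : Filter (nbhs (almost_everywhere (leb n))) by exact: ae_filter_ringOfSetsType.
have ae_E : {ae leb n, forall x, \int[mu]_t (f (ins i t x) * gauss_density (ins i t x)) =
    (\int[mu]_t (f (ins i t x) * gam t)) * gauss_density x}.
  by apply: filterS H => x; exact: E.
have mL := integrable_meas Ei.
split.
  apply: (eq_integrable_ae mL mE ae_E Ei).
rewrite (Rintegral_gauss fi) (Rfubini_ins i fi'); apply: ae_eq_Rintegral => //.
by apply: filterS ae_E => x ex _.
Qed.
End fubini.
End gaussian_average.

Section averaging.
Context (R : realType) (n : nat).
Local Notation mu := (@lebesgue_measure R).
Local Notation gam := (normal_pdf (0 : R) 1).
Local Notation leb := (lebesgue_rV R).
Local Notation gau := (gauss_measure R n.+1).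
Implicit Types (rho : 'rV[R]_n.+1 -> R) (i : 'I_n.+1).

Definition avg i rho (x : 'rV[R]_n.+1) : R := \int[mu]_t (rho (ins i t (del i x)) * gam t).

Definition pinched (e M : R) rho := measurable_fun setT rho /\ forall x, e <= rho x <= M.

Lemma avg_ins i rho t x : avg i rho (ins i t x) = \int[mu]_s (rho (ins i s x) * gam s).
Proof. by rewrite /avg insK. Qed.

Lemma pinched_line i e M rho x : 0 <= e -> pinched e M rho ->
  mu.-integrable setT (fun t => (rho (ins i t x) * gam t)%:E) /\
  e <= \int[mu]_t (rho (ins i t x) * gam t) <= M.
Proof.
move=> e0 [mr rb]; apply: (gamma_average_bounds (f := fun t => rho (ins i t x))) => //.
exact: (measurableT_comp mr (measurable_insl i x)).
Qed.

Lemma avg_pinched i e M rho : 0 <= e -> pinched e M rho -> pinched e M (avg i rho).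
Proof.
move=> e0 rp; have [mr rb] := rp; split; last by move=> x; have [] := pinched_line i (del i x) e0 rp.
apply: (measurableT_comp (f := fun x => \int[mu]_t (rho (ins i t x) * gam t))); last exact: measurable_del.
apply: (measurable_marginal (f := fun p => rho (ins i p.1 p.2) * gam p.1)).
apply: measurable_funM; first exact: (measurableT_comp mr (measurable_ins i)).
apply: (measurableT_comp (f := gam)); last exact: measurable_fst.
exact: measurable_normal_pdf.
Qed.

Lemma pinched_integrable e M rho : 0 <= e -> pinched e M rho ->
  gau.-integrable setT (fun x => (rho x)%:E).
Proof.
move=> e0 [mr rb].
have ci : gau.-integrable setT (fun x => M%:E) by exact: finite_measure_integrable_cst.
apply: (integrable_le measurableT mr _ ci) => x _; have /andP[h1 h2] := rb x.
by rewrite ger0_norm// (le_trans e0).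
Qed.

Lemma Rintegral_avg i e M rho : 0 <= e -> pinched e M rho ->
  \int[gau]_x avg i rho x = \int[gau]_x rho x.
Proof.
move=> e0 rp; have rp' := avg_pinched i e0 rp.
have [_ ->] := gauss_fubini_ins i rp'.1 (pinched_integrable e0 rp').
have [_ ->] := gauss_fubini_ins i rp.1 (pinched_integrable e0 rp).
apply: eq_Rintegral => x _; congr (_ * _).
under eq_Rintegral do rewrite avg_ins.
by rewrite RintegralZl ?Rintegral_gamma ?mulr1//; exact: integrable_gamma.
Qed.

Definition insensitive (J : {set 'I_n.+1}) rho :=
  forall x y : 'rV[R]_n.+1, (forall k, k \notin J -> x 0 k = y 0 k) -> rho x = rho y.

Lemma avg_insensitive i J rho : insensitive J rho -> insensitive (i |: J) (avg i rho).
Proof.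
move=> rJ x y xy; apply: eq_Rintegral => t _; congr (_ * _); apply: rJ => k kJ.
have [k' kE|->] := unliftP i k; last by rewrite !ins_eq.
rewrite kE !ins_lift !mxE -kE; apply: xy.
by rewrite !inE negb_or kJ andbT kE eq_sym neq_lift.
Qed.

(** On a line parallel to the i-th axis, rho divided by its average is a probability density with respect to the Gaussian, so that the one-dimensional inequality applies; Fubini's theorem then integrates it over the lines. *)
Lemma entropy_line_step (u : 'rV[R]_n.+1 -> R) (G : 'rV[R]_n.+1 -> 'rV[R]_n.+1)
    (i : 'I_n.+1) (e M l : R) rho :
  measurable_fun setT u -> measurable_fun setT (fun x => G x 0 i) ->
  is_weak_gradient u G ->
  gau.-integrable setT (fun x => (u x ^+ 2)%:E) ->
  gau.-integrable setT (fun x => (x 0 i ^+ 2 * u x ^+ 2)%:E) ->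
  gau.-integrable setT (fun x => (G x 0 i ^+ 2)%:E) ->
  0 < e -> pinched e M rho -> 0 < l ->
  \int[gau]_x (u x ^+ 2 * ln (rho x)) <=
  \int[gau]_x (u x ^+ 2 * ln (avg i rho x)) +
  (2 * l ^+ 2 * \int[gau]_x (G x 0 i ^+ 2) + \int[gau]_x (u x ^+ 2 * bterm l (x 0 i))).
Proof.
move=> mu' mG wg ui xi Gi e0 rp l0.
have rp' := avg_pinched i (ltW e0) rp.
have lnb r : pinched e M r -> gau.-integrable setT (fun x => (u x ^+ 2 * ln (r x))%:E).
  move=> [mr rb]; apply: (integrable_bounded_mul (M := `|ln e| + `|ln M|) measurableT) => //.
    exact: measurableT_comp.
  move=> x _; have /andP[h1 h2] := rb x.
  have r0 : 0 < r x by exact: lt_le_trans h1.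
  have M0 : 0 < M by exact: lt_le_trans h2.
  have l1 : ln e <= ln (r x) by rewrite ler_ln ?posrE.
  have l2 : ln (r x) <= ln M by rewrite ler_ln ?posrE.
  have := ler_norm (ln M); have := ler_norm (- ln e); rewrite normrN.
  have := normr_ge0 (ln M); have := normr_ge0 (ln e); rewrite ler_norml; move=> *.
  by apply/andP; split; lra.
have bi : gau.-integrable setT (fun x => (u x ^+ 2 * bterm l (x 0 i))%:E).
  have -> : (fun x : 'rV[R]_n.+1 => (u x ^+ 2 * bterm l (x 0 i))%:E) =
      (fun x => ((1 - l ^+ 2) / 2 * (x 0 i ^+ 2 * u x ^+ 2) + (l ^+ 2 - 1 - ln l) * u x ^+ 2)%:E).
    by apply/funext => x; congr EFin; rewrite /bterm; ring.
  by apply: integrable_add => //; exact: integrable_Zl.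
have i1 := lnb _ rp; have i2 := lnb _ rp'.
pose h x := u x ^+ 2 * (ln (rho x) - ln (avg i rho x) - bterm l (x 0 i)).
have hE : h = (fun x => u x ^+ 2 * ln (rho x) - u x ^+ 2 * ln (avg i rho x) - u x ^+ 2 * bterm l (x 0 i)).
  by apply/funext => x; rewrite /h; ring.
have i12 := integrable_sub measurableT i1 i2.
have hi : gau.-integrable setT (fun x => (h x)%:E) by rewrite hE; exact: integrable_sub.
have mh : measurable_fun setT h by exact: integrable_meas hi.
suff : \int[gau]_x h x <= 2 * l ^+ 2 * \int[gau]_x (G x 0 i ^+ 2).
  rewrite hE (RintegralB measurableT i12 bi) (RintegralB measurableT i1 i2); lra.
have mG2 : measurable_fun setT (fun x => G x 0 i ^+ 2) by exact: measurable_funX.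
have mu2 : measurable_fun setT (fun x => u x ^+ 2) by exact: measurable_funX.
have mx2 : measurable_fun setT (fun x : 'rV[R]_n.+1 => x 0 i ^+ 2 * u x ^+ 2) by exact: integrable_meas xi.
have [Hi ->] := gauss_fubini_ins i mh hi.
have [Gi' ->] := gauss_fubini_ins i mG2 Gi.
rewrite -(RintegralZl _ measurableT Gi').
apply: le_Rintegral_ae => //; first exact: integrable_Zl.
have ? : Filter (nbhs (almost_everywhere (leb n))) by exact: ae_filter_ringOfSetsType.
have ae1 := gauss_ae_integrable_ins i mu2 ui.
have ae2 := gauss_ae_integrable_ins i mx2 xi.
have ae3 := gauss_ae_integrable_ins i mG2 Gi.
have ae4 := weak_gradient_lines i wg.
apply: filterS2 (filterI ae1 ae2) (filterI ae3 ae4) => x [/= a1 a2] [/= a3 a4].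
rewrite [leRHS]mulrA; apply: ler_wpM2r; first exact: gauss_density_ge0.
have [rgi rgb] := pinched_line i x (ltW e0) rp.
set m := \int[mu]_t (rho (ins i t x) * gam t) in rgb.
have /andP[em mM] := rgb.
have m0 : 0 < m by exact: lt_le_trans em.
have M0 : 0 < M by exact: lt_le_trans mM.
pose r t := m^-1 * rho (ins i t x).
have mrho : measurable_fun (setT : set (measurableTypeR R)) (fun t => rho (ins i t x)).
  exact: (measurableT_comp rp.1 (measurable_insl i x)).
have -> : \int[mu]_t (h (ins i t x) * gam t) =
    \int[mu]_t (u (ins i t x) ^+ 2 * gam t * (ln (r t) - bterm l t)).
  apply: eq_Rintegral => t _; rewrite /h avg_ins ins_eq -/m /r.
  have r0 : 0 < rho (ins i t x) by apply: lt_le_trans e0 _; have /andP[] := rp.2 (ins i t x).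
  by rewrite lnM ?posrE ?invr_gt0// lnV ?posrE//; ring.
apply: (line_entropy (v := fun t => u (ins i t x)) (g := fun t => G (ins i t x) 0 i)
  (e := e / M) (M := M / e)) => //.
- exact: (measurableT_comp mu' (measurable_insl i x)).
- exact: (measurableT_comp (f := fun x => G x 0 i) mG (measurable_insl i x)).
- have -> // : (fun t => (t ^+ 2 * (u (ins i t x) ^+ 2 * gam t))%:E) =
    (fun t => ((ins i t x) 0 i ^+ 2 * u (ins i t x) ^+ 2 * gam t)%:E).
  by apply/funext => t; rewrite ins_eq mulrA.
- by move=> N; have [_ h1 h2] := a4 N; split.
- exact: measurable_funM.
- exact: divr_gt0.
- move=> t; have /andP[h1 h2] := rp.2 (ins i t x).
  have i3 : M^-1 <= m^-1 by rewrite lef_pV2 ?posrE.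
  have i4 : m^-1 <= e^-1 by rewrite lef_pV2 ?posrE.
  have r1 : 0 <= rho (ins i t x) by rewrite (le_trans (ltW e0)).
  by rewrite /r [m^-1 * _]mulrC !ler_pM// ?invr_ge0 ltW.
- transitivity (\int[mu]_t (m^-1 * (rho (ins i t x) * gam t))).
    by apply: eq_Rintegral => t _; rewrite /r mulrA.
  by rewrite (RintegralZl _ measurableT rgi) mulVf// gt_eqF.
Qed.

End averaging.

(** * Entropy and successive averages *)

Section entropy_duality.
Context (R : realType) (n : nat).
Local Notation gau := (gauss_measure R n.+1).
Implicit Types (rho : 'rV[R]_n.+1 -> R) (i : 'I_n.+1) (s : seq 'I_n.+1).

Definition avgs s rho := foldl (fun r i => avg i r) rho s.

Lemma Rintegral_avgs s (e M : R) rho : 0 <= e -> pinched e M rho ->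
  \int[gau]_x avgs s rho x = \int[gau]_x rho x.
Proof.
move=> e0; elim: s rho => [//|i s IH] rho rp.
by rewrite [LHS](IH (avg i rho)); [exact: (Rintegral_avg i e0 rp)|exact: avg_pinched].
Qed.

Lemma avgs_insensitive s (J : {set 'I_n.+1}) rho : insensitive J rho ->
  insensitive ([set i in s] :|: J) (avgs s rho).
Proof.
elim: s J rho => [|i s IH] J rho rJ; first by have -> : [set j in [::]] :|: J = J by apply/setP => j; rewrite !inE.
have := IH _ _ (avg_insensitive (i := i) rJ); congr (insensitive _ _).
by apply/setP => j; rewrite !inE orbCA orbA.
Qed.

(** Averaging a coordinate makes a function independent of it and preserves both the mean and the independence of the other coordinates. *)
Lemma avgs_enum (e M : R) rho x : 0 <= e -> pinched e M rho ->
  avgs (enum 'I_n.+1) rho x = \int[gau]_y rho y.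
Proof.
move=> e0 rp; rewrite -(Rintegral_avgs (enum 'I_n.+1) e0 rp).
have r0 : insensitive finset.set0 rho.
  by move=> y z yz; congr rho; apply/rowP => k; apply: yz; rewrite inE.
have c y : avgs (enum 'I_n.+1) rho y = avgs (enum 'I_n.+1) rho x.
  by apply: (avgs_insensitive r0) => k; rewrite !inE mem_enum.
under eq_Rintegral do rewrite c.
rewrite Rintegral_cst// [fine _](_ : _ = 1) ?mulr1//; exact: (congr1 fine (gauss_measureT R n.+1)).
Qed.

Variables (u : 'rV[R]_n.+1 -> R) (e M : R) (B : 'I_n.+1 -> R).
Hypothesis e0 : 0 < e.
Hypothesis line : forall i rho, pinched e M rho ->
  \int[gau]_x (u x ^+ 2 * ln (rho x)) <= \int[gau]_x (u x ^+ 2 * ln (avg i rho x)) + B i.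

(** The logarithm of rho telescopes along the successive averages, and each step costs one coordinate of the Dirichlet form. *)
Lemma entropy_telescope s rho : pinched e M rho ->
  \int[gau]_x (u x ^+ 2 * ln (rho x)) <=
  \int[gau]_x (u x ^+ 2 * ln (avgs s rho x)) + \sum_(i <- s) B i.
Proof.
elim: s rho => [|i s IH] rho rp; first by rewrite big_nil addr0.
rewrite big_cons; apply: (le_trans (line i rp)).
by have := IH _ (avg_pinched i (ltW e0) rp); rewrite /=; lra.
Qed.

Lemma entropy_duality rho : gau.-integrable setT (fun x => (u x ^+ 2)%:E) ->
  \int[gau]_x (u x ^+ 2) = 1 -> pinched e M rho ->
  \int[gau]_x (u x ^+ 2 * ln (rho x)) <= ln (\int[gau]_x rho x) + \sum_i B i.
Proof.
move=> ui u1 rp; have := entropy_telescope (enum 'I_n.+1) rp.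
rewrite big_enum /=; congr (_ <= _ + _).
under eq_Rintegral do rewrite (avgs_enum _ (ltW e0) rp) mulrC.
by rewrite RintegralZl// u1 mulr1.
Qed.

End entropy_duality.

(** * Truncation and the choice of the scale *)

Section truncation.
Context (R : realType).

Definition clip (k : nat) (y : R) : R := Num.min k.+1%:R (Num.max k.+1%:R^-1 y).

Let k1 k : 1 <= k.+1%:R :> R. Proof. by rewrite ler1n. Qed.

Let kV k : k.+1%:R^-1 <= 1 :> R. Proof. by rewrite invf_le1. Qed.

Lemma clip_bounds k y : k.+1%:R^-1 <= clip k y <= k.+1%:R.
Proof. by rewrite /clip ge_min lexx le_min le_max lexx (le_trans (kV k)). Qed.

Lemma clip_gt0 k y : 0 < clip k y.
Proof. by have /andP[+ _] := clip_bounds k y; apply: lt_le_trans; rewrite invr_gt0. Qed.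

Lemma clip_le_add k y : 0 <= y -> clip k y <= y + k.+1%:R^-1.
Proof.
by move=> y0; rewrite /clip ge_min ge_max lerDr y0 lerDl invr_ge0 ler0n orbT.
Qed.

Lemma clip_ge1 k y : 1 <= y -> 1 <= clip k y <= y.
Proof.
move=> y1; have ky : k.+1%:R^-1 <= y by exact: le_trans (kV k) y1.
by rewrite /clip (max_idPr ky) le_min y1 k1/= ge_min lexx orbT.
Qed.

Lemma clip_le1 k y : y <= 1 -> y <= clip k y <= 1.
Proof.
move=> y1; rewrite /clip le_min le_max lexx orbT andbT (le_trans y1 (k1 k))/=.
by rewrite ge_min ge_max y1 kV orbT.
Qed.

Lemma clip_entropy_ge k y : 0 <= y -> 0 <= y * ln (clip k y) + 1.
Proof.
rewrite le_eqVlt => /predU1P[<-|y0]; first by rewrite mul0r add0r.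
have [y1|/ltW y1] := leP y 1.
  have /andP[yc _] := clip_le1 k y1.
  have ln1 : ln y <= ln (clip k y) by rewrite ler_ln ?posrE ?clip_gt0.
  have ln2 : - ln y <= y^-1 - 1.
    rewrite -lnV ?posrE// -[X in ln X](subrKC 1); apply: le_ln1Dx.
    by rewrite ltrBrDl subrr invr_gt0.
  have : y * - ln (clip k y) <= y * (y^-1 - 1) by rewrite ler_pM2l// (le_trans _ ln2)// lerN2.
  rewrite mulrBr divff ?gt_eqF//; lra.
have /andP[c1 _] := clip_ge1 k y1.
by rewrite addr_ge0// mulr_ge0 ?(ltW y0)// ln_ge0.
Qed.

Lemma clip_entropy_norm k y : 0 <= y -> `|y * ln (clip k y)| <= `|y * ln y|.
Proof.
rewrite le_eqVlt => /predU1P[<-|y0]; first by rewrite !mul0r.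
rewrite !normrM; apply: ler_wpM2l; first exact: normr_ge0.
have [y1|/ltW y1] := leP y 1.
  have /andP[yc c1] := clip_le1 k y1.
  have ln1 : ln y <= ln (clip k y) by rewrite ler_ln ?posrE ?clip_gt0.
  have ln0 : ln (clip k y) <= 0 by rewrite ln_le0.
  by rewrite !ler0_norm ?lerN2// (le_trans ln1).
have /andP[c1 cy] := clip_ge1 k y1.
have ln1 : ln (clip k y) <= ln y by rewrite ler_ln ?posrE ?clip_gt0.
have ln0 : 0 <= ln (clip k y) by rewrite ln_ge0.
by rewrite !ger0_norm// (le_trans ln0).
Qed.

Lemma clip_entropy_cvg y : 0 <= y -> y * ln (clip k y) @[k --> \oo] --> y * ln y.
Proof.
rewrite le_eqVlt => /predU1P[<-|y0].
  by rewrite mul0r; under eq_fun do rewrite mul0r; exact: cvg_cst.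
apply: cvg_near_cst; near=> k; congr (_ * ln _).
have yk : y <= k.+1%:R.
  by apply: le_trans (_ : k%:R <= _); [near: k; exact: nbhs_infty_ger|rewrite ler_nat].
have yk' : k.+1%:R^-1 <= y.
  rewrite -[leRHS]invrK lef_pV2 ?posrE ?invr_gt0//.
  by apply: le_trans (_ : k%:R <= _); [near: k; exact: nbhs_infty_ger|rewrite ler_nat].
by rewrite /clip (max_idPr yk') (min_idPr yk).
Unshelve. all: by end_near. Qed.

Lemma measurable_clip k (d : measure_display) (T : measurableType d) (f : T -> R) :
  measurable_fun setT f -> measurable_fun setT (fun x => clip k (f x)).
Proof.
by move=> mf; apply: measurable_minr => //; exact: measurable_maxr.
Qed.

End truncation.

Section scaled_entropy.
Context (R : realType) (n : nat).
Local Notation gau := (gauss_measure R n.+1).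

(** The dual bound applied to the truncations of u^2, whose means tend to 1. It bounds the integrals of u^2 ln (clip k (u^2)), which are at least - 1 pointwise, so that Fatou's lemma gives the integrability of u^2 ln u^2; this function then dominates the truncated ones and the limit can be taken. *)
Lemma scaled_entropy_bound (u : 'rV[R]_n.+1 -> R) (G : 'rV[R]_n.+1 -> 'rV[R]_n.+1) :
  measurable_fun setT u -> (forall i, measurable_fun setT (fun x => G x 0 i)) ->
  is_weak_gradient u G ->
  gau.-integrable setT (fun x => (u x ^+ 2)%:E) -> \int[gau]_x (u x ^+ 2) = 1 ->
  (forall i, gau.-integrable setT (fun x => (x 0 i ^+ 2 * u x ^+ 2)%:E)) ->
  \sum_i \int[gau]_x (x 0 i ^+ 2 * u x ^+ 2) = n.+1%:R ->
  (forall i, gau.-integrable setT (fun x => (G x 0 i ^+ 2)%:E)) ->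
  gau.-integrable setT (fun x => (u x ^+ 2 * ln (u x ^+ 2))%:E) /\
  forall l, 0 < l -> \int[gau]_x (u x ^+ 2 * ln (u x ^+ 2)) <=
    2 * l ^+ 2 * (\sum_i \int[gau]_x (G x 0 i ^+ 2)) +
    n.+1%:R * ((l ^+ 2 - 1) / 2 - ln l).
Proof.
move=> mu mG wg ui u1 xi x1 Gi.
pose H k x := u x ^+ 2 * ln (clip k (u x ^+ 2)).
pose Bd l := 2 * l ^+ 2 * (\sum_i \int[gau]_x (G x 0 i ^+ 2)) +
    n.+1%:R * ((l ^+ 2 - 1) / 2 - ln l).
have mu2 : measurable_fun setT (fun x => u x ^+ 2) by exact: measurable_funX.
have cp k : pinched k.+1%:R^-1 k.+1%:R (fun x => clip k (u x ^+ 2)).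
  by split; [exact: measurable_clip|move=> x; exact: clip_bounds].
have ci (c : R) : gau.-integrable setT (fun x => c%:E) by exact: finite_measure_integrable_cst.
have intc (c : R) : \int[gau]_x c = c.
  rewrite Rintegral_cst// [fine _](_ : _ = 1) ?mulr1//.
  exact: (congr1 fine (gauss_measureT R n.+1)).
have bE l : \sum_i (2 * l ^+ 2 * \int[gau]_x (G x 0 i ^+ 2) + \int[gau]_x (u x ^+ 2 * bterm l (x 0 i)))
    = Bd l.
  rewrite big_split/= -mulr_sumr; congr (_ + _).
  have e i : \int[gau]_x (u x ^+ 2 * bterm l (x 0 i)) =
      (1 - l ^+ 2) / 2 * \int[gau]_x (x 0 i ^+ 2 * u x ^+ 2) + (l ^+ 2 - 1 - ln l).
    transitivity (\int[gau]_x ((1 - l ^+ 2) / 2 * (x 0 i ^+ 2 * u x ^+ 2) + (l ^+ 2 - 1 - ln l) * u x ^+ 2)).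
      by apply: eq_Rintegral => x _; rewrite /bterm; ring.
    have h1 := integrable_Zl measurableT ((1 - l ^+ 2) / 2) (xi i).
    have h2 := integrable_Zl measurableT (l ^+ 2 - 1 - ln l) ui.
    by rewrite (RintegralD measurableT h1 h2) (RintegralZl _ measurableT (xi i)) (RintegralZl _ measurableT ui) u1 mulr1.
  under eq_bigr do rewrite e.
  by rewrite big_split/= -mulr_sumr x1 sumr_const card_ord -mulr_natl; field.
have dual k l : 0 < l -> \int[gau]_x H k x <= Bd l + ln (1 + k.+1%:R^-1).
  move=> l0; have e0 : 0 < k.+1%:R^-1 :> R by rewrite invr_gt0.
  have := entropy_duality e0 (fun i rho rp => entropy_line_step mu (mG i) wg ui (xi i) (Gi i) e0 rp l0) ui u1 (cp k).
  move/le_trans; apply; rewrite bE addrC lerD2l.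
  have cI := pinched_integrable (ltW e0) (cp k).
  rewrite ler_ln ?posrE.
  - have h := integrable_add measurableT ui (ci k.+1%:R^-1).
    have -> : 1 + k.+1%:R^-1 = \int[gau]_x (u x ^+ 2 + k.+1%:R^-1).
      by rewrite (RintegralD measurableT ui (ci _)) u1 intc.
    by apply: (le_Rintegral measurableT cI h) => x _; exact: clip_le_add (sqr_ge0 _).
  - apply: (lt_le_trans e0); rewrite -[leLHS]intc.
    by apply: (le_Rintegral measurableT (ci _) cI) => x _; have /andP[] := clip_bounds k (u x ^+ 2).
  - by rewrite addr_gt0.
have Hi k : gau.-integrable setT (fun x => (H k x)%:E).
  apply: (integrable_bounded_mul (M := ln k.+1%:R) measurableT) => //.
    by apply: measurableT_comp => //; exact: measurable_clip.
  move=> x _; have /andP[h1 h2] := clip_bounds k (u x ^+ 2).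
  have c0 := clip_gt0 k (u x ^+ 2).
  rewrite ler_norml -lnV ?posrE// !ler_ln ?posrE ?invr_gt0// h2 andbT//.
have ei : gau.-integrable setT (fun x => (u x ^+ 2 * ln (u x ^+ 2))%:E).
  have ei1 : gau.-integrable setT (fun x => (u x ^+ 2 * ln (u x ^+ 2) + 1)%:E).
    apply: (fatou_integrable (f := fun k x => H k x + 1) (C := Bd 1 + ln 2 + 1)) => [k|k x|x|k].
    - exact: integrable_add.
    - exact: clip_entropy_ge (sqr_ge0 _).
    - by apply: cvgD; [exact: clip_entropy_cvg (sqr_ge0 _)|exact: cvg_cst].
    - rewrite (RintegralD measurableT (Hi k) (ci 1)) intc lerD2r (le_trans (dual k 1 _))//.
      rewrite lerD2l ler_ln ?posrE ?addr_gt0//.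
      by rewrite -[leRHS]/(1 + 1) lerD2l invf_le1// ler1n.
  have -> : (fun x => (u x ^+ 2 * ln (u x ^+ 2))%:E) = (fun x => (u x ^+ 2 * ln (u x ^+ 2) + 1 - 1)%:E).
    by apply/funext => x; rewrite addrK.
  exact: integrable_sub.
split=> // l l0.
have mE : measurable_fun setT (fun x => u x ^+ 2 * ln (u x ^+ 2)) by exact: integrable_meas ei.
have ni : gau.-integrable setT (fun x => `|u x ^+ 2 * ln (u x ^+ 2)|%:E) by exact (integrable_norm ei).
have [_ cvH] := Rintegral_cvg_everywhere measurableT (fun k => integrable_meas (Hi k))
  (fun x _ => clip_entropy_cvg (sqr_ge0 (u x))) ni (fun k x _ => clip_entropy_norm k (sqr_ge0 (u x))).
have cvB : Bd l + ln (1 + k.+1%:R^-1) @[k --> \oo] --> Bd l.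
  have e : Bd l = Bd l + ln (1 + 0) by rewrite addr0 ln1 addr0.
  rewrite [X in _ --> X]e; apply: cvgD; first exact: cvg_cst.
  apply: continuous_cvg; first by apply: continuous_ln; rewrite addr0.
  by apply: cvgD; [exact: cvg_cst|exact: cvg_harmonic].
by apply: (ler_cvg_to cvH cvB); apply: nearW => k; exact: dual.
Qed.

End scaled_entropy.

Lemma optimal_scale (R : realType) (d E I : R) : 0 < d -> 0 <= I ->
  (forall l, 0 < l -> E <= 2 * l ^+ 2 * I + d * ((l ^+ 2 - 1) / 2 - ln l)) ->
  d / 4 * (expR (2 * E / d) - 1) <= I.
Proof.
(* the bound is least at l^2 = 1 / a *)
move=> d0 I0 H; pose a := 1 + 4 * I / d.
have a1 : 1 <= a by rewrite lerDl divr_ge0 ?mulr_ge0// ltW.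
have a0 : 0 < a by exact: lt_le_trans a1.
have l0 : 0 < expR (- ln a / 2) by exact: expR_gt0.
have := H _ l0; rewrite expRK.
have -> : expR (- ln a / 2) ^+ 2 = a^-1.
  by rewrite expr2 -expRD -splitr expRN lnK.
have -> : 2 * a^-1 * I + d * ((a^-1 - 1) / 2 - - ln a / 2) = d / 2 * ln a.
  rewrite /a; field; rewrite gt_eqF//=; apply/eqP => h.
  have : d * a = 0 by rewrite /a mulrDr mulr1 [d * (_ / d)]mulrC divfK ?gt_eqF//; lra.
  by move/eqP; rewrite mulf_eq0 !gt_eqF.
move=> Ea; have le : 2 * E / d <= ln a by rewrite ler_pdivrMr//; lra.
have : expR (2 * E / d) <= a by rewrite -[leRHS](@lnK R a)// ler_expR.
move=> ea; rewrite -(ler_pM2l (_ : 0 < 4 / d)) ?divr_gt0//.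
rewrite mulrA (_ : 4 / d * (d / 4) = 1) ?mul1r; last by field; rewrite gt_eqF.
rewrite lerBlDl (le_trans ea)// /a lerD2l le_eqVlt; apply/orP; left; apply/eqP; field.
by rewrite gt_eqF.
Qed.

Theorem proposition1 (R : realType) (d : nat) (hd : (1 <= d)%N)
    (u : 'rV[R]_d -> R) (hu : H1_gauss u)
    (hu1 : (\int[gauss_measure R d]_x (`|u x| ^+ 2)%:E = 1%:E)%E)
    (hu2 : (\int[gauss_measure R d]_x (enorm x ^+ 2 * `|u x| ^+ 2)%:E
            = d%:R%:E)%E) :
  (\int[gauss_measure R d]_x (enorm (weak_gradient u x) ^+ 2)%:E
     - (1 / 2)%:E
       * \int[gauss_measure R d]_x (`|u x| ^+ 2 * ln (`|u x| ^+ 2))%:E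
   >= (varphi d (\int[gauss_measure R d]_x
                   (`|u x| ^+ 2 * ln (`|u x| ^+ 2)))%R)%:E)%E.
Proof.
case: d hd u hu hu1 hu2 => [//|n] _ u [uL [g wg] GL] u1 x1.
pose G := weak_gradient u.
have wG : is_weak_gradient u G by rewrite /G /weak_gradient; case: xgetP => [h _ //|/(_ g)].
have mu : measurable_fun setT u by have := sub_Lfun_mfun uL; rewrite inE.
have mG i : measurable_fun setT (fun x => G x 0 i).
  by have := sub_Lfun_mfun (GL i); rewrite inE.
have ui : (gauss_measure R n.+1).-integrable setT (fun x => (u x ^+ 2)%:E).
  exact: Lfun2_integrable_sqr uL.
have Gi i : (gauss_measure R n.+1).-integrable setT (fun x => (G x 0 i ^+ 2)%:E).
  exact: Lfun2_integrable_sqr (GL i).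
have nu x : `|u x| ^+ 2 = u x ^+ 2 by rewrite real_normK// num_real.
have Ru1 : \int[gauss_measure R n.+1]_x (u x ^+ 2) = 1.
  by rewrite /Rintegral -[RHS]/(fine 1%:E) -u1; congr fine; apply: eq_integral => x _; rewrite nu.
have menorm : measurable_fun setT (fun x : 'rV[R]_n.+1 => enorm x ^+ 2 * u x ^+ 2).
  apply: measurable_funM; last exact: measurable_funX.
  under eq_fun do rewrite sqr_enorm.
  by apply: measurable_sum => i; apply: measurable_funX; exact: measurable_coord.
have x2 : (\int[gauss_measure R n.+1]_x (enorm x ^+ 2 * u x ^+ 2)%:E = n.+1%:R%:E)%E.
  by rewrite -x1; apply: eq_integral => x _; rewrite nu.
have xE : (gauss_measure R n.+1).-integrable setT (fun x => (enorm x ^+ 2 * u x ^+ 2)%:E).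
  apply/integrableP; split; first exact/measurable_EFinP.
  rewrite [ltLHS](_ : _ = n.+1%:R%:E) ?ltry// -x2; apply: eq_integral => x _.
  by rewrite gee0_abs// lee_fin mulr_ge0// sqr_ge0.
have xi i : (gauss_measure R n.+1).-integrable setT (fun x => (x 0 i ^+ 2 * u x ^+ 2)%:E).
  apply: (integrable_le measurableT _ _ xE).
    apply: measurable_funM; last exact: measurable_funX.
    by apply: measurable_funX; exact: measurable_coord.
  move=> x _; rewrite (ger0_norm (mulr_ge0 (sqr_ge0 _) (sqr_ge0 _))) ler_wpM2r ?sqr_ge0//.
  by rewrite sqr_enorm (bigD1 i)//= lerDl; apply: sumr_ge0 => j _; exact: sqr_ge0.
have sx : \sum_i \int[gauss_measure R n.+1]_x (x 0 i ^+ 2 * u x ^+ 2) = n.+1%:R.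
  have [_ <-] := Rintegral_sum xi; rewrite -[RHS]/(fine n.+1%:R%:E) -x2; congr fine.
  by apply: eq_integral => x _; rewrite sqr_enorm mulr_suml.
have [ei eB] := scaled_entropy_bound mu mG wG ui Ru1 xi sx Gi.
have [GI sG] := Rintegral_sum Gi.
rewrite -sG in eB.
have I0 : 0 <= \int[gauss_measure R n.+1]_x (\sum_i G x 0 i ^+ 2).
  by apply: Rintegral_ge0 => x _; apply: sumr_ge0 => i _; exact: sqr_ge0.
have := optimal_scale (ltr0Sn R n) I0 eB.
set E := \int[_]_x (u x ^+ 2 * ln (u x ^+ 2)) => H.
have -> : (\int[gauss_measure R n.+1]_x (enorm (weak_gradient u x) ^+ 2)%:E =
    (\int[gauss_measure R n.+1]_x (\sum_i G x 0 i ^+ 2))%:E)%E.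
  rewrite /Rintegral fineK; last exact: integrable_fin_num.
  by apply: eq_integral => x _; rewrite sqr_enorm.
have -> : (\int[gauss_measure R n.+1]_x (`|u x| ^+ 2 * ln (`|u x| ^+ 2)) = E)%R.
  by apply: eq_Rintegral => x _; rewrite nu.
have -> : (\int[gauss_measure R n.+1]_x (`|u x| ^+ 2 * ln (`|u x| ^+ 2))%:E = E%:E)%E.
  rewrite /E /Rintegral fineK; last exact: integrable_fin_num.
  by apply: eq_integral => x _; rewrite nu.
rewrite -EFinM -EFinB lee_fin /varphi.
have -> : n.+1%:R / 4 * (expR (2 * E / n.+1%:R) - 1 - 2 * E / n.+1%:R) =
    n.+1%:R / 4 * (expR (2 * E / n.+1%:R) - 1) - 1 / 2 * E.
  have : n.+1%:R != 0 :> R by rewrite pnatr_eq0.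
  by move: (n.+1%:R : R) => m m0; field.
exact: lerB.
Qed.
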